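(* Let $p,q$ be relatively prime integers with $|p|>q\ge 2$, let $T$ be the $(p,q)$-torus knot in $S^3$, let $r,s$ be relatively prime integers with $s\ge 2$, and let $C$ be the $(r,s)$-cabled knot over $T$. If $r$ is not an integer between $0$ and $pqs$ (that is, $r<0$ or $r>pqs$ when $p>0$, and $r>0$ or $r<pqs$ when $p<0$), then the AJ-conjecture holds for $C$: the recurrence polynomial $\alpha_C(t,M,L)$ of $C$ evaluated at $t=-1$ equals the $A$-polynomial $A_C(M,L)$ of $C$ up to multiplication by a nonzero polynomial in $M$.
   Context: Cabled knots: for a knot $K\subset S^3$, relatively prime integers $r,s$ with $s\ge2$, the $(r,s)$-cabled knot over $K$ is the knot embedded in the boundary torus of a regular neighborhood of $K$ as a curve of slope $r/s$ with respect to the meridian/longitude coordinates of $K$ ($s$ is the winding number along $K$). The $(p,q)$-torus knot is the $(p,q)$-cabled knot over the unknot. Colored Jones polynomial: $J_{K,n}(t)\in\mathbb Z[t^{\pm1}]$, $n\ge 1$, is the $n$-colored Jones polynomial of $K$ with the zero framing, normalized so that for the unknot $U$, $J_{U,n}(t)=\frac{t^{2n}-t^{-2n}}{t^2-t^{-2}}$; it is extended to all $n\in\mathbb Z$ by $J_{K,-n}:=-J_{K,n}$ (so $J_{K,0}=0$). In this normalization the known cabling formula for the $(r,s)$-cabled knot $C$ over $K$ is, for $n\ge1$, $$J_{C,n}(t)=t^{-rs(n^2-1)}\sum_{k=-\frac{n-1}{2}}^{\frac{n-1}{2}}t^{4rk(ks+1)}J_{K,2ks+1}(t)$$ (sum in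 steps of $1$); applied with $K=U$ and $(r,s)=(p,q)$ it gives $J_{T,n}$. Recurrence polynomial: the quantum torus $\mathcal T=\mathbb C[t^{\pm1}]\langle L^{\pm1},M^{\pm1}\rangle/(LM-t^2ML)$ acts on functions $f:\mathbb Z\to\mathbb C[t^{\pm1}]$ by $(Mf)(n)=t^{2n}f(n)$, $(Lf)(n)=f(n+1)$. The recurrence ideal of $K$ is the left ideal $\mathcal A_K=\{P\in\mathcal T: P J_{K,n}(t)=0\}$, which is known to be nonzero. Let $\widetilde{\mathcal T}$ be the ring of Laurent polynomials in $L$ with coefficients rational functions of $t$ and $M$, with product $f(t,M)L^a\cdot g(t,M)L^b=f(t,M)g(t,t^{2a}M)L^{a+b}$; it is a principal left ideal domain. The left ideal $\widetilde{\mathcal A}_K=\widetilde{\mathcal T}\mathcal A_K$ has a generator lying in $\mathcal A_K$ of the form $\alpha_K(t,M,L)=\sum_{i=0}^d P_iL^i$ with $d$ minimal and $P_0,\dots,P_d\in\mathbb Z[t,M]$ coprime in $\mathbb Z[t,M]$; it is unique up to sign and is called the (normalized) recurrence polynomial of $K$. $A$-polynomial: $A_K(M,L)\in\mathbb Z[M,L]$ is the $A$-polynomial of Cooper–Culler–Gillet–Long–Shalen, with no repeated factors and relatively prime integer coefficients, well defined up to sign, and with the convention that it always contains the factor $L-1$. For $C$ the $(r,s)$-cabled knot over the $(p,q)$-torus knot, it is known (Ni–Zhang) that $$A_C(M,L)=\begin{cases}(L-1)F_{(r,s)}(M,L)F_{(p,q)}(M^{s^2},L),& s\text{ odd},\\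 (L-1)F_{(r,s)}(M,L)G_{(p,q)}(M^{s^2},L),& s\text{ even},\end{cases}$$ where for relatively prime $(p,q)$ with $q\ge2$: $F_{(p,q)}(M,L)=M^{2p}L+1$ if $q=2,p>0$; $L+M^{-2p}$ if $q=2,p<0$; $M^{2pq}L^2-1$ if $q>2,p>0$; $L^2-M^{-2pq}$ if $q>2,p<0$; and $G_{(p,q)}(M,L)=M^{pq}L-1$ if $p>0$; $L-M^{-pq}$ if $p<0$. *)

(* Defs.v *)
From HB Require Import structures.
From mathcomp Require Import all_boot all_order all_algebra.
From mathcomp Require Import finmap generic_quotient fraction reals complex monalg.

Set Implicit Arguments.
Unset Strict Implicit.
Unset Printing Implicit Defensive.

Import Order.TTheory GRing.Theory Num.Theory.
Local Open Scope ring_scope.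

Notation "x %:F" := (@FracField.tofrac _ x) : ring_scope.

(* C(t), which contains C[t^{+-1}], and the rational functions in t and M.     *)
Notation ratt R := {fraction {poly R[i]}}.
Notation rattM R := {fraction {poly ratt R}}.

Section RationalFunctions.
Variable R : realType.

Definition tvar : ratt R := ('X : {poly R[i]})%:F.

Definition is_zlaurent (f : ratt R) : Prop :=
  exists (P : {poly int}) (m : nat),
    f = (map_poly intr P : {poly R[i]})%:F / tvar ^+ m.

Definition of_ratt (c : ratt R) : rattM R := (c%:P)%:F.

Definition Mvar : rattM R := ('X : {poly ratt R})%:F.

(* g(t, M) |-> g(t, t^{2a} M).  The substitution is injective on polynomials   *)
(* in M, so that the result does not depend on the representative.             *)
Definition shiftM (a : int) (g : rattM R) : rattM R :=
  let sub (P : {poly ratt R}) := P \Po (tvar ^ (2 * a) *: 'X) in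
  (sub (\n_(repr g)))%:F / (sub (\d_(repr g)))%:F.

End RationalFunctions.

(* The quantum torus T: the coefficient at (i, b, a) is that of t^i M^b L^a.   *)
Notation qtorus R := (malg (int * int * int)%type R[i]).

(* The localized torus T~: the coefficient at a is that of L^a, and the        *)
(* product is locmul below.                                                    *)
Notation loctorus R := (malg int (rattM R)).

Section RecurrencePolynomial.
Variable R : realType.

Definition qact (P : qtorus R) (f : int -> ratt R) (n : int) : ratt R :=
  \sum_(k <- msupp P)
    (P@_k)%:P%:F * tvar R ^ (k.1.1 + 2 * k.1.2 * n) * f (n + k.2).

Definition locmul (u v : loctorus R) : loctorus R :=
  \sum_(a <- msupp u) \sum_(b <- msupp v)
    << u@_a * shiftM a v@_b *g a + b >>.

Definition torus_to_loc (P : qtorus R) : loctorus R :=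
  \sum_(k <- msupp P)
    << of_ratt ((P@_k)%:P%:F * tvar R ^ k.1.1) * Mvar R ^ k.1.2 *g k.2 >>.

Definition recurrence_ideal (f : int -> ratt R) (P : qtorus R) : Prop :=
  forall n : int, qact P f n = 0.

(* The left ideal T~ A of T~, for A the recurrence ideal of f.                 *)
Definition loc_recurrence_ideal (f : int -> ratt R) (u : loctorus R) : Prop :=
  exists (k : nat) (x : 'I_k -> loctorus R) (P : 'I_k -> qtorus R),
    (forall i, recurrence_ideal f (P i)) /\
    u = \sum_(i < k) locmul (x i) (torus_to_loc (P i)).

(* Polynomials in Z[t, M, L] are nested: L is the outermost variable, t the    *)
(* innermost one, so that al`_l is the coefficient P_l of L^l.                 *)
Definition poly_to_torus (al : {poly {poly {poly int}}}) : qtorus R :=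
  \sum_(l < size al) \sum_(m < size al`_l) \sum_(i < size al`_l`_m)
    << (al`_l`_m`_i)%:~R *g (i%:Z, m%:Z, l%:Z) >>.

Definition ideal_generator (f : int -> ratt R)
    (al : {poly {poly {poly int}}}) : Prop :=
  recurrence_ideal f (poly_to_torus al) /\
  forall u : loctorus R, loc_recurrence_ideal f u <->
    exists x, u = locmul x (torus_to_loc (poly_to_torus al)).

Definition coprime_coefs (al : {poly {poly {poly int}}}) : Prop :=
  forall c : {poly {poly int}},
    (forall l : nat, exists e, al`_l = c * e) -> c = 1 \/ c = -1.

Definition is_recurrence_polynomial (f : int -> ratt R)
    (al : {poly {poly {poly int}}}) : Prop :=
  [/\ ideal_generator f al,
      forall be, ideal_generator f be -> (size al <= size be)%N
    & coprime_coefs al].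

End RecurrencePolynomial.

Definition eval_t_m1 (al : {poly {poly {poly int}}}) : {poly {poly int}} :=
  map_poly (map_poly (horner_eval (-1))) al.

Section NiZhangFactors.

(* In Z[M, L], M is the inner variable and L the outer one.                    *)
Definition Mpow (k : int) : {poly {poly int}} := ('X^(`|k|%N))%:P.

Definition Lvar : {poly {poly int}} := 'X.

Definition Ffactor (p q : int) : {poly {poly int}} :=
  if q == 2 then
    if 0 < p then Mpow (2 * p) * Lvar + 1 else Lvar + Mpow (- (2 * p))
  else
    if 0 < p then Mpow (2 * p * q) * Lvar ^+ 2 - 1
    else Lvar ^+ 2 - Mpow (- (2 * p * q)).

Definition Gfactor (p q : int) : {poly {poly int}} :=
  if 0 < p then Mpow (p * q) * Lvar - 1 else Lvar - Mpow (- (p * q)).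

Definition substM (k : int) (B : {poly {poly int}}) : {poly {poly int}} :=
  map_poly (fun c : {poly int} => c \Po 'X^(`|k|%N)) B.

Definition NiZhang_apoly (p q r s : int) : {poly {poly int}} :=
  (Lvar - 1) * Ffactor r s *
  substM (s ^+ 2) (if (2 %| s)%Z then Gfactor p q else Ffactor p q).

End NiZhangFactors.

(* Knots in S^3 up to isotopy, with the colored Jones polynomial and the       *)
(* A-polynomial, are not constructed.  They enter through this interface: the  *)
(* unknot, the (r, s)-cabled knot "cable r s K", and the facts on the two      *)
(* invariants which are known for the actual objects, namely the               *)
(* normalization and the cabling formula of the colored Jones polynomial, and  *)
(* the theorem of Ni and Zhang on the A-polynomial (well defined up to sign)   *)
(* of cabled knots over nontrivial torus knots.                                *)
(* In the cabling formula j stands for 2k, where k runs over the half-integers *)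
(* -(n-1)/2, ..., (n-1)/2: thus t^{4rk(ks+1)} = t^{rj(js+2)}, 2ks+1 = js+1.    *)
Record knot_theory (R : realType) := KnotTheory {
  knot : Type;
  unknot : knot;
  cable : int -> int -> knot -> knot;
  jones : knot -> int -> ratt R;
  apoly : knot -> {poly {poly int}};
  jones_laurent : forall K n, is_zlaurent (jones K n);
  jones_opp : forall K n, jones K (- n) = - jones K n;
  jones_unknot : forall n : int, 1 <= n ->
    jones unknot n =
      (tvar R ^ (2 * n) - tvar R ^ (- (2 * n))) / (tvar R ^ 2 - tvar R ^ (- 2));
  jones_cable : forall (K : knot) (r s : int), coprimez r s -> 2 <= s ->
    forall n : nat, (1 <= n)%N ->
    jones (cable r s K) n%:Z =
      tvar R ^ (- (r * s * (n%:Z ^+ 2 - 1))) *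
      \sum_(i < n) (let j := 2 * i%:Z - (n%:Z - 1) in
                    tvar R ^ (r * j * (j * s + 2)) * jones K (j * s + 1));
  apoly_cable : forall p q r s : int,
    coprimez p q -> 2 <= q -> q < `|p| -> coprimez r s -> 2 <= s ->
    let A := apoly (cable r s (cable p q unknot)) in
    A = NiZhang_apoly p q r s \/ A = - NiZhang_apoly p q r s
}.

Arguments cable {R} KT r s K : rename.
Arguments unknot {R} KT : rename.
Arguments jones {R} KT K n : rename.
Arguments apoly {R} KT K : rename.

Definition torus_knot (R : realType) (KT : knot_theory R) (p q : int) : knot KT :=
  cable KT p q (unknot KT).

(* The recurrence polynomial is only defined up to sign; the statement is that *)
(* it exists and that every choice of it specializes to the A-polynomial.      *)
Definition AJ_conjecture (R : realType) (KT : knot_theory R) (K : knot KT) : Prop :=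
  (exists al, is_recurrence_polynomial (jones KT K) al) /\
  forall al, is_recurrence_polynomial (jones KT K) al ->
    exists2 B : {poly int}, B != 0 & eval_t_m1 al = B%:P * apoly KT K.

Arguments AJ_conjecture {R} KT K.

(* Main.v *)
Require Import Defs.
From HB Require Import structures.
From mathcomp Require Import all_boot all_order all_algebra.
From mathcomp Require Import finmap generic_quotient fraction reals boolp complex monalg.
From mathcomp Require Import ring lra zify.

Set Implicit Arguments.
Unset Strict Implicit.
Unset Printing Implicit Defensive.

Import Order.TTheory GRing.Theory Num.Theory.
Local Open Scope ring_scope.

(** Let [U], [T] and [C] be the colored Jones functions of the unknot, of the torus knot
    and of its cable, [M = t^(2n)], and [h(n) = T((n+1)s-1)].

    A recurrence.  The cabling sums for two neighbouring colors differ by their extreme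
    terms only ([cable_rec2], [cable_rec1]).  For [C] this gives
    [(L^d1 - u1) C = g] with [g = A h + w] ([cable_relation]), and for [T], iterated along
    the progression of [h], it gives [(L^d2 - u2) h = z] ([slice_relation]).  Here [d1] and
    [d2] are [1] or [2], [u1] and [u2] are monomials in [t] and [M] up to sign, and [A],
    [w], [z] are Laurent polynomials in [t] and [M], up to a denominator in [t].
    Eliminating [h] between [g(n)] and [g(n+d2)] gives a Laurent sequence
    [b(n) = A(n) g(n+d2) - u2(n) A(n+d2) g(n)], and
    [(b(n) L - b(n+1)) (A(n) L^d2 - u2(n) A(n+d2)) (L^d1 - u1)] annihilates [C].  At
    [t = -1] the variables [L] and [M] commute, and this becomes a polynomial in [M] times
    [(L - 1) (L^d2 - u2) (L^d1 - u1)], which is the A-polynomial up to a power of [M]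
    ([recurrence_operator]).  That [b] is not zero is seen at [t = 1], where every colored
    Jones polynomial takes the value [n].

    Minimality.  By division with remainder ([skew_division], [order_ge_step]) no operator
    of order less than [d1 + d2 + 1] annihilates [C] as soon as the [d1] shifts of [C] are
    linearly independent modulo the span of the shifts of [h] and of [1], over the Laurent
    polynomials in [M], and the same holds for [h] modulo [1].  Take the valuation of
    [K = C(t)] at [t = 0] or at [t = infinity].  Laurent polynomials in [M] have values which
    are affine in [n]; those of [h] are bounded below by [- |p| q s^2 n^2] or by an affine
    function, according to the valuation; and if [r] is not between [0] and [p q s], then
    for one of the two valuations the value of [C(n)] decreases strictly faster, like
    [- |r| s n^2] ([cable_half]).  This settles the case [d1 = 1].  For [d1 = 2] the value
    of [C(n)] is known exactly for odd [n], and it is larger than the same quadratic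
    function for even [n] ([cable_other]); a relation between [C(n)] and [C(n+1)] then
    contradicts itself for consecutive [n] ([indep2]).  The argument for [h] is the same.

    Uniqueness.  An operator of minimal order in [Z[t,M,L]] generates the localized left
    ideal ([ideal_generator_of_order]).  Two such operators are proportional over [Z[t,M]],
    their values at [t = -1] are proportional over [Z[M]] ([proportional_at_m1]), and the
    multiplier is a polynomial because the A-polynomial has no content.  The operator above
    need not be primitive; its primitive part annihilates [C] as well, because by the same
    independence a sequence [Q C] that vanishes for large [n] vanishes ([act_tame]). *)

(** * Skew polynomial operators and division *)

Lemma sum_ord_widen (V : nmodType) (F : nat -> V) (k m : nat) : (k <= m)%N ->
  (forall l, (k <= l)%N -> F l = 0) -> \sum_(l < k) F l = \sum_(l < m) F l.
Proof.
move=> le_km F0; rewrite -!(big_mkord xpredT F) (big_cat_nat (leq0n k) le_km) /=.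
by rewrite [X in _ = _ + X]big_nat [X in _ = _ + X]big1 ?addr0 // => l /andP[/F0].
Qed.

Section SkewOperators.
Variables (K : fieldType) (t : K).
Implicit Types (c d : {poly K}) (P Q X Y B S : {poly {poly K}}) (f g e : int -> K) (n : int).

(** An operator is an element of [{poly {poly K}}], with [L] as the outer variable and
    [M] as the inner one; since [M] acts on sequences as multiplication by [t^(2n)],
    this is how a coefficient in [K[M]] acts at the place [n]. *)
Definition pev (c : {poly K}) (n : int) : K := c.[t ^ (2 * n)].

Definition act (Q : {poly {poly K}}) (f : int -> K) (n : int) : K :=
  \sum_(l < size Q) pev Q`_l n * f (n + l%:Z).

(** The substitution [M := t^(2l) M], which describes the commutation of [L^l] with a
    coefficient: [L^l c = (pshift l c) L^l]. *)
Definition pshift (l : nat) (c : {poly K}) : {poly K} := c \Po (t ^+ (2 * l) *: 'X).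

(** The product of operators.  It is a bare operation on [{poly {poly K}}], whose ring
    structure is the commutative one. *)
Definition smul (X B : {poly {poly K}}) : {poly {poly K}} :=
  \sum_(l < size X) X`_l *: (map_poly (pshift l) B * 'X^l).

(** Vanishing for large [n] is all that valuations can detect, so annihilation is
    studied at the level of germs at infinity first. *)
Definition ev0 (e : int -> K) := exists n0 : int, forall n, n0 <= n -> e n = 0.

Lemma pevD c d n : pev (c + d) n = pev c n + pev d n.
Proof. exact: hornerD. Qed.

Lemma pevM c d n : pev (c * d) n = pev c n * pev d n.
Proof. exact: hornerM. Qed.

Lemma pev0 n : pev 0 n = 0.
Proof. exact: horner0. Qed.

Lemma actE m Q f n : (size Q <= m)%N ->
  act Q f n = \sum_(l < m) pev Q`_l n * f (n + l%:Z).
Proof.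
move=> le_m; apply: (sum_ord_widen (F := fun l => pev Q`_l n * f (n + l%:Z))) => // l le_l.
by rewrite nth_default // pev0 mul0r.
Qed.

Lemma act0 f n : act 0 f n = 0.
Proof. by rewrite /act size_poly0 big_ord0. Qed.

Lemma actD P Q f n : act (P + Q) f n = act P f n + act Q f n.
Proof.
pose m := maxn (size P) (size Q).
rewrite (@actE m (P + Q)%R) ?size_polyD // (@actE m P) ?leq_maxl //.
rewrite (@actE m Q) ?leq_maxr // -big_split /=.
by apply: eq_bigr => l _; rewrite coefD pevD mulrDl.
Qed.

Lemma actZ c Q f n : act (c *: Q) f n = pev c n * act Q f n.
Proof.
rewrite (@actE (size Q)) ?size_scale_leq // mulr_sumr.
by apply: eq_bigr => l _; rewrite coefZ pevM mulrA.
Qed.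

Lemma act_sum m (F : nat -> {poly {poly K}}) f n :
  act (\sum_(l < m) F l) f n = \sum_(l < m) act (F l) f n.
Proof.
elim: m => [|m IH]; first by rewrite !big_ord0 act0.
by rewrite !big_ord_recr /= actD IH.
Qed.

Lemma eq_act Q f g n : f =1 g -> act Q f n = act Q g n.
Proof. by move=> fg; apply: eq_bigr => l _; rewrite fg. Qed.

Lemma act_monomial c l f n : act (c *: 'X^l) f n = pev c n * f (n + l%:Z).
Proof.
rewrite (@actE l.+1); last first.
  by apply: leq_trans (size_scale_leq _ _) _; rewrite size_polyXn.
rewrite big_ord_recr big1 /= => [|i _].
  by rewrite add0r coefZ coefXn eqxx mulr1.
by rewrite coefZ coefXn ltn_eqF // mulr0 pev0 mul0r.
Qed.

Lemma act_eq0 Q f n : (forall k, f k = 0) -> act Q f n = 0.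
Proof. by move=> f0; rewrite /act big1 // => l _; rewrite f0 mulr0. Qed.

Hypothesis t_neq0 : t != 0.

Lemma pev_shift l c n : pev (pshift l c) n = pev c (n + l%:Z).
Proof.
rewrite /pev /pshift horner_comp hornerZ hornerX; congr (_.[_]).
by rewrite exprnP -expfzDr //; congr (_ ^ _); rewrite PoszM; ring.
Qed.

Lemma pshift0 l : pshift l 0 = 0.
Proof. exact: comp_poly0. Qed.

Lemma act_shift B l f n :
  act (map_poly (pshift l) B * 'X^l) f n = act B f (n + l%:Z).
Proof.
have sz : (size (map_poly (pshift l) B * 'X^l)%R <= l + size B)%N.
  apply: leq_trans (size_polyMleq _ _) _; rewrite size_polyXn addnS /= addnC.
  by rewrite leq_add2l size_poly.
rewrite (actE f n sz) big_split_ord /= big1 ?add0r => [|i _]; last first.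
  by rewrite coefMXn ltn_ord pev0 mul0r.
apply: eq_bigr => i _; rewrite coefMXn ltnNge leq_addr /= addKn.
by rewrite coef_map_id0 ?pshift0 // pev_shift PoszD addrA.
Qed.

Lemma act_smul X B f n : act (smul X B) f n = act X (act B f) n.
Proof.
rewrite /smul (act_sum _ (fun l => X`_l *: (map_poly (pshift l) B * 'X^l))).
by apply: eq_bigr => l _; rewrite actZ act_shift.
Qed.

Lemma smulE m X B : (size X <= m)%N ->
  smul X B = \sum_(l < m) X`_l *: (map_poly (pshift l) B * 'X^l).
Proof.
move=> le_m.
apply: (sum_ord_widen (F := fun l => X`_l *: (map_poly (pshift l) B * 'X^l))) => // l le_l.
by rewrite nth_default // scale0r.
Qed.

Lemma smulDl X Y B : smul (X + Y) B = smul X B + smul Y B.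
Proof.
pose m := maxn (size X) (size Y).
rewrite (@smulE m (X + Y)) ?size_polyD // (@smulE m X) ?leq_maxl //.
rewrite (@smulE m Y) ?leq_maxr // -big_split /=.
by apply: eq_bigr => l _; rewrite coefD scalerDl.
Qed.

Lemma smulZl c X B : smul (c *: X) B = c *: smul X B.
Proof.
rewrite (@smulE (size X)) ?size_scale_leq // scaler_sumr.
by apply: eq_bigr => l _; rewrite coefZ scalerA.
Qed.

Lemma smulXn i B : smul 'X^i B = map_poly (pshift i) B * 'X^i.
Proof.
rewrite (@smulE i.+1) ?size_polyXn // big_ord_recr big1 /= => [|l _].
  by rewrite add0r coefXn eqxx scale1r.
by rewrite coefXn ltn_eqF // scale0r.
Qed.

Lemma pshift_eq0 l c : (pshift l c == 0) = (c == 0).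
Proof.
rewrite /pshift comp_poly_eq0 // size_scale ?size_polyX //.
by rewrite expf_neq0.
Qed.

(** Pseudo-division on the right works as over a commutative ring, by cancelling
    leading coefficients; the twist only changes which shift of the leading
    coefficient of [B] appears as a multiplier. *)
Lemma skew_division B j : size B = j.+1 -> forall Q, exists (e : {poly K}) X S,
  [/\ e != 0, e *: Q = smul X B + S, (size S <= j)%N & (size X <= size Q - j)%N].
Proof.
move=> szB Q; have [m] := ubnP (size Q); elim: m Q => // m IH Q ltQ.
have [leQ|gtQ] := leqP (size Q) j.
  exists 1, 0, Q; split; rewrite ?oner_neq0 ?size_poly0 // scale1r.
  by rewrite /smul size_poly0 big_ord0 add0r.
set k := (size Q).-1; set c := lead_coef Q.
have szQ : size Q = k.+1 by rewrite prednK //; apply: leq_ltn_trans gtQ.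
have lejk : (j <= k)%N by rewrite -ltnS -szQ.
set b := pshift (k - j) (lead_coef B).
have b0 : b != 0 by rewrite pshift_eq0 lead_coef_eq0 -size_poly_eq0 szB.
set Y := smul 'X^(k - j) B; set Q1 := b *: Q - c *: Y.
have coefY i : Y`_i = if (i < k - j)%N then 0 else pshift (k - j) B`_(i - (k - j)).
  by rewrite /Y smulXn coefMXn; case: ifP => // _; rewrite coef_map_id0 ?pshift0.
have szQ1 : (size Q1 <= k)%N.
  apply/leq_sizeP => i le_ki; rewrite coefB !coefZ coefY.
  rewrite ltnNge (leq_trans (leq_subr _ _) le_ki) /=.
  have [->|ne_ik] := eqVneq i k.
    rewrite subKn // /b /lead_coef szB /= -/k /c /lead_coef szQ /=.
    by rewrite mulrC subrr.
  have lt_ki : (k < i)%N by rewrite ltn_neqAle eq_sym ne_ik.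
  rewrite [Q`_i]nth_default ?szQ // mulr0 [B`_ _]nth_default ?pshift0 ?mulr0 ?subrr //.
  by rewrite szB; lia.
have [|e1 [X1 [S [e10 E1 szS szX1]]]] := IH Q1.
  by apply: leq_ltn_trans szQ1 _; rewrite -ltnS -szQ.
exists (e1 * b), (X1 + (e1 * c) *: 'X^(k - j)), S; split=> //.
- by rewrite mulf_neq0.
- rewrite smulDl smulZl -/Y addrAC -E1 /Q1 scalerBr !scalerA -scalerA.
  by rewrite scalerA subrK.
- rewrite szQ (leq_trans (size_polyD _ _)) // geq_max; apply/andP; split.
    by apply: leq_trans szX1 _; rewrite leq_sub2r // ltnW.
  by apply: leq_trans (size_scale_leq _ _) _; rewrite size_polyXn subSn.
Qed.

Definition order_ge (k : nat) (f : int -> K) :=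
  forall Q, (size Q <= k)%N -> ev0 (act Q f) -> Q = 0.

(** Orders add up along a factorization.  Divide an annihilator [Q] of [f] on the right
    by [B]: the remainder [S], applied to [f], is minus an operator applied to [B f],
    hence vanishes by independence, and the quotient annihilates [B f]. *)
Lemma order_ge_step B j k f :
    size B = j.+1 -> order_ge k (act B f) ->
    (forall X S, (size S <= j)%N ->
       ev0 (fun n => act S f n + act X (act B f) n) -> S = 0) ->
  order_ge (j + k) f.
Proof.
move=> szB ordg indep Q szQ [n0 Q0].
have [e [X [S [e0 E szS szX]]]] := skew_division szB Q.
have S0 : S = 0.
  apply: (indep X) => //; exists n0 => n le_n.
  by rewrite addrC -act_smul -actD -E actZ Q0 ?mulr0.
have X0 : X = 0.
  apply: ordg; first by apply: leq_trans szX _; rewrite leq_subLR.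
  exists n0 => n le_n; rewrite -act_smul.
  by rewrite -[smul X B]addr0 -{1}S0 -E actZ Q0 ?mulr0.
move: E; rewrite S0 X0 addr0 /smul size_poly0 big_ord0.
by move/eqP; rewrite -mul_polyC mulf_eq0 polyC_eq0 (negbTE e0) => /eqP.
Qed.

End SkewOperators.

(** * Sequences over the Laurent polynomials in M *)

Section LaurentSequences.
Variables (K : fieldType) (t : K).
Implicit Types (c : {poly K}) (Q S : {poly {poly K}}) (f g h x y u e : int -> K) (n : int).
Implicit Types (E : (int -> K) -> Prop).
Hypothesis t_neq0 : t != 0.
Hypothesis t_inf : forall i : int, t ^ i = 1 -> i = 0.

(** The sequences given by a Laurent polynomial in [M = t^(2n)] over [K]. *)
Definition laurent x :=
  exists (N : nat) c, forall n, t ^ (2 * N%:Z * n) * x n = pev t c n.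

Lemma tD (i j : int) : t ^ i * t ^ j = t ^ (i + j).
Proof. by rewrite expfzDr. Qed.

Lemma t_expf_neq0 (i : int) : t ^ i != 0.
Proof. exact: expfz_neq0. Qed.

(** The points [t^(2n)] are pairwise distinct, so a nonzero polynomial in [M] has
    finitely many zeros among them. *)
Lemma pev_ev0 c : ev0 (pev t c) -> c = 0.
Proof.
move=> [n0 c0]; pose r := [seq t ^ (2 * (n0 + i%:Z)) | i <- iota 0 (size c)].
apply: (@roots_geq_poly_eq0 _ _ r); last by rewrite size_map size_iota.
  by apply/allP => _ /mapP[i _ ->]; apply/eqP/c0; lia.
rewrite map_inj_uniq ?iota_uniq // => i j eq_ij.
have /t_inf : t ^ (2 * (n0 + i%:Z) - 2 * (n0 + j%:Z)) = 1.
  by rewrite -tD eq_ij tD subrr expr0z.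
by lia.
Qed.

Lemma eq_laurent x y : x =1 y -> laurent x -> laurent y.
Proof. by move=> xy [N [c cE]]; exists N, c => n; rewrite -xy. Qed.

Lemma pev_Xn N c n : pev t (c * 'X^N) n = t ^ (2 * N%:Z * n) * pev t c n.
Proof.
rewrite /pev hornerM hornerXn mulrC; congr (_ * _).
by rewrite exprnP exprz_exp; congr (_ ^ _); ring.
Qed.

Lemma laurentD x y : laurent x -> laurent y -> laurent (fun n => x n + y n).
Proof.
move=> [N [c cE]] [N' [c' cE']]; exists (N + N')%N, (c * 'X^N' + c' * 'X^N) => n.
rewrite pevD !pev_Xn -cE -cE' mulrDr !mulrA !tD PoszD.
by congr (t ^ _ * _ + t ^ _ * _); ring.
Qed.

Lemma laurentM x y : laurent x -> laurent y -> laurent (fun n => x n * y n).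
Proof.
move=> [N [c cE]] [N' [c' cE']]; exists (N + N')%N, (c * c') => n.
rewrite pevM -cE -cE' PoszD mulrACA tD.
by congr (t ^ _ * _); ring.
Qed.

Lemma laurent_pev c : laurent (pev t c).
Proof. by exists 0%N, c => n; rewrite mulr0 mul0r expr0z mul1r. Qed.

Lemma laurent_cst (a : K) : laurent (fun=> a).
Proof.
by apply: eq_laurent (laurent_pev a%:P) => n; rewrite /pev hornerC.
Qed.

Lemma laurent_shift x : laurent x -> laurent (fun n => x (n + 1)).
Proof.
move=> [N [c cE]]; exists N, (t ^ (- (2 * N%:Z)) *: pshift t 1 c) => n.
rewrite /pev hornerZ -/(pev _ _ _) (pev_shift t_neq0) -cE mulrA tD.
by congr (t ^ _ * _); ring.
Qed.

Lemma laurent_mono (a b : int) : laurent (fun n => t ^ (2 * a * n + b)).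
Proof.
exists (`|a|)%N, (t ^ b *: 'X^(`|a + `|a|%:Z|)) => n.
rewrite /pev hornerZ hornerXn exprnP exprz_exp !tD.
by congr (t ^ _); rewrite (_ : `|(a + `|a|%:Z)%R|%:Z = a + `|a|%:Z); [ring | lia].
Qed.

Lemma laurent_ev0 x : laurent x -> ev0 x -> forall n, x n = 0.
Proof.
move=> [N [c cE]] [n0 x0] n.
have c0 : c = 0.
  by apply: pev_ev0; exists n0 => m lem; rewrite -cE x0 ?mulr0.
have /eqP := cE n; rewrite c0 pev0 mulf_eq0 (negbTE (t_expf_neq0 _)) /=.
by move/eqP.
Qed.

(** The modules over the Laurent sequences which every operator preserves.  The spans
    below and the classes of sequences of bounded growth are of this kind, and
    independence modulo a span is obtained from independence modulo a growth class. *)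
Record seq_module E : Prop := SeqModule {
  seq_module_ext : forall e e', e =1 e' -> E e -> E e';
  seq_moduleD : forall e e', E e -> E e' -> E (fun n => e n + e' n);
  seq_moduleM : forall x e, laurent x -> E e -> E (fun n => x n * e n);
  seq_module_shift : forall e, E e -> E (fun n => e (n + 1)) }.

Lemma laurent_module : seq_module laurent.
Proof.
split; [exact: eq_laurent|exact: laurentD|exact: laurentM|exact: laurent_shift].
Qed.

Lemma seq_module_shiftn E e (l : nat) : seq_module E -> E e -> E (fun n => e (n + l%:Z)).
Proof.
move=> EM Ee; elim: l => [|l IH].
  by apply: (seq_module_ext EM) Ee => n; rewrite addr0.
apply: (seq_module_ext EM) (seq_module_shift EM IH) => n /=.
by congr (e _); lia.
Qed.

Lemma seq_module_act E Q e : seq_module E -> E e -> E (act t Q e).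
Proof.
move=> EM Ee; rewrite /act; have Es l := seq_module_shiftn l EM Ee.
elim: (size Q) => [|m IH].
  apply: (seq_module_ext EM) (seq_moduleM EM (laurent_cst 0) Ee) => n.
  by rewrite big_ord0 mul0r.
apply: (seq_module_ext EM) => [n|]; first by rewrite big_ord_recr.
apply: (seq_moduleD EM IH).
exact: (seq_moduleM EM (laurent_pev Q`_m) (Es m)).
Qed.

Definition span (d : nat) f E e := exists rho : nat -> int -> K,
  (forall i, laurent (rho i)) /\ exists e', E e' /\
  forall n, e n = \sum_(i < d) rho i n * f (n + i%:Z) + e' n.

(** The recurrence expresses [L^(d+1) f] by [f] modulo [E], which makes the span of
    [d+1] consecutive shifts stable under [L]. *)
Lemma span_module (d : nat) f E u g : seq_module E -> laurent u -> E g ->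
  (forall n, f (n + d.+1%:Z) = u n * f n + g n) -> seq_module (span d.+1 f E).
Proof.
move=> EM uL Eg rec; split.
- move=> e e' ee' [rho [rhoL [e1 [Ee1 e1E]]]]; exists rho; split=> //.
  by exists e1; split=> // n; rewrite -ee'.
- move=> e e' [rho [rhoL [e1 [Ee1 eE]]]] [rho' [rhoL' [e1' [Ee1' eE']]]].
  exists (fun i n => rho i n + rho' i n); split.
    by move=> i; apply: laurentD.
  exists (fun n => e1 n + e1' n); split; first exact: seq_moduleD.
  move=> n; rewrite eE eE' addrACA -big_split; congr (_ + _).
  by apply: eq_bigr => i _; rewrite mulrDl.
- move=> x e xL [rho [rhoL [e1 [Ee1 eE]]]].
  exists (fun i n => x n * rho i n); split; first by move=> i; apply: laurentM.
  exists (fun n => x n * e1 n); split; first exact: seq_moduleM.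
  move=> n; rewrite eE mulrDr mulr_sumr; congr (_ + _).
  by apply: eq_bigr => i _; rewrite mulrA.
move=> e [rho [rhoL [e1 [Ee1 eE]]]].
exists (fun i n => if i is i'.+1 then rho i' (n + 1) else rho d (n + 1) * u n).
split.
  by case=> [|i]; [apply: laurentM => //|]; apply: laurent_shift.
exists (fun n => rho d (n + 1) * g n + e1 (n + 1)); split.
  apply: seq_moduleD (seq_module_shift EM Ee1) => //.
  by apply: seq_moduleM => //; apply: laurent_shift.
move=> n; rewrite eE big_ord_recr big_ord_recl /= addr0.
have -> : n + 1 + d%:Z = n + d.+1%:Z by lia.
rewrite rec mulrDr mulrA.
have -> : \sum_(i < d) rho i (n + 1) * f (n + 1 + i%:Z) =
          \sum_(i < d) rho i (n + 1) * f (n + (bump 0 i)%:Z).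
  by apply: eq_bigr => i _; congr (_ * f _); rewrite /bump /=; lia.
by ring.
Qed.

Lemma span_base (d : nat) f E g : seq_module E -> E g -> span d.+1 f E f.
Proof.
move=> EM Eg; exists (fun i _ => if i is 0%N then 1 else 0).
split; first by case=> [|i]; apply: laurent_cst.
exists (fun n => 0 * g n); split; first exact: seq_moduleM (laurent_cst 0) Eg.
move=> n; rewrite big_ord_recl big1 => [|i _]; last by rewrite mul0r.
by rewrite mul1r !addr0 mul0r addr0.
Qed.

Lemma span_sub (d : nat) f E e : E e -> span d f E e.
Proof.
move=> Ee; exists (fun _ _ => 0); split; first by move=> i; apply: laurent_cst.
exists e; split=> // n; rewrite big1 ?add0r // => i _.
by rewrite mul0r.
Qed.

(** This is how an upper bound for the growth of [f] bounds everything built from [f]. *)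
Lemma span_min (d : nat) f E E' : seq_module E' -> E' f -> (forall e, E e -> E' e) ->
  forall e, span d f E e -> E' e.
Proof.
move=> EM Ef sub e [rho [rhoL [e' [Ee' eE]]]].
apply: (seq_module_ext EM (e := fun n => \sum_(i < d) rho i n * f (n + i%:Z) + e' n)) => [n|].
  by rewrite eE.
apply: (seq_moduleD EM) (sub _ Ee'); elim: (d) => [|m IH].
  apply: (seq_module_ext EM) (seq_moduleM EM (laurent_cst 0) Ef) => n.
  by rewrite big_ord0 mul0r.
apply: (seq_module_ext EM) => [n|]; first by rewrite big_ord_recr.
exact: (seq_moduleD EM IH (seq_moduleM EM (rhoL m) (seq_module_shiftn m EM Ef))).
Qed.

(** The independence of [f], ..., [L^(d-1) f] modulo [E], over the Laurent sequences,
    as germs at infinity. *)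
Definition indep (d : nat) f E := forall (rho : nat -> int -> K) e,
  (forall i, laurent (rho i)) -> E e ->
  ev0 (fun n => \sum_(i < d) rho i n * f (n + i%:Z) + e n) ->
  forall i n, (i < d)%N -> rho i n = 0.

Lemma indep_sub (d : nat) f E E' : (forall e, E e -> E' e) -> indep d f E' -> indep d f E.
Proof. by move=> sub ind rho e rhoL /sub Ee; apply: ind. Qed.

(** A sequence of a tame class can be shown to vanish by looking at large [n] only. *)
Definition tame E := forall e, E e -> ev0 e -> forall n, e n = 0.

Lemma tame_laurent : tame laurent.
Proof. by move=> e; apply: laurent_ev0. Qed.

(** Independence kills the coefficients on the shifts of [f], so a sequence of the span
    that vanishes for large [n] already lies in [E]. *)
Lemma tame_span d f E : indep d f E -> tame E -> tame (span d f E).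
Proof.
move=> ind tE e [rho [rhoL [e1 [Ee1 eE]]]] [n0 e0].
have rho0 i n : (i < d)%N -> rho i n = 0.
  apply: (ind rho e1) => //; exists n0 => m le_m.
  by rewrite -eE; apply: e0.
have ee1 n : e n = e1 n.
  by rewrite eE big1 ?add0r // => i _; rewrite rho0 ?mul0r.
move=> n; rewrite ee1; apply: tE => //; exists n0 => m le_m.
by rewrite -ee1 e0.
Qed.

Lemma indep_act (d : nat) f E e S : indep d f E -> E e -> (size S <= d)%N ->
  ev0 (fun n => act t S f n + e n) -> S = 0.
Proof.
move=> ind Ee szS [n0 S0].
apply/polyP => i; rewrite coef0.
have [lt_id|le_di] := ltnP i d; last by rewrite nth_default // (leq_trans szS).
apply: pev_ev0; exists 0 => n _.
apply: (ind (fun i => pev t S`_i) e) lt_id => //.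
  by move=> j; apply: laurent_pev.
by exists n0 => m le_m; rewrite -(actE t f m szS) S0.
Qed.

End LaurentSequences.

(** * Growth of valuations and independence *)

Section Valuation.
Variables (K : fieldType) (t : K) (v : K -> int) (eps : int).

(** A discrete valuation, stated for nonzero elements only, so that [v 0] is a dummy
    value.  At [t = 0] and at [t = infinity] the value [eps] of [t] is [1] and [-1]. *)
Record valuation : Prop := Valuation {
  val_mul : forall x y, x != 0 -> y != 0 -> v (x * y) = v x + v y;
  val_add : forall k x y, x != 0 -> y != 0 -> x + y != 0 ->
    k <= v x -> k <= v y -> k <= v (x + y);
  val_t : v t = eps }.

Hypothesis vP : valuation.
Hypothesis eps_sign : eps = 1 \/ eps = -1.
Hypothesis t_neq0 : t != 0.

(** These account for the infinite value of [0]: it exceeds every bound and is never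
    known exactly. *)
Definition val_ge (k : int) (x : K) : bool := (x == 0) || (k <= v x).
Definition val_eq (k : int) (x : K) : bool := (x != 0) && (v x == k).

Lemma val1 : v 1 = 0.
Proof.
clear eps_sign t_neq0.
have := val_mul vP (oner_neq0 K) (oner_neq0 K); rewrite mulr1; move: (v 1) => w; lia.
Qed.

Lemma valN x : v (- x) = v x.
Proof.
clear eps_sign t_neq0.
have [->|x0] := eqVneq x 0; first by rewrite oppr0.
have N10 : (-1 : K) != 0 by rewrite oppr_eq0 oner_neq0.
have := val_mul vP N10 N10; rewrite mulrNN mulr1 val1 => vN1.
by rewrite -mulN1r (val_mul vP) //; lia.
Qed.

Lemma val_geW k j x : j <= k -> val_ge k x -> val_ge j x.
Proof.
clear vP eps_sign t_neq0.
move=> le_jk /orP[x0|le_k]; apply/orP; [left|right] => //; lia.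
Qed.

Lemma val_eq_ge k x : val_eq k x -> val_ge k x.
Proof. by case/andP=> _ /eqP <-; rewrite /val_ge lexx orbT. Qed.

Lemma val_ge0 k : val_ge k 0. Proof. by rewrite /val_ge eqxx. Qed.

Lemma val_geN k x : val_ge k (- x) = val_ge k x.
Proof. by rewrite /val_ge oppr_eq0 valN. Qed.

Lemma val_geD k x y : val_ge k x -> val_ge k y -> val_ge k (x + y).
Proof.
move=> /orP[/eqP->|xk]; first by rewrite add0r.
move=> /orP[/eqP->|yk]; first by rewrite addr0 /val_ge xk orbT.
have [->|x0] := eqVneq x 0; first by rewrite add0r /val_ge yk orbT.
have [->|y0] := eqVneq y 0; first by rewrite addr0 /val_ge xk orbT.
rewrite /val_ge; have [//|xy0 /=] := eqVneq (x + y) 0.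
exact: (val_add vP).
Qed.

Lemma val_ge_sum k (I : Type) (r : seq I) (P : pred I) (F : I -> K) :
  (forall i, P i -> val_ge k (F i)) -> val_ge k (\sum_(i <- r | P i) F i).
Proof.
move=> FP; elim/big_ind: _ => //; [exact: val_ge0|exact: val_geD].
Qed.

Lemma val_geM k j x y : val_ge k x -> val_ge j y -> val_ge (k + j) (x * y).
Proof.
rewrite /val_ge mulf_eq0.
case/orP=> [->//|xk]; case/orP=> [->|yj]; first by rewrite orbT.
have [//|x0] := eqVneq x 0; have [//|y0 /=] := eqVneq y 0.
by rewrite (val_mul vP) // lerD.
Qed.

Lemma val_eqM k j x y : val_eq k x -> val_eq j y -> val_eq (k + j) (x * y).
Proof.
case/andP=> x0 /eqP<- /andP[y0 /eqP<-].
by rewrite /val_eq mulf_neq0 //= (val_mul vP).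
Qed.

Lemma val_eqN k x : val_eq k (- x) = val_eq k x.
Proof. by rewrite /val_eq oppr_eq0 valN. Qed.

Lemma val_eqD k j x y : k < j -> val_eq k x -> val_ge j y -> val_eq k (x + y).
Proof.
clear eps_sign t_neq0.
move=> lt_kj /andP[x0 /eqP xk] /orP[/eqP->|yj].
  by rewrite addr0 /val_eq x0 xk eqxx.
have [->|y0] := eqVneq y 0; first by rewrite addr0 /val_eq x0 xk eqxx.
have xy0 : x + y != 0.
  apply/eqP => /eqP; rewrite addr_eq0 => /eqP xy.
  by move: xk yj; rewrite xy valN; lia.
rewrite /val_eq xy0 /= eq_le; apply/andP; split; last first.
  by apply: (val_add vP) => //; lia.
have Ny0 : - y != 0 by rewrite oppr_eq0.
rewrite leNgt; apply/negP => gt.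
have := val_add vP (k := k + 1) xy0 Ny0; rewrite addrK valN x0 xk => /(_ isT).
by lia.
Qed.

Lemma val_eq_contra k j x : k < j -> val_eq k x -> val_ge j x -> False.
Proof.
clear vP eps_sign t_neq0. by move=> lt_kj /andP[/negbTE x0 /eqP xk]; rewrite /val_ge x0 xk; lia. Qed.

Lemma val_eq_tX (i : int) : val_eq (eps * i) (t ^ i).
Proof.
clear eps_sign.
have tn (m : nat) : val_eq (eps * m%:Z) (t ^+ m).
  elim: m => [|m IH]; first by rewrite mulr0 expr0 /val_eq oner_neq0 val1.
  rewrite exprS (_ : eps * m.+1 = eps + eps * m); last by lia.
  by apply: val_eqM => //; rewrite /val_eq t_neq0 (val_t vP) eqxx.
have [i0|i0] := lerP 0 i; first by rewrite (_ : i = `|i|%N%:Z); [exact: tn|lia].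
have [m ->] : exists m : nat, i = - m%:Z by exists `|i|%N; lia.
have /andP[tm0 /eqP tm] := tn m.
rewrite /val_eq expfz_neq0 //=.
have := val_mul vP tm0 (invr_neq0 tm0); rewrite divff // val1 tm => E.
rewrite -exprnN mulrN; move: E; move: (v _) => w E; apply/eqP; lia.
Qed.

Implicit Types (f e x : int -> K) (n : int).

(** Distinct powers of [M] have values whose difference is linear in [n], so for
    large [n] a single coefficient dominates. *)
Lemma val_pev c : c = 0 \/ exists (al be n0 : int), 0 <= eps * be /\
  forall n, n0 <= n -> val_eq (al + be * n) (pev t c n).
Proof.
elim/poly_ind: c => [|c a IH]; first by left.
have [->|a0] := eqVneq a 0.
  case: IH => [->|[al [be [n0 [be0 IH]]]]].
    by left; rewrite mul0r addr0.
  right; exists al, (be + 2 * eps), n0; split; first by case: eps_sign be0; nia.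
  move=> n le_n; rewrite addr0 /pev hornerM hornerX.
  have -> : al + (be + 2 * eps) * n = al + be * n + eps * (2 * n) by ring.
  by apply: val_eqM (IH _ le_n) (val_eq_tX _).
have va : val_eq (v a) a by rewrite /val_eq a0 eqxx.
right; case: IH => [->|[al [be [n0 [be0 IH]]]]].
  exists (v a), 0, 0; split=> [|n _]; first by rewrite mulr0.
  by rewrite !mul0r add0r addr0 /pev hornerC.
have cE n : pev t (c * 'X + a%:P) n = pev t c n * t ^ (2 * n) + a.
  by rewrite /pev hornerD hornerM hornerX hornerC.
have main n : n0 <= n -> val_eq (al + be * n + eps * (2 * n)) (pev t c n * t ^ (2 * n)).
  by move=> le_n; apply: val_eqM (IH _ le_n) (val_eq_tX _).
case: eps_sign => eps1.
  exists (v a), 0, (Num.max n0 (Num.max 1 (v a - al + 1))); split=> [|n le_n]; first by rewrite mulr0.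
  rewrite cE mul0r addr0 addrC.
  have [le1 le2 le3] : [/\ n0 <= n, 1 <= n & v a - al + 1 <= n] by split; lia.
  apply: val_eqD va (val_eq_ge (main n le1)); rewrite eps1; rewrite eps1 in be0; nia.
exists al, (be + 2 * eps), (Num.max n0 (Num.max 1 (al - v a + 1))); split=> [|n le_n].
  by rewrite eps1; rewrite eps1 in be0; lia.
have [le1 le2 le3] : [/\ n0 <= n, 1 <= n & al - v a + 1 <= n] by split; lia.
rewrite cE; have -> : al + (be + 2 * eps) * n = al + be * n + eps * (2 * n) by ring.
apply: val_eqD (main n le1) (val_eq_ge va).
by rewrite eps1; rewrite eps1 in be0; nia.
Qed.

Lemma val_laurent x : laurent t x -> (forall n, x n = 0) \/
  exists (al be n0 : int), forall n, n0 <= n -> val_eq (al + be * n) (x n).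
Proof.
move=> [N [c cE]]; case: (val_pev c) => [c0|[al [be [n0 [_ vc]]]]].
  left=> n; apply/eqP; have /eqP := cE n.
  by rewrite c0 pev0 mulf_eq0 expfz_eq0 (negbTE t_neq0) andbF.
right; exists al, (be - eps * (2 * N%:Z)), n0 => n le_n.
have -> : x n = t ^ (- (2 * N%:Z * n)) * pev t c n.
  by rewrite -cE mulrA -expfzDr // addNr expr0z mul1r.
have -> : al + (be - eps * (2 * N%:Z)) * n =
          eps * (- (2 * N%:Z * n)) + (al + be * n) by ring.
by apply: val_eqM (val_eq_tX _) (vc _ le_n).
Qed.

(** A lower bound with leading term [- kap n^2].  One constant serves both as the
    coefficient of the linear error term and as the place from which the bound holds. *)
Definition val_growth (kap : int) e := exists C : int, 0 <= C /\
  forall n, C <= n -> val_ge (- kap * n ^+ 2 - C * n) (e n).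

Lemma growth_ext kap e e' : e =1 e' -> val_growth kap e -> val_growth kap e'.
Proof.
by move=> ee' [C [C0 CP]]; exists C; split=> // n le_n; rewrite -ee' CP.
Qed.

Lemma growthD kap e e' :
  val_growth kap e -> val_growth kap e' -> val_growth kap (fun n => e n + e' n).
Proof.
move=> [C [C0 CP]] [C' [C0' CP']]; exists (C + C'); split=> [|n le_n]; first lia.
have [le1 le2] : C <= n /\ C' <= n by split; lia.
by apply: val_geD; [apply: val_geW (CP n le1)|apply: val_geW (CP' n le2)]; nia.
Qed.

Lemma growthM kap x e :
  laurent t x -> val_growth kap e -> val_growth kap (fun n => x n * e n).
Proof.
move=> /val_laurent[x0|[al [be [n0 xv]]]] [C [C0 CP]].
  by exists 0; split=> // n _; rewrite x0 !mul0r val_ge0.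
exists (C + `|al| + `|be| + `|n0| + 1); split=> [|n le_n]; first lia.
have [le1 [le2 le3]] : C <= n /\ n0 <= n /\ 1 <= n by lia.
apply: val_geW (val_geM (val_eq_ge (xv n le2)) (CP n le1)).
have : - `|al| * n <= al by nia.
have : - `|be| * n <= be * n by nia.
nia.
Qed.

Lemma growth_shift kap e : 0 <= kap ->
  val_growth kap e -> val_growth kap (fun n => e (n + 1)).
Proof.
move=> kap0 [C [C0 CP]]; exists (3 * kap + 2 * C + 1).
split=> [|n le_n]; first lia.
have le1 : C <= n + 1 by lia.
apply: val_geW (CP _ le1); nia.
Qed.

Lemma growth_module kap : 0 <= kap -> seq_module t (val_growth kap).
Proof.
move=> kap0; split; [exact: growth_ext|exact: growthD|exact: growthM|].
by move=> e; apply: growth_shift.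
Qed.

Lemma growth_laurent kap x : 0 <= kap -> laurent t x -> val_growth kap x.
Proof.
move=> kap0 xL.
have : val_growth kap (fun=> 1).
  by exists 0; split=> // n _; apply: val_geW (val_eq_ge (val_eq_tX 0)); nia.
by move/(growthM xL); apply: growth_ext => n; rewrite mulr1.
Qed.

(** For the colored Jones functions in question the value is a known quadratic function
    of [n] only on one parity class, and it exceeds this function on the other one. *)
Definition val_half (kap be ga : int) (odd_class : bool) f := exists n0 : int,
  forall n, n0 <= n -> (2 %| n)%Z = ~~ odd_class ->
  val_eq (- kap * n ^+ 2 + be * n + ga) (f n).

Definition val_other (kap be ga : int) (odd_class : bool) f := exists n0 : int,
  forall n, n0 <= n -> (2 %| n)%Z = odd_class ->
  val_ge (- kap * n ^+ 2 + be * n + ga + 1) (f n).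

Lemma parity_above (b : bool) (m : int) : exists n, m <= n /\ (2 %| n)%Z = b.
Proof.
have [/eqP E|/eqP E] := boolP ((2 %| m)%Z == b); first by exists m.
by exists (m + 1); split; [lia | move: E; case: b; lia].
Qed.

Lemma quadratic_lt (k k' b c C : int) : k < k' -> 0 <= C ->
  exists B : int, forall m, B <= m -> - k' * m ^+ 2 + b * m + c < - k * m ^+ 2 - C * m.
Proof.
move=> lt_k C0; exists (`|b| + `|c| + C + 1) => m le_m.
have m1 : 1 <= m by lia.
have b1 : b * m <= `|b| * m by nia.
have c1 : c <= `|c| * m by nia.
have : (`|b| + `|c| + C + 1) * m <= m * m by nia.
have : m * m <= (k' - k) * (m * m) by nia.
by move: (`|b|) (`|c|) b1 c1 => B D b1 c1; lia.
Qed.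

(** In [rho f + e = 0] the value of [rho] is affine in [n], so on the class where the
    value of [f] is known the first term has a smaller value than [e]. *)
Lemma indep1 kap kap' be ga odd_class f : kap < kap' ->
  val_half kap' be ga odd_class f -> indep t 1 f (val_growth kap).
Proof.
move=> lt_kap [n0 fv] rho e rhoL [C [C0 eC]] [n1 E1] i n; rewrite ltnS leqn0 => /eqP->.
case: (val_laurent (rhoL 0%N)) => [//|[al [bt [n2 rv]]]].
have [B BP] := quadratic_lt (bt + be) (al + ga) lt_kap C0.
have [m [le_m par]] := parity_above (~~ odd_class)
  (Num.max n0 (Num.max n1 (Num.max n2 (Num.max C B)))).
move: le_m; rewrite !ge_max => /and5P[m0 m1 m2 m3 m4].
have := E1 m m1; rewrite big_ord1 addr0 => /eqP; rewrite addr_eq0 => /eqP E.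
have V := val_eqM (rv m m2) (fv m m0 par).
have := eC m m3; rewrite -val_geN -E.
move=> /(val_eq_contra _ V) => /(_ _)[]//; apply: le_lt_trans (BP m m4).
by lia.
Qed.

(** In a relation [rho0 f(n) + rho1 f(n+1) + e(n) = 0] the term in which [f] has
    exactly known value dominates [e], hence its value is at least that of the other
    term.  The difference of the two values is affine in [n] up to this error, yet
    has both signs, according to the parity of [n]. *)
Lemma indep2 kap kap' be ga odd_class f : kap < kap' ->
  val_half kap' be ga odd_class f -> val_other kap' be ga odd_class f ->
  indep t 2 f (val_growth kap).
Proof.
move=> lt_kap [n0 fv] [n0' fv'] rho e rhoL [C [C0 eC]] [n1 E1].
have E2 n : n1 <= n -> rho 0%N n * f n + (rho 1%N n * f (n + 1) + e n) = 0.
  move=> le_n; rewrite -[RHS](E1 n le_n) big_ord_recl big_ord1 /= addr0.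
  by rewrite addrA.
case: (val_laurent (rhoL 0%N)) => [r00|[al0 [bt0 [n2 rv0]]]];
  case: (val_laurent (rhoL 1%N)) => [r10|[al1 [bt1 [n3 rv1]]]].
- by move=> [|[|i]].
- exfalso.
  have [B BP] := quadratic_lt (bt1 + be - 2 * kap') (al1 + ga + be - kap') lt_kap C0.
  have [m [le_m par]] := parity_above odd_class
    (Num.max n0 (Num.max n1 (Num.max n3 (Num.max C B)))).
  move: le_m; rewrite !ge_max => /and5P[m0 m1 m2 m3 m4].
  have := E2 m m1; rewrite r00 mul0r add0r => /eqP; rewrite addr_eq0 => /eqP E.
  have par' : (2 %| m + 1)%Z = ~~ odd_class by move: par; case: (odd_class); lia.
  have m0' : n0 <= m + 1 by lia.
  have V := val_eqM (rv1 m m2) (fv (m + 1) m0' par').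
  have := eC m m3; rewrite -val_geN -E.
  move=> /(val_eq_contra _ V) => /(_ _)[]//; apply: le_lt_trans (BP m m4).
  by lia.
- exfalso.
  have [B BP] := quadratic_lt (bt0 + be) (al0 + ga) lt_kap C0.
  have [m [le_m par]] := parity_above (~~ odd_class)
    (Num.max n0 (Num.max n1 (Num.max n2 (Num.max C B)))).
  move: le_m; rewrite !ge_max => /and5P[m0 m1 m2 m3 m4].
  have := E2 m m1; rewrite r10 mul0r add0r => /eqP; rewrite addr_eq0 => /eqP E.
  have V := val_eqM (rv0 m m2) (fv m m0 par).
  have := eC m m3; rewrite -val_geN -E.
  move=> /(val_eq_contra _ V) => /(_ _)[]//; apply: le_lt_trans (BP m m4).
  by lia.
exfalso.
have [B BP] := quadratic_lt (bt0 + be) (al0 + ga + 1) lt_kap C0.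
have [D DP] := quadratic_lt (bt1 + be - 2 * kap') (al1 + ga + be - kap' + 1) lt_kap C0.
pose bd := Num.max n0 (Num.max n0' (Num.max n1 (Num.max n2 (Num.max n3
  (Num.max C (Num.max B D)))))).
have big m : bd <= m ->
    [/\ n0 <= m, n0' <= m & n1 <= m] /\ [/\ n2 <= m, n3 <= m, C <= m, B <= m & D <= m].
  rewrite /bd !ge_max => /and5P[-> -> -> ->] /and4P[-> -> -> ->].
  by [].
have low m : bd <= m -> (2 %| m)%Z = ~~ odd_class ->
  al1 + bt1 * m - kap' * (2 * m + 1) + be + 1 <= al0 + bt0 * m.
  move=> le_m par; have [[m0 m1 m2] [m3 m4 m5 m6 _]] := big _ le_m.
  have V := val_eqM (rv0 m m3) (fv m m0 par).
  have m1' : n0' <= m + 1 by lia.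
  have par' : (2 %| m + 1)%Z = odd_class by move: par; case: (odd_class); lia.
  have W := val_geM (val_eq_ge (rv1 m m4)) (fv' (m + 1) m1' par').
  have := E2 m m2 => /eqP; rewrite addr_eq0 => /eqP E.
  rewrite leNgt; apply/negP => lt.
  apply: (@val_eq_contra _ (al0 + bt0 * m + (- kap' * m ^+ 2 + be * m + ga) + 1) _ _ V).
    by rewrite ltrDl.
  rewrite E val_geN; apply: val_geD; first by apply: val_geW W; lia.
  by apply: val_geW (eC m m5); apply: le_trans (ltW (BP m m6)); lia.
have high m : bd <= m -> (2 %| m)%Z = odd_class ->
  al0 + bt0 * m + 1 <= al1 + bt1 * m - kap' * (2 * m + 1) + be.
  move=> le_m par; have [[m0 m1 m2] [m3 m4 m5 _ m6]] := big _ le_m.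
  have m1' : n0 <= m + 1 by lia.
  have par' : (2 %| m + 1)%Z = ~~ odd_class by move: par; case: (odd_class); lia.
  have V := val_eqM (rv1 m m4) (fv (m + 1) m1' par').
  have W := val_geM (val_eq_ge (rv0 m m3)) (fv' m m1 par).
  have := E2 m m2; rewrite addrCA => /eqP; rewrite addr_eq0 => /eqP E.
  rewrite leNgt; apply/negP => lt.
  apply: (@val_eq_contra _
    (al1 + bt1 * m + (- kap' * (m + 1) ^+ 2 + be * (m + 1) + ga) + 1) _ _ V).
    by rewrite ltrDl.
  rewrite E val_geN; apply: val_geD; first by apply: val_geW W; lia.
  by apply: val_geW (eC m m5); apply: le_trans (ltW (DP m m6)); lia.
have [m [le_m par]] := parity_above (~~ odd_class) bd.
have par1 : (2 %| m + 1)%Z = odd_class by move: par; case: (odd_class); lia.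
have par2 : (2 %| m + 2)%Z = ~~ odd_class by move: par; case: (odd_class); lia.
have le1 : bd <= m + 1 by apply: le_trans le_m _; rewrite lerDl.
have le2 : bd <= m + 2 by apply: le_trans le_m _; rewrite lerDl.
have := low m le_m par; have := high (m + 1) le1 par1; have := low (m + 2) le2 par2.
by clear; lia.
Qed.

End Valuation.

(** * Fraction fields of polynomial rings *)

Section FractionValuation.
Local Open Scope quotient_scope.
Variable D : idomainType.

Lemma fracE (x : {fraction D}) : x = (\n_(repr x))%:F / (\d_(repr x))%:F.
Proof.
have d0 : (\d_(repr x))%:F != 0 by rewrite tofrac_eq0 denom_ratioP.
apply: (mulIf d0); rewrite divfK // -{1}[x]reprK; move: (repr x) => r.
unlock FracField.tofrac; rewrite -[LHS]FracField.pi_mul.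
apply/eqmodP; rewrite /= FracField.equivfE /FracField.mulf.
by rewrite !numden_Ratio ?mulr1 ?oner_neq0 ?denom_ratioP // mulrC.
Qed.

Variable w : D -> int.

Definition frac_val (x : {fraction D}) : int := w \n_(repr x) - w \d_(repr x).

Hypothesis wM : forall a b, a != 0 -> b != 0 -> w (a * b) = w a + w b.
Hypothesis wD : forall k a b, a != 0 -> b != 0 -> a + b != 0 ->
  k <= w a -> k <= w b -> k <= w (a + b).

(** The multiplicativity of [w] makes the value independent of the representative. *)
Lemma frac_valE (a b : D) : a != 0 -> b != 0 -> frac_val (a%:F / b%:F) = w a - w b.
Proof.
move=> a0 b0; rewrite /frac_val; set x := _ / _; have E := fracE x.
set n := \n_(repr x) in E *; set d := \d_(repr x) in E *.
have d0 : d != 0 by rewrite denom_ratioP.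
have bF : b%:F != 0 by rewrite tofrac_eq0.
have dF : d%:F != 0 by rewrite tofrac_eq0.
have Ex : a * d = n * b.
  apply/eqP; rewrite -tofrac_eq !tofracM; apply/eqP.
  by move: E; rewrite {1}/x => /eqP; rewrite eqr_div // => /eqP.
have n0 : n != 0.
  apply/eqP => n0; move/eqP: Ex; rewrite n0 mul0r mulf_eq0.
  by rewrite (negbTE a0) (negbTE d0).
have := wM a0 d0; have := wM n0 b0; rewrite Ex => ->; move: (w _) (w _) (w _) (w _).
by move=> i1 i2 i3 i4; lia.
Qed.

Lemma frac_neq0 (x : {fraction D}) : x != 0 -> \n_(repr x) != 0.
Proof.
by apply: contraNneq => E; rewrite [x]fracE E tofrac0 mul0r.
Qed.

Lemma frac_valuation (t : D) : t != 0 -> w 1 = 0 -> valuation (t%:F) frac_val (w t).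
Proof.
move=> t0 w1; split.
- move=> x y x0 y0; rewrite {1}[x]fracE {1}[y]fracE mulf_div -!tofracM.
  rewrite frac_valE ?mulf_neq0 ?frac_neq0 ?denom_ratioP // /frac_val.
  by rewrite !wM ?frac_neq0 ?denom_ratioP //; lia.
- move=> k x y x0 y0 xy0; rewrite /frac_val.
  have ar1 (i j l : int) : k <= i - j -> k + (j + l) <= i + l by lia.
  have ar2 (i j l : int) : k <= i - j -> k + (l + j) <= i + l by lia.
  set a := \n_(repr x); set b := \d_(repr x); set c := \n_(repr y); set d := \d_(repr y).
  have a0 : a != 0 by apply: frac_neq0.
  have c0 : c != 0 by apply: frac_neq0.
  have [b0 d0] : b != 0 /\ d != 0 by rewrite !denom_ratioP.
  have E : x + y = (a * d + c * b)%:F / (b * d)%:F.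
    rewrite [x]fracE [y]fracE addf_div ?tofrac_eq0 ?denom_ratioP //.
    by rewrite tofracD !tofracM.
  have s0 : a * d + c * b != 0.
    by apply: contraNneq xy0 => s0; rewrite E s0 tofrac0 mul0r.
  rewrite -/(frac_val _) E frac_valE ?mulf_neq0 // => kx ky.
  rewrite lerBrDr; apply: wD; rewrite ?mulf_neq0 // !wM //; first exact: ar1.
  exact: ar2.
have -> : t%:F = t%:F / 1%:F by rewrite tofrac1 divr1.
by rewrite frac_valE ?oner_neq0 // w1 subr0.
Qed.

End FractionValuation.

Section FractionMap.
Variables (D : idomainType) (phi : {rmorphism D -> D}).
Hypothesis phi_inj : forall a, (phi a == 0) = (a == 0).
Implicit Types (a b c d : D) (x y : {fraction D}).

(** The extension of [phi] to the fraction field, computed on the chosen representative. *)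
Definition frac_map x : {fraction D} := (phi \n_(repr x))%:F / (phi \d_(repr x))%:F.

Lemma frac_eqE a b c d : b != 0 -> d != 0 ->
  (a%:F / b%:F == c%:F / d%:F) = (a * d == c * b).
Proof. by move=> b0 d0; rewrite eqr_div ?tofrac_eq0 // -!tofracM tofrac_eq. Qed.

Lemma frac_mapE a b : b != 0 -> frac_map (a%:F / b%:F) = (phi a)%:F / (phi b)%:F.
Proof.
move=> b0; set x := _ / _; have /eqP := fracE x.
have d0 : \d_(repr x) != 0 by exact: denom_ratioP.
rewrite {1}/x frac_eqE // => /eqP E; apply/eqP.
by rewrite frac_eqE ?phi_inj // -!rmorphM E.
Qed.

Lemma fracP x : exists a b, b != 0 /\ x = a%:F / b%:F.
Proof. by exists \n_(repr x), \d_(repr x); split; [exact: denom_ratioP | exact: fracE]. Qed.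

Lemma frac_map_tofrac a : frac_map a%:F = (phi a)%:F.
Proof.
have -> : a%:F = a%:F / 1%:F by rewrite tofrac1 divr1.
by rewrite frac_mapE ?oner_neq0 // rmorph1 tofrac1 divr1.
Qed.

Lemma frac_mapM x y : frac_map (x * y) = frac_map x * frac_map y.
Proof.
have [a [b [b0 ->]]] := fracP x; have [c [d [d0 ->]]] := fracP y.
by rewrite mulf_div -!tofracM !frac_mapE ?mulf_neq0 // mulf_div -!tofracM !rmorphM.
Qed.

Lemma frac_mapB x y : frac_map (x - y) = frac_map x - frac_map y.
Proof.
have [a [b [b0 ->]]] := fracP x; have [c [d [d0 ->]]] := fracP y.
have sub (a' b' c' d' : D) : b' != 0 -> d' != 0 ->
    a'%:F / b'%:F - c'%:F / d'%:F = (a' * d' - c' * b')%:F / (b' * d')%:F.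
  move=> b'0 d'0; rewrite -mulNr addf_div ?tofrac_eq0 // mulNr -!tofracM.
  by rewrite -tofracN -tofracD.
by rewrite sub // !frac_mapE ?mulf_neq0 // sub ?phi_inj // rmorphB !rmorphM.
Qed.

End FractionMap.

Lemma frac_map_comp (D : idomainType) (phi psi chi : {rmorphism D -> D}) :
  (forall a, (phi a == 0) = (a == 0)) -> (forall a, (psi a == 0) = (a == 0)) ->
  (forall a, phi (psi a) = chi a) ->
  forall x, frac_map phi (frac_map psi x) = frac_map chi x.
Proof.
move=> phi0 psi0 comp x; have [a [b [b0 ->]]] := fracP x.
have chi0 c : (chi c == 0) = (c == 0) by rewrite -comp phi0 psi0.
by rewrite (frac_mapE psi0) // (frac_mapE phi0) ?psi0 // (frac_mapE chi0) // !comp.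
Qed.

Lemma frac_map_id (D : idomainType) (phi : {rmorphism D -> D}) :
  (forall a, phi a = a) -> forall x, frac_map phi x = x.
Proof.
move=> phi1 x; have [a [b [b0 ->]]] := fracP x.
by rewrite frac_mapE ?phi1 // => c; rewrite phi1.
Qed.

Section RationalFunctionValuations.
Variable F : fieldType.

(** The order of vanishing at [0]. *)
Lemma zero_valuation : exists v, valuation (('X : {poly F})%:F) v 1.
Proof.
pose w (p : {poly F}) : int := (mup 0 p)%:Z.
have wX : w 'X = 1.
  by rewrite /w; have := mup_XsubCX 1 (0 : F) 0; rewrite eqxx expr1 subr0 => ->.
exists (frac_val w); rewrite -wX; apply: frac_valuation; rewrite ?polyX_eq0 //.
- by move=> a b a0 b0; rewrite /w mupM.
- move=> k a b a0 b0 ab0; rewrite /w.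
  have [k0|k0] := lerP k 0; first by lia.
  have [m ->] : exists m : nat, k = m%:Z by exists `|k|%N; lia.
  by rewrite !lez_nat !mup_geq // => ma mb; rewrite dvdp_add.
- by rewrite /w mupNroot // root1.
Qed.

(** Minus the degree. *)
Lemma infinity_valuation : exists v, valuation (('X : {poly F})%:F) v (-1).
Proof.
pose w (p : {poly F}) : int := 1 - (size p)%:Z.
have wX : w 'X = -1 by rewrite /w size_polyX.
exists (frac_val w); rewrite -wX; apply: frac_valuation; rewrite ?polyX_eq0 //.
- move=> a b a0 b0; rewrite /w size_mul //.
  move: a0 b0; rewrite -!size_poly_gt0.
  by move: (size a) (size b) => [|i] [|j] //; lia.
- move=> k a b a0 b0 ab0; rewrite /w.
  have := size_polyD a b; rewrite leq_max; move: (size _) (size _) (size _) => i1 i2 i3; lia.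
- by rewrite /w size_poly1.
Qed.

End RationalFunctionValuations.

Lemma fracX_transcendental (F : numFieldType) (P : {poly int}) :
  (map_poly intr P : {poly {fraction {poly F}}}).[('X)%:F] = 0 -> P = 0.
Proof.
have -> : (map_poly intr P : {poly {fraction {poly F}}}) =
    map_poly (@FracField.tofrac {poly F}) (map_poly polyC (map_poly intr P)).
  by rewrite -!map_poly_comp; apply: eq_map_poly => i; rewrite /= !rmorph_int.
rewrite horner_map -/(comp_poly 'X _) comp_polyXr => /eqP; rewrite tofrac_eq0.
move=> /eqP/polyP P0; apply/polyP => i; have := P0 i.
by rewrite coef_map_id0 // !coef0 => /eqP; rewrite intr_eq0 => /eqP.
Qed.

(** * Consequences of the cabling formula *)

Section Cabling.
Variables (K : fieldType) (t : K).
Hypothesis t_neq0 : t != 0.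
Implicit Types (J Jc : int -> K) (r s j m n : int).

Definition seq_odd J := forall n, J (- n) = - J n.

Definition cable_term r s Jc j : K := t ^ (r * j * (j * s + 2)) * Jc (j * s + 1).

Definition cabling r s Jc J := forall n : nat, (1 <= n)%N ->
  J n%:Z = t ^ (- (r * s * (n%:Z ^+ 2 - 1))) *
           \sum_(i < n) cable_term r s Jc (2 * i%:Z - (n%:Z - 1)).

Section Recurrences.
Variables (r s : int) (Jc J : int -> K).
Hypotheses (Jc_odd : seq_odd Jc) (J_odd : seq_odd J) (J_cable : cabling r s Jc J).
Hypothesis two_neq0 : (2%:R : K) != 0.

Lemma odd_at0 (F : int -> K) : seq_odd F -> F 0 = 0.
Proof.
move=> Fodd; have := Fodd 0; rewrite oppr0 => /eqP; rewrite -addr_eq0 -mulr2n.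
by rewrite -mulr_natl mulf_eq0 (negbTE two_neq0) => /eqP.
Qed.

Lemma cable_sum (n : nat) : \sum_(i < n) cable_term r s Jc (2 * i%:Z - (n%:Z - 1)) =
  t ^ (r * s * (n%:Z ^+ 2 - 1)) * J n%:Z.
Proof.
case: n => [|n]; first by rewrite big_ord0 (odd_at0 J_odd) mulr0.
by rewrite J_cable // mulrA (tD t_neq0) addrN expr0z mul1r.
Qed.

Lemma cable_at1 : J 1 = Jc 1.
Proof.
have := cable_sum 1; rewrite big_ord1 /cable_term /=.
have -> : r * s * (1%:Z ^+ 2 - 1) = 0 by ring.
have -> : 2 * 0%:Z - (1%:Z - 1) = 0 by [].
by rewrite !(mulr0, mul0r) expr0z !mul1r add0r.
Qed.

(** The sums for [C(m+1)] and [C(m-1)] run over the indices [-m, ..., m] and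
    [-m+2, ..., m-2] in steps of [2], so only the two extreme terms survive in the
    difference.  The case [m < 0] follows by antisymmetry. *)
Lemma cable_rec2 m :
  t ^ (2 * r * s * m) * J (m + 1) - t ^ (- (2 * r * s * m)) * J (m - 1) =
  t ^ (2 * r * m) * Jc (m * s + 1) - t ^ (- (2 * r * m)) * Jc (m * s - 1).
Proof.
have pos (n : nat) (k : int) : k = n%:Z + 1 ->
  t ^ (2 * r * s * k) * J (k + 1) - t ^ (- (2 * r * s * k)) * J (k - 1) =
  t ^ (2 * r * k) * Jc (k * s + 1) - t ^ (- (2 * r * k)) * Jc (k * s - 1).
  move=> kE; have := cable_sum n.+2; rewrite big_ord_recl big_ord_recr /=.
  have -> : \sum_(i < n) cable_term r s Jc (2 * (bump 0 i)%:Z - (n.+2%:Z - 1)) =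
            \sum_(i < n) cable_term r s Jc (2 * i%:Z - (n%:Z - 1)).
    by apply: eq_bigr => i _; congr cable_term; rewrite /bump /=; lia.
  rewrite cable_sum /cable_term.
  have -> : 2 * 0%:Z - (n.+2%:Z - 1) = - k by lia.
  have -> : 2 * (1 + n)%N%:Z - (n.+2%:Z - 1) = k by lia.
  have -> : - k * s + 1 = - (k * s - 1) by ring.
  rewrite Jc_odd (_ : n.+2%:Z = k + 1); last by lia.
  rewrite (_ : n%:Z = k - 1); last by lia.
  have scale i i' : i = - (r * s * k ^+ 2) + i' -> t ^ i = t ^ (- (r * s * k ^+ 2)) * t ^ i'.
    by move=> ->; rewrite (tD t_neq0).
  rewrite (scale (2 * r * s * k) (r * s * ((k + 1) ^+ 2 - 1))); last by ring.
  rewrite (scale (- (2 * r * s * k)) (r * s * ((k - 1) ^+ 2 - 1))); last by ring.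
  rewrite (scale (2 * r * k) (r * k * (k * s + 2))); last by ring.
  rewrite (scale (- (2 * r * k)) (r * - k * (- k * s + 2))); last by ring.
  rewrite -!mulrA -!mulrBr => E; congr (_ * _); rewrite -E.
  by rewrite mulrN; ring.
have [m0|m0|m0] := ltrgtP 0 m; last rewrite -m0.
- by apply: (pos `|(m - 1)|%N); lia.
- have := pos `|(- m - 1)|%N (- m) ltac:(lia).
  have -> : - m + 1 = - (m - 1) by ring.
  have -> : - m - 1 = - (m + 1) by ring.
  have -> : - m * s + 1 = - (m * s - 1) by ring.
  have -> : - m * s - 1 = - (m * s + 1) by ring.
  rewrite !J_odd !Jc_odd !mulrN !opprK => E.
  rewrite addrC E addrC; congr (t ^ _ * _ - t ^ _ * _); ring.
- rewrite !mulr0 mul0r !add0r oppr0 expr0z !mul1r J_odd Jc_odd !opprK.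
  by rewrite cable_at1.
Qed.

(** For [s = 2] the reflection [j := - 1 - j] reverses the sign of [Jc (2j+1)] and keeps
    the exponent [2rj(j+1)].  It carries the sum for [C(n)] to minus the sum for
    [C(n+1)] deprived of its last term, which gives a recurrence of order [1]. *)
Lemma cable_rec1 n : s = 2 ->
  t ^ (2 * r * n) * J (n + 1) + t ^ (- (2 * r * n) - 2 * r) * J n = Jc (2 * n + 1).
Proof.
move=> s2.
have pos (k : nat) : t ^ (2 * r * k%:Z) * J (k%:Z + 1)
    + t ^ (- (2 * r * k%:Z) - 2 * r) * J k%:Z = Jc (2 * k%:Z + 1).
  have := cable_sum k.+1; rewrite big_ord_recr /=.
  have -> : \sum_(i < k) cable_term r s Jc (2 * i%:Z - (k.+1%:Z - 1)) =
            - (t ^ (r * s * (k%:Z ^+ 2 - 1)) * J k%:Z).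
    rewrite -cable_sum -sumrN [RHS](reindex_inj rev_ord_inj) /=.
    apply: eq_bigr => i _; rewrite /cable_term s2.
    have -> : 2 * (k - i.+1)%N%:Z - (k%:Z - 1) = -1 - (2 * i%:Z - (k.+1%:Z - 1)).
      by have := ltn_ord i; lia.
    set j := 2 * i%:Z - _; have -> : (-1 - j) * 2 + 1 = - (j * 2 + 1) by ring.
    by rewrite Jc_odd mulrN opprK; congr (t ^ _ * _); ring.
  rewrite /cable_term s2 (_ : 2 * k%:Z - (k.+1%:Z - 1) = k%:Z); last by lia.
  rewrite (_ : k.+1%:Z = k%:Z + 1); last by lia.
  set T := r * k%:Z * (k%:Z * 2 + 2).
  have scale i i' : i = - T + i' -> t ^ i = t ^ (- T) * t ^ i'.
    by move=> ->; rewrite (tD t_neq0).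
  rewrite (scale (2 * r * k%:Z) (r * 2 * ((k%:Z + 1) ^+ 2 - 1))); last by rewrite /T; ring.
  rewrite (scale (- (2 * r * k%:Z) - 2 * r) (r * 2 * (k%:Z ^+ 2 - 1))); last first.
    by rewrite /T; ring.
  rewrite -!mulrA -mulrDr => <-; rewrite addrAC addNr add0r mulrA (tD t_neq0) addNr expr0z mul1r.
  by rewrite mulrC.
have [n0|n0] := lerP 0 n; first by rewrite (_ : n = `|n|%N%:Z); [exact: pos | lia].
have := pos `|(- n - 1)|%N; rewrite (_ : `|(- n - 1)|%N%:Z = - n - 1); last by lia.
have -> : - n - 1 + 1 = - n by ring.
have -> : - n - 1 = - (n + 1) by ring.
have -> : 2 * - (n + 1) + 1 = - (2 * n + 1) by ring.
rewrite !J_odd Jc_odd !mulrN -opprD => /oppr_inj <-.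
by rewrite addrC; congr (t ^ _ * _ + t ^ _ * _); ring.
Qed.

End Recurrences.

Section Growth.
Variables (v : K -> int) (eps : int).
Hypothesis vP : valuation t v eps.
Variables (r s : int) (Jc J : int -> K).
Hypothesis J_cable : cabling r s Jc J.

Lemma cable_val (n : nat) k : (1 <= n)%N ->
  (forall i : nat, (i < n)%N -> val_ge v k (cable_term r s Jc (2 * i%:Z - (n%:Z - 1)))) ->
  val_ge v (- (eps * r * s) * (n%:Z ^+ 2 - 1) + k) (J n%:Z).
Proof.
move=> n1 terms; rewrite J_cable //.
have -> : - (eps * r * s) * (n%:Z ^+ 2 - 1) = eps * - (r * s * (n%:Z ^+ 2 - 1)) by ring.
apply: (val_geM vP); first exact: val_eq_ge (val_eq_tX vP t_neq0 _).
by apply: (val_ge_sum vP) => i _; apply: terms.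
Qed.

(** For odd [n] the index [0] occurs in the sum.  Its term is [Jc 1 = 1], of value [0],
    and dominates all the others. *)
Lemma cable_val_odd (n : nat) : odd n -> Jc 1 = 1 ->
  (forall j, (2 %| j)%Z -> j != 0 -> val_ge v 1 (cable_term r s Jc j)) ->
  val_eq v (- (eps * r * s) * (n%:Z ^+ 2 - 1)) (J n%:Z).
Proof.
move=> n_odd J1 terms; rewrite J_cable ?odd_gt0 //.
have -> : - (eps * r * s) * (n%:Z ^+ 2 - 1) = eps * - (r * s * (n%:Z ^+ 2 - 1)) + 0 by ring.
apply: (val_eqM vP); first exact: val_eq_tX.
have lt_h : (n./2 < n)%N by lia.
rewrite (bigD1 (Ordinal lt_h)) //=.
apply: (val_eqD vP (j := 1)) => //.
  rewrite (_ : 2 * n./2%:Z - (n%:Z - 1) = 0); last by lia.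
  by rewrite /cable_term !(mulr0, mul0r) expr0z add0r mul1r J1 /val_eq oner_neq0 (val1 vP).
apply: (val_ge_sum vP) => i ne_i; apply: terms; first by lia.
apply: contra ne_i => /eqP E; apply/eqP/val_inj => /=.
by have := ltn_ord i; lia.
Qed.

End Growth.
End Cabling.

(** * Growth of the iterated cable *)

Lemma mul_add1_neq0 (j s : int) : 2 <= s -> j * s + 1 != 0.
Proof.
move=> s2; have [j0|j0] := lerP 0 j.
  by have js : 0 <= j * s; [nia | lia].
by have js : j * s <= - 2; [nia | lia].
Qed.

Section IteratedCableGrowth.
Variables (K : fieldType) (t : K) (v : K -> int) (eps : int).
Hypothesis t_neq0 : t != 0.
Hypotheses (vP : valuation t v eps) (eps_sign : eps = 1 \/ eps = -1).
Variables (U T : int -> K) (p q s : int).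
Hypothesis U_odd : seq_odd U.
Hypothesis U_val : forall n, 1 <= n ->
  U n = (t ^ (2 * n) - t ^ (- (2 * n))) / (t ^ 2 - t ^ (- 2)).
Hypothesis T_odd : seq_odd T.
Hypothesis T_cable : cabling t p q U T.
Hypothesis q2 : 2 <= q.
Hypothesis s2 : 2 <= s.

Lemma val_eqV k x : val_eq v k x -> val_eq v (- k) x^-1.
Proof.
case/andP=> x0 /eqP xk; rewrite /val_eq invr_neq0 //=.
have := val_mul vP x0 (invr_neq0 x0); rewrite divff // (val1 vP) xk => E.
by rewrite -addr_eq0 addrC -E.
Qed.

Lemma val_quantum : val_eq v (-2) (t ^ 2 - t ^ (- 2)).
Proof.
have a := val_eq_tX vP t_neq0 2; have b := val_eq_tX vP t_neq0 (- 2).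
case: eps_sign => E; rewrite E in a b.
  by rewrite addrC; apply: (val_eqD vP (j := 2)); rewrite ?(val_eqN vP) ?val_eq_ge.
by apply: (val_eqD vP (j := 2)); rewrite // (val_geN vP) val_eq_ge.
Qed.

Lemma unknot_growth n : n != 0 -> val_ge v (- (2 * (`|n| - 1))) (U n).
Proof.
have pos m : 1 <= m -> val_ge v (- (2 * (m - 1))) (U m).
  move=> m1; rewrite U_val //.
  have -> : - (2 * (m - 1)) = - (2 * m) + - -2 by ring.
  apply: (val_geM vP); last exact: val_eq_ge (val_eqV val_quantum).
  apply: (val_geD vP); rewrite ?(val_geN vP).
    by apply: val_geW (val_eq_ge (val_eq_tX vP t_neq0 _)); case: eps_sign => ->; lia.
  by apply: val_geW (val_eq_ge (val_eq_tX vP t_neq0 _)); case: eps_sign => ->; lia.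
move=> n0; have [n_gt0|n_le0] := ltrP 0 n.
  by rewrite ger0_norm; [apply: pos; lia | lia].
rewrite -[n]opprK U_odd (val_geN vP) normrN ger0_norm; last by lia.
by apply: pos; lia.
Qed.

Lemma unknot1 : U 1 = 1.
Proof.
rewrite U_val // mulr1 divff //.
by case/andP: val_quantum.
Qed.

Lemma torus_term j : val_ge v (eps * p * (j * (j * q + 2)) - 2 * (`|j * q + 1| - 1))
  (cable_term t p q U j).
Proof.
rewrite /cable_term.
have -> : eps * p * (j * (j * q + 2)) - 2 * (`|j * q + 1| - 1)
  = eps * (p * j * (j * q + 2)) + - (2 * (`|j * q + 1| - 1)) by ring.
apply: (val_geM vP); first exact: val_eq_ge (val_eq_tX vP t_neq0 _).
by apply: unknot_growth; apply: mul_add1_neq0.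
Qed.

Section Steep.
(** Of the two valuations, at [t = 0] and at [t = infinity], this is the one for which
    the prefactor [t^(- p q (n^2 - 1))] of [T n] has values tending to minus infinity. *)
Hypothesis steep : q < eps * p.

(** The prefactor carries all of the decrease: the terms of the cabling sum have values
    at least [0], because the exponent [p j (j q + 2)] outweighs the value
    [- 2 (|j q + 1| - 1)] of the quantum integer. *)
Lemma torus_term_ge0 j : val_ge v 0 (cable_term t p q U j).
Proof.
apply: val_geW (torus_term j); move: steep; move: (eps * p) => P ltP.
have [j0|j0] := lerP 0 j.
  have jq : 0 <= j * q by nia.
  rewrite ger0_norm; last by lia.
  have : 0 <= (P - q) * (j * (j * q + 2)) by nia.
  nia.
have jq : j * q <= - 2 by nia.
rewrite ler0_norm; last by lia.
have : 0 <= (P * (- j) - 2) * (- (j * q) - 2) by apply: mulr_ge0; nia.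
by nia.
Qed.

Lemma torus_term_gt0 j : j != 0 -> 2 < q \/ (2 %| j)%Z ->
  val_ge v 1 (cable_term t p q U j).
Proof.
move=> j0 qj; apply: val_geW (torus_term j); move: steep; move: (eps * p) => P ltP.
have [j_gt0|j_le0] := ltrP 0 j.
  have jq : 2 <= j * q by nia.
  rewrite ger0_norm; last by lia.
  have : 0 <= (P - q) * (j * (j * q + 2)) by nia.
  nia.
have jq : j * q <= - 3 by case: qj => [q3|j2]; nia.
rewrite ler0_norm; last by lia.
have f1 : 1 <= P * (- j) - 2 by nia.
have f2 : 1 <= - (j * q) - 2 by lia.
have : 1 <= (P * (- j) - 2) * (- (j * q) - 2) by apply: le_trans f2 _; rewrite ler_peMl //; lia.
by nia.
Qed.

Lemma torus_growth n : n != 0 -> val_ge v (- (eps * p * q) * (n ^+ 2 - 1)) (T n).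
Proof.
have pos (m : nat) : (1 <= m)%N -> val_ge v (- (eps * p * q) * (m%:Z ^+ 2 - 1)) (T m%:Z).
  move=> m1; rewrite -[X in val_ge _ X _]addr0.
  by apply: (cable_val t_neq0 vP T_cable) => // i _; apply: torus_term_ge0.
move=> n0; have [n_gt0|n_le0] := ltrP 0 n.
  by rewrite (_ : n = `|n|%N%:Z); [apply: pos; lia | lia].
rewrite -[n]opprK T_odd (val_geN vP) sqrrN (_ : - n = `|n|%N%:Z); last by lia.
by apply: pos; lia.
Qed.

Lemma torus_growth_odd (n : nat) : odd n ->
  val_eq v (- (eps * p * q) * (n%:Z ^+ 2 - 1)) (T n%:Z).
Proof.
move=> n_odd; apply: (cable_val_odd t_neq0 vP T_cable) => //; first exact: unknot1.
by move=> j j2 j0; apply: torus_term_gt0 => //; right.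
Qed.

Lemma torus_growth_even (n : nat) : (0 < n)%N -> ~~ odd n -> 2 < q ->
  val_ge v (- (eps * p * q) * (n%:Z ^+ 2 - 1) + 1) (T n%:Z).
Proof.
move=> n0 n_even q3; apply: (cable_val t_neq0 vP T_cable) => // i _.
by apply: torus_term_gt0; [lia | left].
Qed.

(** The values of [T] that occur in the recurrence of the cable of winding number [s]:
    the index is [m s - 1] for [m = n + 1]. *)
Definition torus_slice n := T ((n + 1) * s - 1).

Lemma slice_half : val_half v (eps * p * q * s ^+ 2)
  (2 * eps * p * q * s - 2 * eps * p * q * s ^+ 2)
  (2 * eps * p * q * s - eps * p * q * s ^+ 2) true torus_slice.
Proof.
exists 0 => n n0 n2; rewrite /torus_slice.
have [m mE] : exists m : nat, (n + 1) * s - 1 = m%:Z.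
  by exists `|((n + 1) * s - 1)%R|%N; nia.
have n_odd : odd m.
  have [k kE] : exists k, n + 1 = 2 * k by exists ((n + 1) %/ 2)%Z; lia.
  by move: mE; rewrite kE -mulrA; move: (k * s) => ks; lia.
rewrite (_ : _ + _ = - (eps * p * q) * (((n + 1) * s - 1) ^+ 2 - 1)); last by ring.
by rewrite mE; apply: torus_growth_odd.
Qed.

Lemma slice_other : 2 < q -> ~~ (2 %| s)%Z -> val_other v (eps * p * q * s ^+ 2)
  (2 * eps * p * q * s - 2 * eps * p * q * s ^+ 2)
  (2 * eps * p * q * s - eps * p * q * s ^+ 2) true torus_slice.
Proof.
move=> q3 s_odd; exists 0 => n n0 n2; rewrite /torus_slice.
have [m mE] : exists m : nat, (n + 1) * s - 1 = m%:Z.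
  by exists `|((n + 1) * s - 1)%R|%N; nia.
have m_gt0 : (0 < m)%N by nia.
have m_even : ~~ odd m.
  have [k kE] : exists k, n = 2 * k by exists (n %/ 2)%Z; lia.
  by move: mE; rewrite kE mulrDl mul1r -mulrA; move: (k * s) => ks; lia.
rewrite (_ : _ + _ = - (eps * p * q) * (((n + 1) * s - 1) ^+ 2 - 1) + 1); last by ring.
by rewrite mE; apply: torus_growth_even.
Qed.

Lemma slice_growth : val_growth v (eps * p * q * s ^+ 2) torus_slice.
Proof.
have pq0 : 0 <= eps * p * q by move: steep; nia.
have s_ge0 : 0 <= s by lia.
have Q0 : 0 <= eps * p * q * s ^+ 2 by apply: mulr_ge0 => //; apply: exprn_ge0.
exists (3 * (eps * p * q * s ^+ 2) + 1); split=> [|n le_n]; first by lia.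
have n1 : 1 <= n by lia.
apply: (val_geW _ (torus_growth _)) => [|]; last first.
  have : 1 * 2 <= n * s by apply: ler_pM; lia.
  by rewrite mulrDl mul1r; lia.
have : eps * p * q * s ^+ 2 * 1 <= eps * p * q * s ^+ 2 * n by apply: ler_wpM2l.
have : 0 <= eps * p * q * s * (n + 1) by apply: mulr_ge0; [apply: mulr_ge0 | lia].
have : 0 <= eps * p * q * s ^+ 2 * n by apply: mulr_ge0 => //; lia.
by clear -n1; lia.
Qed.

End Steep.

(** For the opposite valuation the prefactor and the terms compensate: the value of
    the prefactor is [|p| q (n^2 - 1)], and the values of the terms do not go
    below the opposite of this. *)
Lemma torus_flat n : q < - (eps * p) -> n != 0 -> val_ge v 0 (T n).
Proof.
move=> flat.
have pos (m : nat) : (1 <= m)%N -> val_ge v 0 (T m%:Z).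
  move=> m1; rewrite -(addNr (eps * p * q * (m%:Z ^+ 2 - 1))) -mulNr.
  apply: (cable_val t_neq0 vP T_cable) => // i lt_im.
  apply: val_geW (torus_term _).
  have [P PE] : exists P, eps * p = - P by exists (- (eps * p)); rewrite opprK.
  move: flat; set j := 2 * i%:Z - _; rewrite PE opprK => ltP.
  have {lt_im} [jm1 jm2] : j <= m%:Z - 1 /\ - j <= m%:Z - 1 by rewrite /j; lia.
  move: j jm1 jm2 => j jm1 jm2.
  have [j0|j0] := lerP 0 j.
    have jq : 0 <= j * q by nia.
    rewrite ger0_norm; last by lia.
    have : 0 <= P * q * (m%:Z ^+ 2 - 1 - (j ^+ 2 + 2 * j)).
      by apply: mulr_ge0; nia.
    have : 0 <= j * ((P - 1) * (q - 1) - 1) by apply: mulr_ge0; nia.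
    nia.
  have jq : j * q <= - 2 by nia.
  rewrite ler0_norm; last by lia.
  have : 0 <= P * q * (m%:Z ^+ 2 - 1 - (j ^+ 2 - 2 * j)).
    by apply: mulr_ge0; nia.
  have : 0 <= - j * ((P - 1) * (q - 1) - 1) by apply: mulr_ge0; nia.
  have : 0 <= - j * P by nia.
  nia.
move=> n0; have [n_gt0|n_le0] := ltrP 0 n.
  by rewrite (_ : n = `|n|%N%:Z); [apply: pos; lia | lia].
rewrite -[n]opprK T_odd (val_geN vP) (_ : - n = `|n|%N%:Z); last by lia.
by apply: pos; lia.
Qed.

Lemma slice_flat : q < - (eps * p) -> val_growth v 0 torus_slice.
Proof.
move=> flat; exists 0; split=> // n n0; rewrite oppr0 !mul0r subr0.
by apply: torus_flat => //; nia.
Qed.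

Variables (r : int) (C : int -> K).
Hypothesis C_cable : cabling t r s T C.
Hypothesis two_neq0 : (2%:R : K) != 0.

Lemma torus1 : T 1 = 1.
Proof. by rewrite (cable_at1 t_neq0 T_odd T_cable two_neq0) unknot1. Qed.

(** This is where [r] has to lie outside of the interval between [0] and [p q s].  For
    one of the two valuations, either [T] decreases with rate [|p| q] and [|r|] exceeds
    [|p| q s], or [T] does not decrease and [r] has the right sign; in both cases the
    exponents [r j (j s + 2)] outweigh the values of [T]. *)
Lemma cable_term_growth : (q < eps * p /\ eps * p * q * s < eps * r) \/
    (q < - (eps * p) /\ 0 < eps * r) ->
  exists c, 1 <= c /\ forall j, val_ge v (c * (j * (j * s + 2))) (cable_term t r s T j).
Proof.
have base j k : val_ge v k (T (j * s + 1)) ->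
    val_ge v (eps * (r * j * (j * s + 2)) + k) (cable_term t r s T j).
  by move=> Tk; apply: (val_geM vP) => //; apply: val_eq_ge (val_eq_tX vP t_neq0 _).
case=> [[steep lt_r]|[flat r_gt0]].
  exists (eps * r - eps * p * q * s); split=> [|j]; first by lia.
  have j0 := mul_add1_neq0 j s2.
  apply: val_geW (base j _ (torus_growth steep j0)).
  by rewrite le_eqVlt; apply/orP; left; apply/eqP; ring.
exists (eps * r); split=> [|j]; first by lia.
have j0 := mul_add1_neq0 j s2.
apply: val_geW (base j _ (torus_flat flat j0)).
by rewrite le_eqVlt; apply/orP; left; apply/eqP; ring.
Qed.

Hypothesis slope : (q < eps * p /\ eps * p * q * s < eps * r) \/
    (q < - (eps * p) /\ 0 < eps * r).

Lemma cable_half : val_half v (eps * r * s) 0 (eps * r * s) true C.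
Proof.
have [c [c1 terms]] := cable_term_growth slope.
exists 0 => n n0 n2; have [m nE] : exists m : nat, n = m%:Z by exists `|n|%N; lia.
rewrite nE; have n_odd : odd m by lia.
have -> : - (eps * r * s) * m%:Z ^+ 2 + 0 * m%:Z + eps * r * s
  = - (eps * r * s) * (m%:Z ^+ 2 - 1) by ring.
apply: (cable_val_odd t_neq0 vP C_cable) => //; first exact: torus1.
move=> j j2 j0; apply: val_geW (terms j).
have : 1 <= j * (j * s + 2) by nia.
nia.
Qed.

Lemma cable_other : 2 < s -> val_other v (eps * r * s) 0 (eps * r * s) true C.
Proof.
move=> s3; have [c [c1 terms]] := cable_term_growth slope.
exists 1 => n n0 n2; have [m nE] : exists m : nat, n = m%:Z by exists `|n|%N; lia.
rewrite nE; have m_gt0 : (1 <= m)%N by lia.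
have -> : - (eps * r * s) * m%:Z ^+ 2 + 0 * m%:Z + eps * r * s + 1
  = - (eps * r * s) * (m%:Z ^+ 2 - 1) + 1 by ring.
apply: (cable_val t_neq0 vP C_cable) => // i lt_im.
apply: val_geW (terms _); set j := 2 * i%:Z - _.
have j0 : j != 0 by rewrite /j; lia.
have : 1 <= j * (j * s + 2) by nia.
nia.
Qed.

End IteratedCableGrowth.

(** * Contents and the specialization at t = -1 *)

Section CoefficientDivisibility.
Variable R : comNzRingType.
Implicit Types (c e : R) (D F G : {poly R}).

Definition divides c e := exists e', e = c * e'.

Lemma dividesD c e e' : divides c e -> divides c e' -> divides c (e + e').
Proof. by move=> [x ->] [y ->]; exists (x + y); rewrite mulrDr. Qed.

Lemma dividesN c e : divides c e -> divides c (- e).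
Proof. by move=> [x ->]; exists (- x); rewrite mulrN. Qed.

Lemma dividesMr e' c e : divides c e -> divides c (e * e').
Proof. by move=> [x ->]; exists (x * e'); rewrite mulrA. Qed.

Definition coefs_divisible c D := forall l, divides c D`_l.

Lemma coefs_divisibleP c D : coefs_divisible c D -> exists D', D = c *: D'.
Proof.
move=> /choice[e eP]; exists (\poly_(l < size D) e l); apply/polyP => l.
rewrite coefZ coef_poly; case: ltnP => [_|le_l]; first exact: eP.
by rewrite mulr0 nth_default.
Qed.

Lemma coefs_divisibleZ c D : coefs_divisible c (c *: D).
Proof. by move=> l; rewrite coefZ; exists D`_l. Qed.

(** Regularity modulo every constant; over a factorial ring this is primitivity.  The
    form given here is the conclusion of the Gauss lemma, and it is closed under
    products without any theory of factorization. *)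
Definition content_free F := forall c D,
  coefs_divisible c (D * F) -> coefs_divisible c D.

Lemma content_freeM F G : content_free F -> content_free G -> content_free (F * G).
Proof. by move=> cF cG c D cD; apply/cF/cG; rewrite -mulrA. Qed.

(** The leading coefficient of [D F] is that of [D]; remove it and go on. *)
Lemma content_free_monic F : F \is monic -> content_free F.
Proof.
move=> Fm c D; have [m] := ubnP (size D); elim: m D => // m IH D ltD cDF.
have [->|D0] := eqVneq D 0; first by move=> l; exists 0; rewrite coef0 mulr0.
pose k := (size D).-1; pose T := lead_coef D *: 'X^k : {poly R}.
have szD : size D = k.+1 by rewrite prednK ?size_poly_gt0.
have cT : coefs_divisible c T.
  move=> l; rewrite coefZ coefXn; apply: dividesMr.
  rewrite -(lead_coef_Mmonic D Fm); exact: cDF.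
have DTE : D - T = \poly_(i < k) D`_i.
  apply/polyP => i; rewrite coefB coefZ coefXn coef_poly.
  have [lt_i|gt_i|->] := ltngtP i k; rewrite ?mulr0 ?mulr1 ?subr0 ?subrr //.
  by rewrite nth_default // szD.
have cDT : coefs_divisible c (D - T).
  apply: IH; first by rewrite DTE; apply: leq_ltn_trans (size_poly _ _) _; rewrite -ltnS -szD.
  move=> l; rewrite mulrBl coefB; apply: dividesD => //; apply: dividesN.
  rewrite -scalerAl coefZ; apply: dividesMr.
  by have := cT k; rewrite coefZ coefXn eqxx mulr1.
by move=> l; have := dividesD (cDT l) (cT l); rewrite coefB subrK.
Qed.

(** The mirror image of the monic case: [F] has an invertible constant term, so the
    coefficients of [D] are obtained one by one starting from the lowest. *)
Lemma content_free_const F u : u * F`_0 = 1 -> content_free F.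
Proof.
move=> F0 c D; have [m] := ubnP (size D); elim: m D => // m IH D ltD cDF.
have cD0 : divides c D`_0.
  have := dividesMr u (cDF 0%N); rewrite coef0M.
  by rewrite -mulrA [F`_0 * u]mulrC F0 mulr1.
pose D' := \poly_(i < (size D).-1) D`_i.+1.
have DE : D = D' * 'X + (D`_0)%:P.
  apply/polyP => -[|i]; rewrite coefD coefMX coefC /= ?add0r ?addr0 //.
  rewrite coef_poly; case: ltnP => // le_i; rewrite nth_default //.
  by move: le_i; case: (size D).
have [D0|D0] := posnP (size D).
  by move=> l; exists 0; rewrite mulr0 nth_default // D0.
have cD' : coefs_divisible c D'.
  apply: IH; first by apply: leq_ltn_trans (size_poly _ _) _; rewrite -ltnS prednK.
  move=> l; have := cDF l.+1; rewrite DE mulrDl mulrAC coefD coefMX /= mul_polyC coefZ.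
  move=> cl; rewrite -[_`_l](addrK (D`_0 * F`_l.+1)).
  by apply: dividesD => //; apply: dividesN; apply: dividesMr.
by case=> [|l] //; rewrite DE coefD coefMX coefC addr0.
Qed.

End CoefficientDivisibility.

Lemma content_free_cancel (c e : {poly int}) (E A : {poly {poly int}}) :
  c != 0 -> content_free A -> c *: E = e%:P * A -> exists2 B, e = c * B & E = B%:P * A.
Proof.
move=> c0 cA EA; have := cA c e%:P; rewrite -EA.
move=> /(_ (@coefs_divisibleZ _ _ _))/(_ 0%N); rewrite coefC /= => -[B eB]; exists B => //.
have /(@mulfI _ c%:P) : c%:P != 0 by rewrite polyC_eq0.
by apply; rewrite [c%:P * E]mul_polyC EA eB polyCM mulrA.
Qed.

(** [L^d - sg M^a], multiplied by [M^(-a)] if [a < 0].  All the factors of the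
    A-polynomial other than [L - 1] have this form. *)
Definition binomialF (a : int) (d : nat) (sg : int) : {poly {poly int}} :=
  if a < 0 then 'X^(`|a|%N) *: 'X^d - (sg%:~R)%:P else 'X^d - (sg%:~R * 'X^(`|a|%N))%:P.

Lemma content_free_binomial a d sg : (0 < d)%N -> sg = 1 \/ sg = -1 ->
  content_free (binomialF a d sg).
Proof.
move=> d0 sg1; rewrite /binomialF; case: ifP => _.
  apply: (@content_free_const _ _ (- sg%:~R)).
  rewrite coefB coefZ coefXn eq_sym (gtn_eqF d0) mulr0 coefC sub0r mulrNN.
  by case: sg1 => ->; rewrite -intrM.
by apply: content_free_monic; rewrite monicE lead_coefDl ?lead_coefXn // size_polyN size_polyXn
   (leq_ltn_trans (size_polyC_leq1 _)).
Qed.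

Section IntegralCoefficients.
Implicit Types (c e : {poly {poly int}}) (al be : {poly {poly {poly int}}}).

Definition at_m1 c : {poly int} := map_poly (horner_eval (-1)) c.

Lemma at_m1M c e : at_m1 (c * e) = at_m1 c * at_m1 e.
Proof. exact: rmorphM. Qed.

Lemma at_m1D c e : at_m1 (c + e) = at_m1 c + at_m1 e.
Proof. exact: rmorphD. Qed.

Lemma at_m1N c : at_m1 (- c) = - at_m1 c.
Proof. exact: rmorphN. Qed.

Lemma at_m1_int (i : int) : at_m1 i%:~R = i%:~R.
Proof. exact: rmorph_int. Qed.

Lemma eval_t_m1Z c al : eval_t_m1 (c *: al) = at_m1 c *: eval_t_m1 al.
Proof.
apply/polyP => l; rewrite coefZ !coef_map_id0 ?map_poly0 //.
by rewrite coefZ -at_m1M.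
Qed.

Lemma eval_t_m1D al be : eval_t_m1 (al + be) = eval_t_m1 al + eval_t_m1 be.
Proof. exact: rmorphD. Qed.

Lemma eval_t_m1M al be : eval_t_m1 (al * be) = eval_t_m1 al * eval_t_m1 be.
Proof. exact: rmorphM. Qed.

Definition t_plus_1 : {poly {poly int}} := ('X + 1)%:P.

Lemma at_m1_t_plus_1 : at_m1 t_plus_1 = 0.
Proof.
by rewrite /at_m1 map_polyC /= /horner_eval hornerD hornerX hornerC addNr.
Qed.

Lemma t_plus_1_neq0 : t_plus_1 != 0.
Proof. by rewrite polyC_eq0 -size_poly_gt0 size_XaddC. Qed.

Lemma t_plus_1_factor c : at_m1 c = 0 -> exists c', c = t_plus_1 * c'.
Proof.
move=> c0; suff /coefs_divisibleP[c' ->] : coefs_divisible ('X + 1) c.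
  by exists c'; rewrite mul_polyC.
move=> l; have /polyP/(_ l) := c0; rewrite coef_map /= coef0 => /eqP.
by move=> /factor_theorem[q ->]; exists q; rewrite mulrC polyCN opprK.
Qed.

Lemma t_plus_1_size c : c != 0 ->
  size (lead_coef (t_plus_1 * c)) = (size (lead_coef c)).+1.
Proof.
move=> c0; rewrite lead_coefM lead_coefC size_mul ?lead_coef_eq0 //.
  by rewrite size_XaddC.
by rewrite -size_poly_gt0 size_XaddC.
Qed.

(** The degree in [t] of the leading coefficient bounds the number of factors. *)
Lemma strip_t_plus_1 c : c != 0 ->
  exists k c', c = t_plus_1 ^+ k * c' /\ at_m1 c' != 0.
Proof.
have [m] := ubnP (size (lead_coef c)); elim: m c => // m IH c ltm c0.
have [/t_plus_1_factor[c' cE]|cm] := eqVneq (at_m1 c) 0; last first.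
  by exists 0%N, c; rewrite expr0 mul1r.
have c'0 : c' != 0 by apply: contraNneq c0 => c'0; rewrite cE c'0 mulr0.
have [|k [c2 [c2E c2m]]] := IH c' _ c'0.
  by move: ltm; rewrite cE t_plus_1_size.
by exists k.+1, c2; rewrite cE c2E mulrA exprS.
Qed.

(** Proportionality survives the substitution [t := -1] because neither value vanishes:
    if one of the two multipliers is divisible by [t + 1] then so is the other one, and
    the factor cancels. *)
Lemma proportional_at_m1 c e al be : c != 0 -> c *: al = e *: be ->
    ~ (exists al', al = t_plus_1 *: al') -> eval_t_m1 be != 0 ->
  exists c' e' : {poly int},
    [/\ c' != 0, e' != 0 & c' *: eval_t_m1 al = e' *: eval_t_m1 be].
Proof.
move=> c0 E al_prim be0.
have al0 : eval_t_m1 al != 0.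
  apply/eqP => al0; apply: al_prim.
  suff [al' alE] : exists al', al = t_plus_1 *: al' by exists al'.
  apply: coefs_divisibleP => l; have /polyP/(_ l) := al0.
  by rewrite coef0 coef_map /= => /t_plus_1_factor.
have [m] := ubnP (size (lead_coef c)); elim: m c e c0 E => // m IH c e c0 E ltm.
have Em := congr1 eval_t_m1 E; rewrite !eval_t_m1Z in Em.
have [cm|cm] := eqVneq (at_m1 c) 0; last first.
  exists (at_m1 c), (at_m1 e); split=> //; apply/eqP => em.
  move/eqP: Em; rewrite em scale0r -mul_polyC mulf_eq0 polyC_eq0.
  by rewrite (negbTE cm) (negbTE al0).
have em : at_m1 e = 0.
  move/eqP: Em; rewrite cm scale0r eq_sym -mul_polyC mulf_eq0 polyC_eq0.
  by rewrite (negbTE be0) orbF => /eqP.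
have [c' cE] := t_plus_1_factor cm; have [e' eE] := t_plus_1_factor em.
have c'0 : c' != 0 by apply: contraNneq c0 => c'0; rewrite cE c'0 mulr0.
apply: (IH c' e') => //; last by move: ltm; rewrite cE t_plus_1_size.
have /(@mulfI _ t_plus_1%:P) : t_plus_1%:P != 0 by rewrite polyC_eq0 t_plus_1_neq0.
by apply; rewrite !mul_polyC !scalerA -cE -eE.
Qed.

(** Dividing out common factors terminates: each nonunit of [Z[t,M]] divided out
    lowers the degree in [M], the degree in [t] or the absolute value of the iterated
    leading coefficient. *)
Lemma primitive_part al : al != 0 ->
  exists c al', [/\ c != 0, al = c *: al' & coprime_coefs al'].
Proof.
pose mu c := (size c + size (lead_coef c) + `|lead_coef (lead_coef c)|)%N.
have [m] := ubnP (mu (lead_coef al)); elim: m al => // m IH al ltm al0.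
have [cop|ncop] := pselect (coprime_coefs al).
  by exists 1, al; split; rewrite ?oner_neq0 ?scale1r.
have [c [/coefs_divisibleP[al1 alE] c_unit]] :
    exists c, coefs_divisible c al /\ ~ (c = 1 \/ c = -1).
  apply: contrapT => nex; apply: ncop => c cdiv; apply: contrapT => cu.
  by apply: nex; exists c.
have c0 : c != 0 by apply: contraNneq al0 => c0; rewrite alE c0 scale0r.
have al10 : al1 != 0 by apply: contraNneq al0 => al10; rewrite alE al10 scaler0.
have [|c' [al' [c'0 al1E cop]]] := IH al1 _ al10; last first.
  exists (c * c'), al'; split; rewrite ?mulf_neq0 //.
  by rewrite alE al1E scalerA.
suff lt_mu : (mu (lead_coef al1) < mu (lead_coef al))%N.
  by apply: leq_trans lt_mu _; rewrite -ltnS.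
rewrite alE lead_coefZ /mu; set e := lead_coef al1.
have e0 : e != 0 by rewrite lead_coef_eq0.
have [lc0 le0] : lead_coef c != 0 /\ lead_coef e != 0 by rewrite !lead_coef_eq0.
rewrite lead_coefM lead_coefM size_mul // (size_mul lc0 le0) abszM.
have [llc0 lle0] : lead_coef (lead_coef c) != 0 /\ lead_coef (lead_coef e) != 0.
  by rewrite !lead_coef_eq0.
have sc : (0 < size c)%N by rewrite size_poly_gt0.
have slc : (0 < size (lead_coef c))%N by rewrite size_poly_gt0.
have allc : (0 < `|lead_coef (lead_coef c)|)%N by rewrite absz_gt0.
have alle : (0 < `|lead_coef (lead_coef e)|)%N by rewrite absz_gt0.
have : (1 < size c)%N \/ (1 < size (lead_coef c))%N \/ (1 < `|lead_coef (lead_coef c)|)%N.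
  apply: contrapT => nu; apply: c_unit.
  have /size1_polyC cE : (size c <= 1)%N by rewrite leqNgt; apply/negP => ?; apply: nu; left.
  have sz1 : (size (lead_coef c) <= 1)%N.
    by rewrite leqNgt; apply/negP => ?; apply: nu; right; left.
  have ab1 : (`|lead_coef (lead_coef c)| <= 1)%N.
    by rewrite leqNgt; apply/negP => ?; apply: nu; right; right.
  move: sz1 ab1 allc; rewrite cE lead_coefC => /size1_polyC ->; rewrite lead_coefC.
  move: (c`_0`_0) => i i1 i0; have [->|->] : i = 1 \/ i = -1 by lia.
    by left.
  by right; rewrite !rmorphN1.
move: sc slc allc alle.
move: (size c) (size (lead_coef c)) `|lead_coef (lead_coef c)|%N.
move: (size e) (size (lead_coef e)) `|lead_coef (lead_coef e)|%N => i j k i' j' k'.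
move=> i'0 j'0 k'0 k0 ineq.
have le_k : (k <= k' * k)%N by rewrite leq_pmull.
case: ineq => [i1|[j1|k1]]; [lia | lia |].
have : (k < k' * k)%N by rewrite ltn_Pmull.
lia.
Qed.

End IntegralCoefficients.

(** * Integral operators *)

Section SkewBinomials.
Implicit Types (c e : {poly {poly int}}) (Q : {poly {poly {poly int}}}) (a b j : nat).

(** The monomial [t^(2b) M^a] of [Z[t,M]].  Only even powers of [t] occur, so that it
    specializes to [M^a] at [t = -1]. *)
Definition monomial a b : {poly {poly int}} := ('X^(2 * b))%:P * 'X^a.

(** The counterpart of [pshift] over [Z[t,M]]. *)
Definition shift_coef j c : {poly {poly int}} := c \Po (('X^(2 * j))%:P * 'X).

(** The product of [c1 L^j + c0] and [Q] in the quantum torus: every operator needed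
    below is built from such factors. *)
Definition skew_binomial c1 c0 j Q : {poly {poly {poly int}}} :=
  c1 *: (map_poly (shift_coef j) Q * 'X^j) + c0 *: Q.

(** The exponent [N + a] of a Laurent monomial multiplied by an [N]-th power, for
    [|a| <= N]. *)
Definition addz (N : nat) (a : int) : nat := `|(N%:Z + a)%R|%N.

Lemma addzE (N : nat) (a : int) : `|a| <= N%:Z -> (addz N a)%:Z = N%:Z + a.
Proof. by rewrite /addz; lia. Qed.

Lemma monomial_neq0 a b : monomial a b != 0.
Proof. by rewrite mulf_neq0 ?polyC_eq0 ?monic_neq0 ?monicXn. Qed.

Lemma at_m1_monomial a b : at_m1 (monomial a b) = 'X^a.
Proof.
rewrite at_m1M /at_m1 map_polyC map_polyXn /= /horner_eval hornerXn.
by rewrite mulnC exprM sqrr_sign mul1r.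
Qed.

Lemma shift_coef0 j : shift_coef j 0 = 0. Proof. exact: comp_poly0. Qed.

Lemma size_shift j : size (('X^(2 * j) : {poly int})%:P * 'X) = 2.
Proof. by rewrite size_Cmul ?size_polyX // monic_neq0 ?monicXn. Qed.

Lemma shift_coef_eq0 j c : (shift_coef j c == 0) = (c == 0).
Proof. by rewrite /shift_coef comp_poly_eq0 // size_shift. Qed.

Lemma at_m1_shift j c : at_m1 (shift_coef j c) = at_m1 c.
Proof.
rewrite /at_m1 /shift_coef map_comp_poly rmorphM /= map_polyC map_polyX /=.
by rewrite /horner_eval hornerXn mulnC exprM sqrr_sign mul1r comp_polyXr.
Qed.

Lemma size_skew_binomial c1 c0 j Q : c1 != 0 -> Q != 0 -> (0 < j)%N ->
  size (skew_binomial c1 c0 j Q) = (j + size Q)%N.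
Proof.
move=> c10 Q0 j0; have sz1 : size (c1 *: (map_poly (shift_coef j) Q * 'X^j)) = (j + size Q)%N.
  rewrite size_scale // size_mulXn ?size_map_poly_id0 ?shift_coef_eq0 ?lead_coef_eq0 //.
  by rewrite -size_poly_eq0 size_map_poly_id0 ?shift_coef_eq0 ?lead_coef_eq0 // size_poly_eq0.
rewrite size_polyDl sz1 //.
by apply: leq_ltn_trans (size_scale_leq _ _) _; rewrite -addn1 addnC leq_add2r.
Qed.

Lemma eval_skew_binomial c1 c0 j Q : eval_t_m1 (skew_binomial c1 c0 j Q) =
  (at_m1 c1 *: 'X^j + (at_m1 c0)%:P) * eval_t_m1 Q.
Proof.
rewrite eval_t_m1D !eval_t_m1Z eval_t_m1M mulrDl mul_polyC -scalerAl.
congr (_ *: _ + _); rewrite mulrC; congr (_ * _).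
  by apply/polyP => i; rewrite /eval_t_m1 map_polyXn.
apply/polyP => i; rewrite /eval_t_m1 coef_map /= coef_map_id0 ?shift_coef0 //.
by rewrite -/(at_m1 _) at_m1_shift coef_map.
Qed.

Lemma binomial_at_m1 (N d : nat) (a sg : int) : `|a| <= N%:Z -> exists m : nat,
  ('X^N : {poly int}) *: 'X^d + (- (sg%:~R * 'X^(addz N a)))%:P
    = ('X^m)%:P * binomialF a d sg.
Proof.
move=> leN; rewrite /binomialF polyCN; case: ltrP => a0.
  exists (addz N a); rewrite mulrBr mul_polyC scalerA -exprD -polyCM.
  congr ('X^_ *: _ - _%:P); first by rewrite /addz; lia.
  by rewrite mulrC.
exists N; rewrite mulrBr mul_polyC -polyCM mulrCA -exprD.
by congr (_ - (_ * 'X^_)%:P); rewrite /addz; lia.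
Qed.

End SkewBinomials.

Section Embedding.
Variables (K : fieldType) (t : K).
Hypothesis transcendental : forall P : {poly int}, (map_poly intr P).[t] = 0 -> P = 0.
Implicit Types (c e : {poly {poly int}}) (Q : {poly {poly {poly int}}}) (n : int).

(** Integral polynomials in [t] and [M] are mapped to [K] and to [K[M]] by substituting
    the transcendental element for [t]. *)
Definition tev (P : {poly int}) : K := (map_poly intr P).[t].

Lemma tev_is_zmod_morphism : zmod_morphism tev.
Proof. by move=> P Q; rewrite /tev rmorphB hornerD hornerN. Qed.
Lemma tev_is_monoid_morphism : monoid_morphism tev.
Proof.
by split=> [|P Q]; rewrite /tev ?rmorph1 ?hornerC // rmorphM hornerM.
Qed.
HB.instance Definition _ := GRing.isZmodMorphism.Build {poly int} K tev tev_is_zmod_morphism.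
HB.instance Definition _ := GRing.isMonoidMorphism.Build {poly int} K tev tev_is_monoid_morphism.

Definition embed_coef c : {poly K} := map_poly tev c.
Definition embed Q : {poly {poly K}} := map_poly (map_poly tev) Q.
Definition zev c n : K := pev t (embed_coef c) n.

Lemma tev_eq0 P : (tev P == 0) = (P == 0).
Proof. by apply/eqP/eqP => [/transcendental //|->]; rewrite rmorph0. Qed.

Lemma embed_coef_eq0 c : (embed_coef c == 0) = (c == 0).
Proof.
apply/eqP/eqP => [/polyP c0|->]; last exact: rmorph0.
by apply/polyP => i; have := c0 i; rewrite coef_map !coef0 => /eqP; rewrite tev_eq0 => /eqP.
Qed.

Lemma embed_eq0 Q : (embed Q == 0) = (Q == 0).
Proof.
apply/eqP/eqP => [/polyP Q0|->]; last exact: rmorph0.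
apply/polyP => i; have := Q0 i; rewrite coef_map !coef0 => /eqP.
by rewrite embed_coef_eq0 => /eqP.
Qed.

Lemma size_embed Q : size (embed Q) = size Q.
Proof.
have [->|Q0] := eqVneq Q 0; first by rewrite /embed rmorph0 !size_poly0.
by rewrite size_map_poly_id0 // embed_coef_eq0 lead_coef_eq0.
Qed.

Lemma tevX : tev 'X = t. Proof. by rewrite /tev map_polyX hornerX. Qed.

Lemma transcendental_neq0 : t != 0.
Proof. by rewrite -tevX tev_eq0 polyX_eq0. Qed.

Let t_neq0 := transcendental_neq0.

Lemma transcendental_inf (i : int) : t ^ i = 1 -> i = 0.
Proof.
have pos (m : nat) : t ^+ m = 1 -> m = 0%N.
  move=> tm; have /eqP : tev ('X^m - 1) = 0 by rewrite rmorphB rmorphXn rmorph1 /= tevX tm subrr.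
  by rewrite tev_eq0 subr_eq0; case: m {tm} => // m /eqP/(congr1 (fun P : {poly int} => size P)); rewrite size_polyXn size_poly1.
have [i0|i0] := lerP 0 i.
  by rewrite (_ : i = `|i|%N%:Z) => [/pos ->//|]; lia.
rewrite (_ : i = - `|i|%N%:Z); last by lia.
by rewrite -exprnN => /(congr1 GRing.inv); rewrite invrK invr1 => /pos ->.
Qed.

Let t_inf := transcendental_inf.

Lemma zevD c e n : zev (c + e) n = zev c n + zev e n.
Proof. by rewrite /zev /embed_coef rmorphD pevD. Qed.

Lemma zevN c n : zev (- c) n = - zev c n.
Proof. by rewrite /zev /embed_coef rmorphN /pev hornerN. Qed.

Lemma zevM c e n : zev (c * e) n = zev c n * zev e n.
Proof. by rewrite /zev /embed_coef rmorphM pevM. Qed.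

Lemma zevC (P : {poly int}) n : zev P%:P n = tev P.
Proof. by rewrite /zev /embed_coef map_polyC /pev hornerC. Qed.

Lemma zev_int (i : int) n : zev i%:~R n = i%:~R.
Proof. by rewrite -(rmorph_int (@polyC {poly int})) zevC rmorph_int. Qed.

Lemma zev_monomial a b n : zev (monomial a b) n = t ^ (2 * a%:Z * n + 2 * b%:Z).
Proof.
rewrite /monomial zevM zevC rmorphXn /= tevX /zev /embed_coef map_polyXn /pev hornerXn.
by rewrite !exprnP exprz_exp (tD t_neq0); congr (t ^ _); rewrite PoszM; ring.
Qed.

Lemma zev_shift j c n : zev (shift_coef j c) n = zev c (n + j%:Z).
Proof.
rewrite /zev -(pev_shift t_neq0) /embed_coef /shift_coef map_comp_poly rmorphM /=.
by rewrite map_polyC map_polyX /= rmorphXn /= tevX mul_polyC.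
Qed.

Lemma act_embed1 f n : act t (embed 1) f n = f n.
Proof.
by rewrite /embed rmorph1 /act size_poly1 big_ord1 coefC /= /pev hornerC mul1r addr0.
Qed.

Lemma act_skew_binomial c1 c0 j Q f n :
  act t (embed (skew_binomial c1 c0 j Q)) f n =
  zev c1 n * act t (embed Q) f (n + j%:Z) + zev c0 n * act t (embed Q) f n.
Proof.
rewrite /embed rmorphD actD -!mul_polyC !rmorphM /= !map_polyC /= map_polyXn.
rewrite !mul_polyC !actZ; congr (_ * _ + _).
rewrite -(act_shift t_neq0); congr act; congr (_ * _).
apply/polyP => i; rewrite coef_map /= !coef_map_id0 ?rmorph0 ?shift_coef0 ?pshift0 //.
rewrite /shift_coef map_comp_poly rmorphM /= map_polyC map_polyX /= rmorphXn /= tevX.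
by rewrite mul_polyC.
Qed.

(** Laurent polynomials in [t] and [M] over [Z], up to powers of [t^4 - 1]: quantum
    integers have the denominator [t^2 - t^(-2)].  The factor [t^(2N(n+1))], which is
    [(t^2 M)^N], clears the negative powers of [t] and [M] simultaneously. *)
Definition int_laurent (x : int -> K) := exists (k N : nat) c, forall n,
  t ^ (2 * N%:Z * (n + 1)) * (t ^+ 4 - 1) ^+ k * x n = zev c n.

Lemma t4_neq1 : t ^+ 4 - 1 != 0.
Proof. by rewrite subr_eq0; apply/eqP => /(@t_inf 4). Qed.

Lemma int_laurent_raise x : int_laurent x -> exists k0 N0 : nat, forall k N : nat,
  (k0 <= k)%N -> (N0 <= N)%N -> exists c, forall n,
  t ^ (2 * N%:Z * (n + 1)) * (t ^+ 4 - 1) ^+ k * x n = zev c n.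
Proof.
move=> [k0 [N0 [c cE]]]; exists k0, N0 => k N le_k le_N.
exists (monomial (N - N0) (N - N0) * (('X^4 - 1) ^+ (k - k0))%:P * c) => n.
rewrite zevM zevM -cE zev_monomial zevC rmorphXn rmorphB rmorph1 rmorphXn /= tevX.
rewrite -{1}(subnK le_k) exprD.
have -> : t ^ (2 * N%:Z * (n + 1)) =
    t ^ (2 * (N - N0)%N%:Z * n + 2 * (N - N0)%N%:Z) * t ^ (2 * N0%:Z * (n + 1)).
  by rewrite (tD t_neq0); congr (t ^ _); rewrite -subzn //; ring.
by ring.
Qed.

Lemma eq_int_laurent x y : x =1 y -> int_laurent x -> int_laurent y.
Proof. by move=> xy [k [N [c cE]]]; exists k, N, c => n; rewrite -xy. Qed.

Lemma int_laurentD x y : int_laurent x -> int_laurent y -> int_laurent (fun n => x n + y n).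
Proof.
move=> /int_laurent_raise[k [N xP]] /int_laurent_raise[k' [N' yP]].
have [c cE] := xP (k + k')%N (N + N')%N (leq_addr _ _) (leq_addr _ _).
have [c' cE'] := yP (k + k')%N (N + N')%N (leq_addl _ _) (leq_addl _ _).
by exists (k + k')%N, (N + N')%N, (c + c') => n; rewrite zevD -cE -cE' mulrDr.
Qed.

Lemma int_laurentM x y : int_laurent x -> int_laurent y -> int_laurent (fun n => x n * y n).
Proof.
move=> [k [N [c cE]]] [k' [N' [c' cE']]]; exists (k + k')%N, (N + N')%N, (c * c') => n.
rewrite zevM -cE -cE' exprD.
have -> : t ^ (2 * (N + N')%N%:Z * (n + 1)) =
    t ^ (2 * N%:Z * (n + 1)) * t ^ (2 * N'%:Z * (n + 1)).
  by rewrite (tD t_neq0); congr (t ^ _); rewrite PoszD; ring.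
by ring.
Qed.

Lemma int_laurent_int (i : int) : int_laurent (fun=> i%:~R).
Proof. by exists 0%N, 0%N, i%:~R => n; rewrite zev_int mulr0 mul0r expr0z expr0 !mul1r. Qed.

Lemma int_laurentN x : int_laurent x -> int_laurent (fun n => - x n).
Proof.
move=> /(int_laurentM (int_laurent_int (-1))); apply: eq_int_laurent => n.
by rewrite mulrN1z mulNr mul1r.
Qed.

Lemma int_laurent_power (a b : int) : int_laurent (fun n => t ^ (2 * a * n + 2 * b)).
Proof.
pose N := (`|a| + `|b|)%N.
exists 0%N, N, (monomial (addz N a) (addz N b)) => n.
rewrite expr0 mulr1 zev_monomial (tD t_neq0); congr (t ^ _).
by rewrite !addzE; [ring | rewrite /N; lia | rewrite /N; lia].
Qed.

Lemma int_laurent_shift (j : nat) x : int_laurent x -> int_laurent (fun n => x (n + j%:Z)).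
Proof.
move=> [k [N [c cE]]].
have y : int_laurent (fun n => t ^ (2 * N%:Z * (n + j%:Z + 1)) * x (n + j%:Z)).
  by exists k, 0%N, (shift_coef j c) => n; rewrite mulr0 mul0r expr0z mul1r mulrCA mulrA cE zev_shift.
apply: eq_int_laurent (int_laurentM (int_laurent_power (- N%:Z) (- N%:Z * (j%:Z + 1))) y) => n.
rewrite mulrA (tD t_neq0) (_ : _ + _ = 0) ?expr0z ?mul1r //.
by ring.
Qed.

Lemma int_laurent_quantum : int_laurent (fun=> (t ^ 2 - t ^ (- 2))^-1).
Proof.
exists 1%N, 0%N, (('X^2)%:P) => n.
rewrite mulr0 mul0r expr0z mul1r expr1 zevC rmorphXn /= tevX.
have -> : t ^ 2 - t ^ (- 2) = (t ^+ 4 - 1) / t ^+ 2.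
  rewrite -[t ^ 2]/(t ^+ 2) -[t ^ (- 2)]/(t ^- 2); field; exact: t_neq0.
by rewrite invf_div mulrCA divff ?t4_neq1 ?mulr1.
Qed.

Lemma int_laurent_laurent x : int_laurent x -> laurent t x.
Proof.
move=> [k [N [c cE]]].
have L := laurentM t_neq0 (laurent_mono t_neq0 (- N%:Z) (- (2 * N%:Z)))
  (laurentM t_neq0 (laurent_cst t ((t ^+ 4 - 1) ^- k)) (laurent_pev t (embed_coef c))).
apply: eq_laurent L => n; rewrite -/(zev c n) -cE.
rewrite [_ * (t ^+ 4 - 1) ^+ k]mulrC -!mulrA mulKf ?expf_neq0 ?t4_neq1 //.
by rewrite [LHS]mulrA (tD t_neq0) (_ : _ + _ = 0) ?expr0z ?mul1r //; ring.
Qed.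

End Embedding.

(** * The recurrence operator of minimal order *)

Section RecurrenceOperator.
Variables (K : fieldType) (t : K).
Hypothesis transcendental : forall P : {poly int}, (map_poly intr P).[t] = 0 -> P = 0.
Let t_neq0 := transcendental_neq0 transcendental.
Let t_inf := transcendental_inf transcendental.
Variables (d1 d2 : nat) (a1 b1 a2 b2 s1 s2 : int) (f h A w z : int -> K).
Hypotheses (d1_gt0 : (0 < d1)%N) (d2_gt0 : (0 < d2)%N).

(** The invertible Laurent monomials [sg t^(2b) M^a]. *)
Definition unit_mono (sg a b : int) (n : int) : K := sg%:~R * t ^ (2 * a * n + 2 * b).

Local Notation u1 := (unit_mono s1 a1 b1).
Local Notation u2 := (unit_mono s2 a2 b2).

Hypothesis rec_f : forall n, f (n + d1%:Z) = u1 n * f n + (A n * h n + w n).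
Hypothesis rec_h : forall n, h (n + d2%:Z) = u2 n * h n + z n.
Hypothesis A_int : exists (N : nat) c,
  at_m1 c != 0 /\ forall n, t ^ (2 * N%:Z * (n + 1)) * A n = zev t c n.
Hypotheses (w_int : int_laurent t w) (z_int : int_laurent t z).
Hypothesis indep_h : indep t d2 h (laurent t).
Hypothesis indep_f : indep t d1 f (span t d2 h (laurent t)).

Let g n := A n * h n + w n.
Hypothesis b_neq0 : exists n, A n * g (n + d2%:Z) - u2 n * A (n + d2%:Z) * g n != 0.

Lemma unit_mono_int (sg a b : int) : int_laurent t (unit_mono sg a b).
Proof.
exact: int_laurentM (int_laurent_int _ _) (int_laurent_power transcendental a b).
Qed.

Lemma unit_mono_laurent sg a b : laurent t (unit_mono sg a b).
Proof. exact/int_laurent_laurent/unit_mono_int. Qed.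

Lemma span_h_module : seq_module t (span t d2 h (laurent t)).
Proof.
case: d2 d2_gt0 rec_h => // d _ rec.
apply: (span_module t_neq0 (laurent_module t_neq0) (unit_mono_laurent s2 a2 b2) _ rec).
exact: int_laurent_laurent.
Qed.

Lemma span_h_base : span t d2 h (laurent t) h.
Proof.
case: d2 d2_gt0 => // d _.
exact: (span_base _ _ (laurent_module t_neq0) (laurent_cst t 0)).
Qed.

Lemma span_h_combination x y : laurent t x -> laurent t y ->
  span t d2 h (laurent t) (fun n => x n * h n + y n).
Proof.
move=> xL yL; apply: (seq_moduleD span_h_module); last exact: span_sub.
exact: (seq_moduleM span_h_module xL span_h_base).
Qed.

Lemma A_laurent : laurent t A.
Proof.
have [N [c [_ cE]]] := A_int; apply: (int_laurent_laurent transcendental).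
by exists 0%N, N, c => n; rewrite expr0 mulr1 cE.
Qed.

(** All the sequences [Q f] lie in the module spanned by the shifts of [f], of [h] and
    of [1].  Independence makes this module free over the Laurent sequences, and these
    vanish as soon as they vanish for large [n]. *)
Lemma act_tame Q : ev0 (act t Q f) -> forall n, act t Q f n = 0.
Proof.
have M : seq_module t (span t d1 f (span t d2 h (laurent t))).
  case: d1 d1_gt0 rec_f => // d _ rec.
  apply: (span_module t_neq0 span_h_module (unit_mono_laurent s1 a1 b1) _ rec).
  exact: span_h_combination A_laurent (int_laurent_laurent transcendental w_int).
have fM : span t d1 f (span t d2 h (laurent t)) f.
  case: d1 d1_gt0 => // d _; apply: (span_base _ _ span_h_module).
  exact: span_h_base.
apply: (tame_span indep_f (tame_span indep_h (tame_laurent t_neq0 t_inf))).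
exact: (seq_module_act t_neq0 _ M fM).
Qed.

Lemma order_ge_ext k F G : F =1 G -> order_ge t k F -> order_ge t k G.
Proof.
move=> FG ordF Q szQ [n0 Q0]; apply: ordF => //; exists n0 => n le_n.
by rewrite (eq_act _ _ _ FG) Q0.
Qed.

(** The operator is [(b(n) L - b(n+1)) (A L^d2 - u2 A(n+d2)) (L^d1 - u1)]: the last
    factor maps [f] to [g = A h + w], the middle one maps [g] to the Laurent sequence
    [b(n) = A(n) g(n+d2) - u2(n) A(n+d2) g(n)], in which [h] has been eliminated, and
    the first one kills [b].  The order of [f] is the sum of the orders of the factors
    by [order_ge_step].  At [t = -1] the sequence [b] becomes a polynomial in [M], and
    the first factor becomes a multiple of [L - 1]. *)
Lemma recurrence_operator : s1 = 1 \/ s1 = -1 -> s2 = 1 \/ s2 = -1 ->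
  exists (al : {poly {poly {poly int}}}) (B : {poly int}),
  [/\ size al = (d1 + d2).+2, forall n, act t (embed t al) f n = 0,
      order_ge t (d1 + d2).+1 f, B != 0 &
      eval_t_m1 al = B%:P * (('X - 1) * binomialF a1 d1 s1 * binomialF a2 d2 s2)].
Proof.
move=> s1P s2P; have [NA [cA0 [cA0_m1 cA0E]]] := A_int.
(* Multiplication by [T1], a power of [t^2 M], makes the three coefficients of the
   recurrence of [f] integral. *)
pose N1 := (NA + `|a1| + `|b1|)%N; pose T1 n := t ^ (2 * N1%:Z * (n + 1)).
pose e1 := monomial N1 N1.
pose e0 := - (s1%:~R * monomial (addz N1 a1) (addz N1 b1)).
have leN1 : `|a1| <= N1%:Z /\ `|b1| <= N1%:Z by rewrite /N1; lia.
have leNA : (NA <= N1)%N by rewrite /N1 -addnA leq_addr.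
have e1E n : zev t e1 n = T1 n.
  by rewrite /e1 (zev_monomial transcendental); congr (t ^ _); ring.
have e0E n : zev t e0 n = - (T1 n * u1 n).
  rewrite zevN zevM zev_int (zev_monomial transcendental) /unit_mono mulrCA; congr (- (_ * _)).
  rewrite /T1 (tD t_neq0); congr (t ^ _).
  by rewrite !addzE; [ring | case: leN1 | case: leN1].
pose cA := monomial (N1 - NA) (N1 - NA) * cA0.
pose A' n := T1 n * A n; pose w' n := T1 n * w n.
have cAE n : zev t cA n = A' n.
  rewrite zevM -cA0E (zev_monomial transcendental) mulrA (tD t_neq0) /A' /T1.
  by congr (t ^ _ * _); rewrite -subzn //; ring.
have cA_m1 : at_m1 cA != 0.
  by rewrite at_m1M at_m1_monomial mulf_neq0 // monic_neq0 ?monicXn.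
have cA_neq0 : cA != 0 by apply: contraNneq cA_m1 => ->; rewrite /at_m1 rmorph0.
pose Q1 := skew_binomial e1 e0 d1 1.
pose G n := A' n * h n + w' n.
have Q1E n : act t (embed t Q1) f n = G n.
  rewrite (act_skew_binomial transcendental) !act_embed1 rec_f e1E e0E /G /A' /w'.
  by ring.
have A'_int : int_laurent t A' by exists 0%N, 0%N, cA => n; rewrite cAE mulr0 mul0r expr0z !mul1r.
have w'_int : int_laurent t w'.
  apply: (int_laurentM transcendental _ w_int).
  by exists 0%N, 0%N, e1 => n; rewrite e1E mulr0 mul0r expr0z !mul1r.
pose b' n := A' n * G (n + d2%:Z) - u2 n * A' (n + d2%:Z) * G n.
have b'_int : int_laurent t b'.
  have L : int_laurent t (fun n => A' n * A' (n + d2%:Z) * z n + A' n * w' (n + d2%:Z)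
      - u2 n * A' (n + d2%:Z) * w' n).
    have LM := int_laurentM transcendental; have LD := int_laurentD transcendental.
    have LS := int_laurent_shift transcendental d2; have LN := int_laurentN transcendental.
    apply: (LD); last by apply: (LN); apply: (LM) w'_int; apply: (LM) (LS _ A'_int); exact: unit_mono_int.
    apply: (LD); last exact: (LM _ _ A'_int (LS _ w'_int)).
    exact: (LM _ _ (LM _ _ A'_int (LS _ A'_int)) z_int).
  apply: eq_int_laurent L => n; rewrite /b' /G rec_h; ring.
have [k [N2' raise]] := int_laurent_raise transcendental b'_int.
pose N2 := (N2' + `|a2| + `|b2|)%N; pose T2 n := t ^ (2 * N2%:Z * (n + 1)).
have leN2 : `|a2| <= N2%:Z /\ `|b2| <= N2%:Z by rewrite /N2; clear; lia.
have [||cb cbE] := raise k N2; rewrite ?leqnn //; first by rewrite /N2 -addnA leq_addr.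
pose tt := t ^+ 4 - 1.
have tt0 : tt ^+ k != 0 by rewrite expf_neq0 // (t4_neq1 transcendental).
have cb_neq0 : cb != 0.
  have [n bn] := b_neq0; apply/eqP => cb0; move: (cbE n); rewrite cb0.
  rewrite /zev /embed_coef rmorph0 pev0 => /eqP.
  rewrite !mulf_eq0 (negbTE tt0) (negbTE (t_expf_neq0 t_neq0 _)) /=.
  have -> : b' n = T1 n * T1 (n + d2%:Z) * (A n * g (n + d2%:Z) - u2 n * A (n + d2%:Z) * g n).
    by rewrite /b' /G /A' /w' /g; ring.
  by rewrite !mulf_eq0 !(negbTE (t_expf_neq0 t_neq0 _)) (negbTE bn).
(* Factors [t + 1] of [b] would make the operator vanish at [t = -1]; they are
   constants for [L] and can be left out. *)
have [i [c0 [cbE' c0_m1]]] := strip_t_plus_1 cb_neq0.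
pose y1 := monomial N2 N2 * cA.
pose y0 := - (s2%:~R * monomial (addz N2 a2) (addz N2 b2) * shift_coef d2 cA).
have y1E n : zev t y1 n = T2 n * A' n.
  rewrite zevM cAE (zev_monomial transcendental); congr (t ^ _ * _); ring.
have y0E n : zev t y0 n = - (T2 n * u2 n * A' (n + d2%:Z)).
  rewrite zevN zevM (zev_shift transcendental) cAE; congr (- (_ * _)).
  rewrite zevM zev_int (zev_monomial transcendental) /unit_mono mulrCA; congr (_ * _).
  rewrite /T2 (tD t_neq0); congr (t ^ _).
  by rewrite !addzE; [ring | case: leN2 | case: leN2].
pose b'' n := T2 n * b' n.
have y_act F n : act t (embed t (skew_binomial y1 y0 d2 1)) F n =
    T2 n * (A' n * F (n + d2%:Z) - u2 n * A' (n + d2%:Z) * F n).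
  by rewrite (act_skew_binomial transcendental) !act_embed1 y1E y0E; ring.
pose Q2 := skew_binomial y1 y0 d2 Q1.
have Q2E n : act t (embed t Q2) f n = b'' n.
  by rewrite (act_skew_binomial transcendental) !Q1E y1E y0E /b'' /b'; ring.
pose kap := (tev t ('X + 1)) ^+ i / tt ^+ k.
have b''E n : b'' n = kap * zev t c0 n.
  have E : T2 n * tt ^+ k * b' n = tev t ('X + 1) ^+ i * zev t c0 n.
    by rewrite [LHS]cbE cbE' zevM /t_plus_1 -rmorphXn zevC rmorphXn.
  apply: (mulfI tt0); rewrite [LHS]mulrCA [LHS]mulrA E /kap [RHS]mulrA.
  by rewrite [tt ^+ k * _]mulrC divfK.
pose al := skew_binomial c0 (- shift_coef 1 c0) 1 Q2.
have alE n : act t (embed t al) f n = 0.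
  rewrite (act_skew_binomial transcendental) !Q2E !b''E zevN (zev_shift transcendental).
  by ring.
have Q1_size : size Q1 = d1.+1.
  by rewrite size_skew_binomial ?monomial_neq0 ?oner_neq0 // size_poly1 addn1.
have y1_neq0 : y1 != 0 by rewrite mulf_neq0 ?monomial_neq0.
have Q1_neq0 : Q1 != 0 by rewrite -size_poly_eq0 Q1_size.
have Q2_size : size Q2 = (d2 + d1.+1)%N by rewrite size_skew_binomial // Q1_size.
have Q2_neq0 : Q2 != 0 by rewrite -size_poly_eq0 Q2_size addnS.
have c0_neq0 : c0 != 0 by apply: contraNneq c0_m1 => ->; rewrite /at_m1 rmorph0.
have [m1 m1E] := binomial_at_m1 d1 s1 (proj1 leN1).
have [m2 m2E] := binomial_at_m1 d2 s2 (proj1 leN2).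
exists al, (at_m1 c0 * 'X^m2 * at_m1 cA * 'X^m1); split=> //.
- by rewrite size_skew_binomial // Q2_size addnS add1n addnC.
- have order_b : order_ge t 1 b''.
    move=> Q szQ [n0 Q0]; have E n : act t Q b'' n = pev t Q`_0 n * b'' n.
      by rewrite (actE _ _ _ szQ) big_ord1 addr0.
    have : Q`_0 * embed_coef t c0 = 0.
      apply: (pev_ev0 t_neq0 t_inf); exists n0 => n le_n; rewrite pevM.
      have := Q0 n le_n; rewrite E b''E mulrCA => /eqP; rewrite mulf_eq0 => /orP[/eqP kap0|/eqP //].
      have [m bm] := b_neq0; exfalso; move: (b''E m); rewrite kap0 mul0r => /eqP.
      rewrite mulf_eq0 (negbTE (t_expf_neq0 t_neq0 _)) /=.
      have -> : b' m = T1 m * T1 (m + d2%:Z) * (A m * g (m + d2%:Z) - u2 m * A (m + d2%:Z) * g m).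
        by rewrite /b' /G /A' /w' /g; ring.
      by rewrite !mulf_eq0 !(negbTE (t_expf_neq0 t_neq0 _)) (negbTE bm).
    move=> /eqP; rewrite mulf_eq0 embed_coef_eq0 // (negbTE c0_neq0) orbF => /eqP Q00.
    by rewrite (size1_polyC szQ) Q00 polyC0.
  have order_G : order_ge t (d2 + 1) G.
    apply: (@order_ge_step _ t t_neq0 (embed t (skew_binomial y1 y0 d2 1))).
    + by rewrite size_embed // size_skew_binomial ?oner_neq0 // size_poly1 addn1.
    + by apply: order_ge_ext order_b => n; rewrite y_act.
    move=> X S szS SX; apply/polyP => l; rewrite coef0.
    have [lt_l|le_l] := ltnP l d2; last by rewrite nth_default // (leq_trans szS).
    suff : S`_l * pshift t l (embed_coef t cA) = 0.
      move/eqP; rewrite mulf_eq0 (pshift_eq0 t_neq0) embed_coef_eq0 // (negbTE cA_neq0).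
      by rewrite orbF => /eqP.
    apply: (pev_ev0 t_neq0 t_inf); exists 0 => n _.
    rewrite pevM (pev_shift t_neq0) -/(zev t cA _) cAE.
    (* [S G] is a combination of the shifts of [h], because [G = A' h + w']. *)
    pose rho i m := pev t S`_i m * A' (m + i%:Z).
    pose rest m := act t S w' m + act t X (act t (embed t (skew_binomial y1 y0 d2 1)) G) m.
    suff rho0 : forall i m, (i < d2)%N -> rho i m = 0 by apply: rho0.
    apply: (@indep_h rho rest).
    + move=> j; apply: (laurentM t_neq0 (laurent_pev _ _)).
      exact/(int_laurent_laurent transcendental)/(int_laurent_shift transcendental).
    + apply: (laurentD t_neq0).
        apply: (seq_module_act t_neq0 _ (laurent_module t_neq0)).
        exact: int_laurent_laurent.
      apply: (seq_module_act t_neq0 _ (laurent_module t_neq0)).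
      apply: (@eq_laurent _ _ (fun n => T2 n * b' n)) => [m|]; first by rewrite y_act.
      apply: (laurentM t_neq0); last exact: int_laurent_laurent.
      apply: eq_laurent (laurent_mono t_neq0 N2%:Z (2 * N2%:Z)) => m.
      by congr (t ^ _); ring.
    have [n0 SX0] := SX; exists n0 => m le_m; rewrite -[RHS](SX0 m le_m) addrA.
    congr (_ + _); rewrite (actE _ _ _ szS) (actE _ _ _ szS) -big_split /=.
    by apply: eq_bigr => j _; rewrite /rho /G; ring.
  rewrite -addn1 -addnA.
  apply: (@order_ge_step _ t t_neq0 (embed t Q1)).
  + by rewrite size_embed.
  + by apply: order_ge_ext order_G => n; rewrite Q1E.
  move=> X S szS SX; apply: (indep_act t_neq0 t_inf indep_f _ szS SX).
  apply: (seq_module_act t_neq0 _ span_h_module).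
  apply: (seq_module_ext span_h_module) (span_h_combination (x := A') (y := w') _ _) => [n||].
  + by rewrite Q1E.
  + exact: int_laurent_laurent.
  + exact: int_laurent_laurent.
- by rewrite !mulf_neq0 // monic_neq0 ?monicXn.
have one_m1 : eval_t_m1 1 = 1 by rewrite /eval_t_m1 rmorph1.
rewrite /al eval_skew_binomial at_m1N at_m1_shift /Q2 eval_skew_binomial /Q1 eval_skew_binomial.
have -> : at_m1 e0 = - (s1%:~R * 'X^(addz N1 a1)).
  by rewrite at_m1N at_m1M at_m1_int at_m1_monomial.
rewrite one_m1 mulr1 at_m1_monomial m1E.
have -> : at_m1 y1 *: 'X^d2 + (at_m1 y0)%:P = (at_m1 cA)%:P * (('X^m2)%:P * binomialF a2 d2 s2).
  have -> : at_m1 y1 = 'X^N2 * at_m1 cA by rewrite at_m1M at_m1_monomial.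
  have -> : at_m1 y0 = - (s2%:~R * 'X^(addz N2 a2)) * at_m1 cA.
    rewrite mulNr at_m1N at_m1M at_m1_shift [at_m1 (_ * monomial _ _)]at_m1M.
    by rewrite at_m1_int at_m1_monomial.
  by rewrite -m2E mulrDr mul_polyC scalerA -polyCM [at_m1 cA * 'X^N2]mulrC [at_m1 cA * - _]mulrC.
rewrite -!mul_polyC polyCN expr1 !polyCM.
by ring.
Qed.

End RecurrenceOperator.

(** * Twisted Laurent polynomials *)

Section MalgSums.
Variables (I : choiceType) (G V : zmodType) (F : I -> G -> V).
Hypotheses (F0 : forall k, F k 0 = 0) (FD : forall k, {morph F k : x y / x + y}).

(** The maps on a monoid algebra that are defined by sums over the support are additive
    and determined by their values on monomials, which reduces the identities below
    to monomials. *)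
Definition malg_sum (g : {malg G[I]}) : V := \sum_(k <- msupp g) F k g@_k.

Lemma malg_sumEw (d : {fset I}) g : (msupp g `<=` d)%fset ->
  malg_sum g = \sum_(k <- d) F k g@_k.
Proof.
by move=> le; rewrite /malg_sum; apply: big_fset_incl => // k _ /mcoeff_outdom ->.
Qed.

Lemma malg_sumD g h : malg_sum (g + h) = malg_sum g + malg_sum h.
Proof.
rewrite (@malg_sumEw (msupp g `|` msupp h)%fset (g + h)) ?msuppD_le //.
rewrite (@malg_sumEw (msupp g `|` msupp h)%fset g) ?fsubsetUl //.
rewrite (@malg_sumEw (msupp g `|` msupp h)%fset h) ?fsubsetUr //.
by rewrite -big_split; apply: eq_bigr => k _; rewrite mcoeffD FD.
Qed.

Lemma malg_sumU c k : malg_sum << c *g k >> = F k c.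
Proof.
by rewrite (@malg_sumEw [fset k]%fset) ?msuppU_le // big_seq_fset1 mcoeffUU.
Qed.

Lemma malg_sum0 : malg_sum 0 = 0.
Proof. by rewrite /malg_sum msupp0 big_seq_fset0. Qed.

Lemma malg_sum_sum (J : Type) (r : seq J) (P : pred J) (g : J -> {malg G[I]}) :
  malg_sum (\sum_(j <- r | P j) g j) = \sum_(j <- r | P j) malg_sum (g j).
Proof. by apply: (big_morph _ malg_sumD malg_sum0). Qed.

End MalgSums.

Lemma malg_ind (I : choiceType) (G : zmodType) (P : {malg G[I]} -> Prop) :
  P 0 -> (forall g h, P g -> P h -> P (g + h)) -> (forall c k, P << c *g k >>) ->
  forall g, P g.
Proof. by move=> P0 PD PU g; rewrite [g]monalgE; apply: big_ind => // k _. Qed.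

(** Twisted Laurent polynomials: [L^a x = sh a x L^a] for [x] in the ring [S]. *)
Section TwistedLaurent.
Variables (S : comNzRingType) (sh : int -> S -> S).
Hypotheses (shB : forall a, {morph sh a : x y / x - y})
  (shM : forall a, {morph sh a : x y / x * y})
  (sh_sh : forall a b x, sh a (sh b x) = sh (a + b) x) (sh_0 : forall x, sh 0 x = x).
Local Notation malgS := {malg S[int]}.
Implicit Types (u v w : malgS) (x y : S) (a b : int).

Definition twmul u v : malgS :=
  \sum_(a <- msupp u) \sum_(b <- msupp v) << u@_a * sh a v@_b *g a + b >>.

Lemma sh0 a : sh a 0 = 0. Proof. by rewrite -[X in sh a X](subrr 0) shB subrr. Qed.
Lemma shN a x : sh a (- x) = - sh a x. Proof. by rewrite -sub0r shB sh0 sub0r. Qed.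
Lemma shD a : {morph sh a : x y / x + y}.
Proof. by move=> x y; rewrite -[y in LHS]opprK shB shN opprK. Qed.

Let inner v a x : malgS := malg_sum (fun b y => << x * sh a y *g a + b >>) v.

Lemma inner_additive a x : (forall b : int, << x * sh a 0 *g a + b >> = 0 :> malgS) /\
  (forall b : int, {morph (fun y => << x * sh a y *g a + b >> : malgS) : y z / y + z}).
Proof.
split=> [b|b y z]; first by rewrite sh0 mulr0 monalgU0.
by rewrite shD mulrDr monalgUD.
Qed.

Lemma innerD a x v w : inner (v + w) a x = inner v a x + inner w a x.
Proof. by have [? ?] := inner_additive a x; apply: malg_sumD. Qed.

Lemma innerU a b x y : inner << y *g b >> a x = << x * sh a y *g a + b >>.
Proof. by have [? ?] := inner_additive a x; rewrite /inner malg_sumU. Qed.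

Lemma inner0 v a : inner v a 0 = 0.
Proof. by rewrite /inner /malg_sum big1 // => b _; rewrite mul0r monalgU0. Qed.

Lemma innerDl v a : {morph inner v a : x y / x + y}.
Proof.
move=> x y; rewrite /inner /malg_sum -big_split; apply: eq_bigr => b _.
by rewrite mulrDl monalgUD.
Qed.

Lemma twmulE u v : twmul u v = malg_sum (inner v) u. Proof. by []. Qed.

Lemma twmulDl u v w : twmul (u + v) w = twmul u w + twmul v w.
Proof. by rewrite !twmulE malg_sumD // => a; [apply: inner0 | apply: innerDl]. Qed.

Lemma twmulDr u v w : twmul u (v + w) = twmul u v + twmul u w.
Proof.
rewrite !twmulE /malg_sum -big_split; apply: eq_bigr => a _; exact: innerD.
Qed.

Lemma twmul0r u : twmul u 0 = 0.
Proof. by rewrite twmulE /malg_sum big1 // => a _; rewrite /inner malg_sum0. Qed.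

Lemma twmul0l v : twmul 0 v = 0.
Proof. by rewrite twmulE malg_sum0. Qed.

Lemma twmulU x a y b : twmul << x *g a >> << y *g b >> = << x * sh a y *g a + b >>.
Proof.
by rewrite twmulE malg_sumU ?innerU // => k; apply: inner0.
Qed.

Lemma twmul1 u : twmul << 1 *g 0 >> u = u.
Proof.
elim/malg_ind: u => [|u v IHu IHv|c k]; first exact: twmul0r.
  by rewrite twmulDr IHu IHv.
by rewrite twmulU sh_0 mul1r add0r.
Qed.

Lemma twmulA u v w : twmul u (twmul v w) = twmul (twmul u v) w.
Proof.
elim/malg_ind: u => [|u u' IHu IHu'|x a]; first by rewrite !twmul0l.
  by rewrite !twmulDl IHu IHu'.
elim/malg_ind: v => [|v v' IHv IHv'|y b]; first by rewrite !(twmul0l, twmul0r).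
  by rewrite !(twmulDl, twmulDr) IHv IHv'.
elim/malg_ind: w => [|w w' IHw IHw'|z c]; first by rewrite !twmul0r.
  by rewrite !twmulDr IHw IHw'.
by rewrite !twmulU shM sh_sh mulrA addrA.
Qed.

Lemma twmul_cancel x y u : y * x = 1 -> twmul << y *g 0 >> (twmul << x *g 0 >> u) = u.
Proof. by move=> yx; rewrite twmulA twmulU sh_0 addr0 yx twmul1. Qed.

Lemma twmul_suml (J : Type) (r : seq J) (P : pred J) (u : J -> malgS) v :
  twmul (\sum_(j <- r | P j) u j) v = \sum_(j <- r | P j) twmul (u j) v.
Proof.
by apply: (big_morph (fun u => twmul u v)) => [u1 u2|]; [apply: twmulDl | apply: twmul0l].
Qed.

Lemma twmul_sumr (J : Type) (r : seq J) (P : pred J) u (v : J -> malgS) :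
  twmul u (\sum_(j <- r | P j) v j) = \sum_(j <- r | P j) twmul u (v j).
Proof.
by apply: (big_morph (twmul u)) => [v1 v2|]; [apply: twmulDr | apply: twmul0r].
Qed.

Section PolynomialOperators.
Variables (K : fieldType) (t : K) (iota : {poly K} -> S).
Hypotheses (iota0 : iota 0 = 0) (iotaD : {morph iota : c d / c + d})
  (iotaM : {morph iota : c d / c * d})
  (iota_sh : forall (l : nat) c, sh l%:Z (iota c) = iota (pshift t l c)).
Implicit Types (c : {poly K}) (Q X B : {poly {poly K}}).

(** The polynomials in [L], with the product [smul], as twisted Laurent polynomials. *)
Definition to_malg Q : malgS := \sum_(l < size Q) << iota Q`_l *g l%:Z >>.

Lemma to_malgE m Q : (size Q <= m)%N -> to_malg Q = \sum_(l < m) << iota Q`_l *g l%:Z >>.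
Proof.
move=> le_m; apply: (sum_ord_widen (F := fun l => << iota Q`_l *g l%:Z >>)) => // l le_l.
by rewrite nth_default // iota0 monalgU0.
Qed.

Lemma to_malg0 : to_malg 0 = 0.
Proof. by rewrite /to_malg size_poly0 big_ord0. Qed.

Lemma to_malgD P Q : to_malg (P + Q) = to_malg P + to_malg Q.
Proof.
pose m := maxn (size P) (size Q).
rewrite (@to_malgE m (P + Q)%R) ?size_polyD // (@to_malgE m P) ?leq_maxl //.
rewrite (@to_malgE m Q) ?leq_maxr // -big_split /=.
by apply: eq_bigr => l _; rewrite coefD iotaD monalgUD.
Qed.

Lemma to_malg_sum (J : Type) (r : seq J) (P : pred J) (Q : J -> {poly {poly K}}) :
  to_malg (\sum_(j <- r | P j) Q j) = \sum_(j <- r | P j) to_malg (Q j).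
Proof. by apply: (big_morph to_malg) => [Q1 Q2|]; [apply: to_malgD | apply: to_malg0]. Qed.

Lemma to_malg_mono c l : to_malg (c *: 'X^l) = << iota c *g l%:Z >>.
Proof.
rewrite (@to_malgE l.+1).
  rewrite big_ord_recr big1 /= => [|i _].
    by rewrite coefZ coefXn eqxx mulr1 add0r.
  by rewrite coefZ coefXn ltn_eqF // mulr0 iota0 monalgU0.
by apply: leq_trans (size_scale_leq _ _) _; rewrite size_polyXn.
Qed.

Lemma to_malgZ c Q : to_malg (c *: Q) = twmul << iota c *g 0 >> (to_malg Q).
Proof.
rewrite (@to_malgE (size Q)) ?size_scale_leq // /to_malg twmul_sumr.
by apply: eq_bigr => l _; rewrite twmulU sh_0 add0r coefZ iotaM.
Qed.

Lemma to_malg_shift l B : to_malg (map_poly (pshift t l) B * 'X^l) =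
  twmul << iota 1 *g l%:Z >> (to_malg B).
Proof.
have sz : (size (map_poly (pshift t l) B * 'X^l)%R <= l + size B)%N.
  apply: leq_trans (size_polyMleq _ _) _; rewrite size_polyXn addnS /= addnC.
  by rewrite leq_add2l size_poly.
rewrite (to_malgE sz) big_split_ord /= big1 ?add0r => [|i _]; last first.
  by rewrite coefMXn ltn_ord iota0 monalgU0.
rewrite /to_malg twmul_sumr; apply: eq_bigr => i _.
rewrite coefMXn ltnNge leq_addr /= addKn coef_map_id0 ?pshift0 //.
by rewrite twmulU iota_sh -iotaM mul1r PoszD.
Qed.

Lemma to_malg_smul X B : to_malg (smul t X B) = twmul (to_malg X) (to_malg B).
Proof.
rewrite /smul to_malg_sum [to_malg X]/to_malg twmul_suml; apply: eq_bigr => l _.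
by rewrite to_malgZ to_malg_shift twmulA twmulU sh_0 add0r -iotaM mulr1.
Qed.

End PolynomialOperators.
End TwistedLaurent.

Section ShiftM.
Variable R : realType.
Local Notation t := (tvar R).
Implicit Types (a b : int) (x y : rattM R) (P Q : {poly ratt R}).

Lemma tvar_neq0 : t != 0.
Proof. by rewrite tofrac_eq0 polyX_eq0. Qed.

(** The polynomial part of [shiftM]; unlike [pshift] it allows negative exponents. *)
Definition dilate a P : {poly ratt R} := P \Po (t ^ (2 * a) *: 'X).

Lemma dilate_eq0 a P : (dilate a P == 0) = (P == 0).
Proof. by rewrite /dilate comp_poly_eq0 // size_scale ?size_polyX // expfz_neq0 // tvar_neq0. Qed.

Lemma dilateD a b P : dilate a (dilate b P) = dilate (a + b) P.
Proof.
rewrite /dilate -comp_polyA comp_polyZ comp_polyX scalerA; congr (_ \Po (_ *: _)).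
by rewrite -expfzDr ?tvar_neq0 //; congr (t ^ _); ring.
Qed.

Lemma dilate0 P : dilate 0 P = P.
Proof. by rewrite /dilate mulr0 expr0z scale1r comp_polyXr. Qed.

Lemma dilate_is_zmod_morphism a : zmod_morphism (dilate a).
Proof. by move=> P Q; rewrite /dilate comp_polyB. Qed.
Lemma dilate_is_monoid_morphism a : monoid_morphism (dilate a).
Proof. by split=> [|P Q]; rewrite /dilate ?comp_polyC // comp_polyM. Qed.
HB.instance Definition _ a := GRing.isZmodMorphism.Build {poly ratt R} {poly ratt R}
  (dilate a) (dilate_is_zmod_morphism a).
HB.instance Definition _ a := GRing.isMonoidMorphism.Build {poly ratt R} {poly ratt R}
  (dilate a) (dilate_is_monoid_morphism a).

(** Being the extension of an injective ring morphism to the fraction field, [shiftM]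
    inherits its algebraic properties. *)
Lemma shiftME a x : shiftM a x = frac_map (dilate a) x.
Proof. by []. Qed.

Lemma shiftM_poly a P : shiftM a P%:F = (dilate a P)%:F.
Proof. by rewrite shiftME frac_map_tofrac //; apply: dilate_eq0. Qed.

Lemma shiftM_is_zmod_morphism a : zmod_morphism (shiftM a : rattM R -> rattM R).
Proof. by move=> x y; rewrite !shiftME frac_mapB //; apply: dilate_eq0. Qed.
HB.instance Definition _ a :=
  GRing.isZmodMorphism.Build (rattM R) (rattM R) (shiftM a) (shiftM_is_zmod_morphism a).

Lemma shiftMM a x y : shiftM a (x * y) = shiftM a x * shiftM a y.
Proof. by rewrite !shiftME frac_mapM //; apply: dilate_eq0. Qed.

Lemma shiftMD a b x : shiftM a (shiftM b x) = shiftM (a + b) x.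
Proof.
rewrite !shiftME; apply: (@frac_map_comp _ (dilate a) (dilate b) (dilate (a + b))).
- exact: dilate_eq0.
- exact: dilate_eq0.
exact: dilateD.
Qed.

Lemma shiftM_0 x : shiftM 0 x = x.
Proof. by rewrite shiftME; apply: (@frac_map_id _ (dilate 0)); apply: dilate0. Qed.

End ShiftM.

(** * The localized quantum torus *)

Section QuantumTorus.
Variable R : realType.
Local Notation K := (ratt R).
Local Notation t := (tvar R).
Implicit Types (f : int -> K) (P : qtorus R) (Q : {poly {poly K}})
  (al be : {poly {poly {poly int}}}) (n : int).

Lemma tvar_transcendental (P : {poly int}) : (map_poly intr P : {poly K}).[t] = 0 -> P = 0.
Proof. exact: fracX_transcendental. Qed.

Definition to_loc Q : loctorus R := to_malg (fun c : {poly K} => c%:F : rattM R) Q.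

Lemma shiftM_pshift (l : nat) (c : {poly K}) : shiftM l%:Z c%:F = (pshift t l c)%:F.
Proof. by rewrite shiftM_poly. Qed.

Lemma Mvar_neq0 : Mvar R != 0.
Proof. by rewrite tofrac_eq0 polyX_eq0. Qed.

Lemma shiftM_additive (a : int) : {morph @shiftM R a : x y / x - y}.
Proof. by move=> x y; rewrite raddfB. Qed.

Let shB := shiftM_additive.
Let shM := @shiftMM R.
Let shsh := @shiftMD R.
Let sh0 := @shiftM_0 R.

Let iota (c : {poly K}) : rattM R := c%:F.
Let iota0 : iota 0 = 0. Proof. exact: tofrac0. Qed.
Let iotaD : {morph iota : c d / c + d}. Proof. exact: tofracD. Qed.
Let iotaM : {morph iota : c d / c * d}. Proof. exact: tofracM. Qed.

Lemma to_locD Q Q' : to_loc (Q + Q') = to_loc Q + to_loc Q'.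
Proof. exact: (to_malgD iota0 iotaD). Qed.

Lemma to_locZ c Q : to_loc (c *: Q) = locmul << c%:F *g 0 >> (to_loc Q).
Proof. exact: (to_malgZ shB sh0 iota0 iotaM). Qed.

Lemma to_loc_smul X B : to_loc (smul t X B) = locmul (to_loc X) (to_loc B).
Proof. exact: (to_malg_smul shB shM shsh sh0 iota0 iotaD iotaM shiftM_pshift). Qed.

Lemma to_loc_mono c l : to_loc (c *: 'X^l) = << c%:F *g l%:Z >>.
Proof. exact: (to_malg_mono iota0). Qed.

Lemma locmulA (u v w : loctorus R) : locmul u (locmul v w) = locmul (locmul u v) w.
Proof. exact: (twmulA shB shM shsh). Qed.

Lemma locmul_cancel (x : rattM R) (u : loctorus R) : x != 0 ->
  locmul << x^-1 *g 0 >> (locmul << x *g 0 >> u) = u.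
Proof. by move=> x0; apply: (twmul_cancel shB shM shsh sh0); apply: mulVf. Qed.

Lemma locmul_suml (J : Type) (r : seq J) (u : J -> loctorus R) v :
  locmul (\sum_(j <- r) u j) v = \sum_(j <- r) locmul (u j) v.
Proof. exact: (twmul_suml (@shiftM R)). Qed.

Lemma locmul0r (u : loctorus R) : locmul u 0 = 0.
Proof. exact: (twmul0r (@shiftM R)). Qed.

Lemma locmulDr (u v w : loctorus R) : locmul u (v + w) = locmul u v + locmul u w.
Proof. exact: (twmulDr shB). Qed.

Lemma locmulU (x y : rattM R) a b :
  locmul << x *g a >> << y *g b >> = << x * shiftM a y *g a + b >>.
Proof. exact: (twmulU shB). Qed.

Lemma locmul1 (u : loctorus R) : locmul << 1 *g 0 >> u = u.
Proof. exact: (twmul1 shB). Qed.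

End QuantumTorus.

(** * The quantum torus *)

Section MalgMonomials.
Variables (S : comNzRingType) (I : choiceType).
Implicit Types (x y z : S) (k : I).

Lemma malgU_mul0 z k : << 0 * z *g k >> = 0 :> {malg S[I]}.
Proof. by rewrite mul0r monalgU0. Qed.

Lemma malgU_mulDl x y z k :
  << (x + y) * z *g k >> = << x * z *g k >> + << y * z *g k >> :> {malg S[I]}.
Proof. by rewrite mulrDl monalgUD. Qed.

End MalgMonomials.

Section RecurrenceIdeal.
Variable R : realType.
Local Notation K := (ratt R).
Local Notation t := (tvar R).
Implicit Types (f : int -> K) (P : qtorus R) (Q : {poly {poly K}})
  (al be : {poly {poly {poly int}}}) (n : int) (k : (int * int * int)%type).

Let trans := @tvar_transcendental R.
Let t_neq0 : t != 0 := tvar_neq0 R.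

Definition cst (c : R[i]) : K := c%:P%:F.

Lemma cst0 : cst 0 = 0. Proof. by rewrite /cst polyC0 tofrac0. Qed.
Lemma cstD c d : cst (c + d) = cst c + cst d. Proof. by rewrite /cst polyCD tofracD. Qed.
Lemma cst_int (i : int) : cst i%:~R = i%:~R. Proof. by rewrite /cst !rmorph_int. Qed.

Definition loc_term k (c : R[i]) : loctorus R :=
  << of_ratt (cst c * t ^ k.1.1) * Mvar R ^ k.1.2 *g k.2 >>.
Definition act_term f n k (c : R[i]) : K :=
  cst c * t ^ (k.1.1 + 2 * k.1.2 * n) * f (n + k.2).

Lemma of_ratt0 : of_ratt (0 : K) = 0. Proof. by rewrite /of_ratt polyC0 tofrac0. Qed.
Lemma of_rattD (c d : K) : of_ratt (c + d) = of_ratt c + of_ratt d.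
Proof. by rewrite /of_ratt polyCD tofracD. Qed.
Lemma loc_term0 k : loc_term k 0 = 0.
Proof. rewrite /loc_term; have -> : cst 0 * t ^ k.1.1 = 0 by rewrite cst0 mul0r.
by rewrite of_ratt0; apply: malgU_mul0. Qed.
Lemma loc_termD k : {morph loc_term k : c d / c + d}.
Proof. by move=> c d; rewrite /loc_term cstD mulrDl of_rattD; apply: malgU_mulDl. Qed.
Lemma act_term0 f n k : act_term f n k 0 = 0.
Proof. by rewrite /act_term cst0 !mul0r. Qed.
Lemma act_termD f n k : {morph act_term f n k : c d / c + d}.
Proof. by move=> c d; rewrite /act_term cstD !mulrDl. Qed.

Lemma torus_to_locE P : torus_to_loc P = malg_sum loc_term P. Proof. by []. Qed.
Lemma qactE P f n : qact P f n = malg_sum (act_term f n) P. Proof. by []. Qed.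

Lemma torus_to_locD P P' : torus_to_loc (P + P') = torus_to_loc P + torus_to_loc P'.
Proof. exact: (malg_sumD loc_term0 loc_termD). Qed.
Lemma torus_to_locU c k : torus_to_loc << c *g k >> = loc_term k c.
Proof. exact: (malg_sumU loc_term0). Qed.
Lemma torus_to_loc0 : torus_to_loc (0 : qtorus R) = 0.
Proof. by rewrite torus_to_locE malg_sum0. Qed.
Lemma qactD P P' f n : qact (P + P') f n = qact P f n + qact P' f n.
Proof. exact: (malg_sumD (act_term0 f n) (act_termD f n)). Qed.
Lemma qactU c k f n : qact << c *g k >> f n = act_term f n k c.
Proof. exact: (malg_sumU (act_term0 f n)). Qed.
Lemma qact0 f n : qact (0 : qtorus R) f n = 0.
Proof. by rewrite qactE malg_sum0. Qed.

Lemma malg_sum_poly (V : zmodType) (F : int * int * int -> R[i] -> V) al :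
  (forall k, F k 0 = 0) -> (forall k, {morph F k : c d / c + d}) ->
  malg_sum F (poly_to_torus R al) = \sum_(l < size al) \sum_(m < size al`_l)
    \sum_(i < size al`_l`_m) F (i%:Z, m%:Z, l%:Z) (al`_l`_m`_i)%:~R.
Proof.
move=> F0 FD; rewrite /poly_to_torus malg_sum_sum //; apply: eq_bigr => l _.
rewrite malg_sum_sum //; apply: eq_bigr => m _.
by rewrite malg_sum_sum //; apply: eq_bigr => i _; rewrite malg_sumU.
Qed.

Lemma tev_sum (p : {poly int}) : tev t p = \sum_(i < size p) (p`_i)%:~R * t ^ i%:Z.
Proof.
rewrite /tev /map_poly poly_def horner_sum; apply: eq_bigr => i _.
by rewrite hornerZ hornerXn exprnP.
Qed.

Lemma embed_coef_sum (c : {poly {poly int}}) :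
  embed_coef t c = \sum_(m < size c) tev t c`_m *: 'X^m.
Proof. by rewrite /embed_coef /map_poly poly_def. Qed.

(** The two descriptions of an integral operator, by its support in the quantum torus
    and as a nested polynomial, agree in their action and in their image below. *)
Lemma qact_poly al f n : qact (poly_to_torus R al) f n = act t (embed t al) f n.
Proof.
rewrite qactE malg_sum_poly; [|exact: act_term0|exact: act_termD].
rewrite /act (size_embed trans); apply: eq_bigr => l _.
rewrite coef_map /= -/(embed_coef t _) embed_coef_sum /pev horner_sum mulr_suml.
apply: eq_bigr => m _; rewrite hornerZ hornerXn tev_sum !mulr_suml.
apply: eq_bigr => i _; rewrite /act_term /= cst_int; congr (_ * _).
rewrite -[RHS]mulrA; congr (_ * _); rewrite [_ ^+ m]exprnP exprz_exp (tD t_neq0).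
by congr (t ^ _); ring.
Qed.

Lemma to_loc_poly al : torus_to_loc (poly_to_torus R al) = to_loc (embed t al).
Proof.
rewrite torus_to_locE malg_sum_poly; [|exact: loc_term0|exact: loc_termD].
rewrite /to_loc /to_malg (size_embed trans); apply: eq_bigr => l _.
rewrite coef_map /= -/(embed_coef t _) embed_coef_sum raddf_sum /= raddf_sum.
apply: eq_bigr => m _; rewrite /loc_term /=.
rewrite -mul_polyC tofracM tofracXn -/(of_ratt _) tev_sum.
rewrite (big_morph _ of_rattD of_ratt0) mulr_suml raddf_sum.
by apply: eq_bigr => i _; rewrite cst_int exprnP.
Qed.

(** A monomial on the left removes the negative powers of [M] and [L], and brings [P]
    into the domain where division with remainder is available. *)
Lemma clear_negative_powers P : exists (N : nat) Q,
  torus_to_loc P = locmul << Mvar R ^ (- N%:Z) *g - N%:Z >> (to_loc Q) /\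
  forall f n, act t Q f n = t ^ (2 * N%:Z * (n + N%:Z)) * qact P f (n + N%:Z).
Proof.
suff [N0 clear] : exists N0 : nat, forall N : nat, (N0 <= N)%N -> exists Q,
    torus_to_loc P = locmul << Mvar R ^ (- N%:Z) *g - N%:Z >> (to_loc Q) /\
    forall f n, act t Q f n = t ^ (2 * N%:Z * (n + N%:Z)) * qact P f (n + N%:Z).
  by exists N0; apply: clear.
elim/malg_ind: P => [|P P' [N0 IH] [N0' IH']|c [[i b] a]].
- exists 0%N => N _; exists 0; split.
    by rewrite torus_to_loc0 /to_loc to_malg0 locmul0r.
  by move=> f n; rewrite act0 qact0 mulr0.
- exists (N0 + N0')%N => N le_N.
  have [Q [QL QA]] := IH N (leq_trans (leq_addr _ _) le_N).
  have [Q' [QL' QA']] := IH' N (leq_trans (leq_addl _ _) le_N).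
  exists (Q + Q'); split; first by rewrite torus_to_locD to_locD locmulDr QL QL'.
  by move=> f n; rewrite actD qactD QA QA' [RHS]mulrDr.
exists (`|a| + `|b|)%N => N le_N.
have aE : (addz N a)%:Z = N%:Z + a by apply: addzE; lia.
have bE : (addz N b)%:Z = N%:Z + b by apply: addzE; lia.
pose x := cst c * t ^ (i + 2 * N%:Z * (b + N%:Z)).
have xE : x * (t ^ (2 * - N%:Z)) ^+ addz N b = cst c * t ^ i.
  rewrite /x [_ ^+ _]exprnP exprz_exp -[LHS]mulrA (tD t_neq0) bE.
  by congr (_ * t ^ _); ring.
have ME : Mvar R ^ (- N%:Z) * Mvar R ^+ addz N b = Mvar R ^ b.
  rewrite [_ ^+ _]exprnP -expfzDr ?Mvar_neq0 // bE.
  by congr (_ ^ _); ring.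
exists (x *: 'X^(addz N b) *: 'X^(addz N a)); split.
  rewrite torus_to_locU to_loc_mono locmulU /loc_term /=; congr << _ *g _ >>.
    by rewrite aE; ring.
  rewrite shiftM_poly /dilate comp_polyZ comp_Xn_poly exprZn scalerA xE -mul_polyC.
  by rewrite tofracM tofracXn -/(of_ratt _) -/(Mvar R) mulrCA ME.
move=> f n; rewrite act_monomial qactU /act_term /= /pev hornerZ hornerXn aE.
rewrite (_ : n + (N%:Z + a) = n + N%:Z + a) ?addrA // [RHS]mulrA; congr (_ * _).
rewrite [RHS]mulrCA -[LHS]mulrA; congr (_ * _).
rewrite [_ ^+ _]exprnP exprz_exp !(tD t_neq0) bE.
by congr (t ^ _); ring.
Qed.

End RecurrenceIdeal.

(** * Recurrence polynomials *)

(** Of the product of the localized torus only the associativity matters here. *)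
Lemma left_multiple_trans (T : Type) (mul : T -> T -> T) (u v w x y z al : T) :
  (forall a b c, mul a (mul b c) = mul (mul a b) c) ->
  u = mul z v -> mul y (mul w v) = v -> mul w v = mul x al -> exists x', u = mul x' al.
Proof.
by move=> mulA uE vE wE; exists (mul z (mul y x)); rewrite uE -vE wE !mulA.
Qed.

Section RecurrencePolynomials.
Variable R : realType.
Local Notation K := (ratt R).
Local Notation t := (tvar R).
Implicit Types (al be : {poly {poly {poly int}}}) (P : qtorus R).
Variable f : int -> K.

Let trans := @tvar_transcendental R.
Let t_neq0 : t != 0 := tvar_neq0 R.

Definition kills al := forall n, act t (embed t al) f n = 0.

Lemma recurrence_ideal_poly al : recurrence_ideal f (poly_to_torus R al) <-> kills al.
Proof. by split=> E n; [rewrite -qact_poly | rewrite qact_poly]; apply: E. Qed.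

Lemma kills_small al d : order_ge t d f -> kills al -> (size al <= d)%N -> al = 0.
Proof.
move=> ord al0 sz; apply/eqP; rewrite -(embed_eq0 trans); apply/eqP.
by apply: ord; [rewrite (size_embed trans) | exists 0 => n _; apply: al0].
Qed.

(** Division by [al] on the right leaves a remainder that annihilates [f] and has order
    less than [d], hence vanishes. *)
Lemma recurrence_ideal_multiple al d P :
    size al = d.+1 -> kills al -> order_ge t d f -> recurrence_ideal f P ->
  exists x, torus_to_loc P = locmul x (torus_to_loc (poly_to_torus R al)).
Proof.
move=> szal al0 ord P0; have [N [Q [PQ QP]]] := clear_negative_powers P.
have szB : size (embed t al) = d.+1 by rewrite (size_embed trans).
have [e [X [S [e0 E szS _]]]] := skew_division t_neq0 szB Q.
have S0 : S = 0.
  apply: ord => //; exists 0 => n _.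
  have := actZ t e Q f n; rewrite E actD (act_smul t_neq0) QP P0 mulr0 mulr0.
  by rewrite (act_eq0 _ _ _ al0) add0r.
have EL : locmul << e%:F *g 0 >> (to_loc Q) = locmul (to_loc X) (to_loc (embed t al)).
  transitivity (to_loc (e *: Q)); first by apply: esym; apply: to_locZ.
  by rewrite E S0 addr0; apply: to_loc_smul.
have eF0 : e%:F != 0 :> rattM R by rewrite tofrac_eq0.
have QL := locmul_cancel (to_loc Q) eF0.
rewrite -to_loc_poly in EL; exact: (left_multiple_trans (@locmulA R) PQ QL EL).
Qed.

Lemma ideal_generator_of_order al d :
  size al = d.+1 -> kills al -> order_ge t d f -> ideal_generator f al.
Proof.
move=> szal al0 ord; split; first exact/recurrence_ideal_poly.
move=> u; split=> [[k [x [P [PA ->]]]]|[x ->]]; last first.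
  exists 1%N, (fun=> x), (fun=> poly_to_torus R al); split.
    by move=> _; apply/recurrence_ideal_poly.
  by rewrite big_ord1.
have /choice[y yE] (i : 'I_k) := recurrence_ideal_multiple szal al0 ord (PA i).
exists (\sum_(i < k) locmul (x i) (y i)); rewrite locmul_suml.
by apply: eq_bigr => i _; rewrite yE locmulA.
Qed.

Lemma ideal_generator_neq0 al be : kills al -> al != 0 -> ideal_generator f be -> be != 0.
Proof.
move=> al0 alN0 [_ gen]; apply/eqP => be0.
have /gen[x] : loc_recurrence_ideal f (torus_to_loc (poly_to_torus R al)).
  exists 1%N, (fun=> << 1 *g 0 >>), (fun=> poly_to_torus R al); split.
    by move=> _; apply/recurrence_ideal_poly.
  by rewrite big_ord1 locmul1.
rewrite be0 [in RHS]to_loc_poly /embed rmorph0 /to_loc to_malg0 locmul0r to_loc_poly.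
move=> loc0; have /eqP[] := alN0; apply/eqP; rewrite -(embed_eq0 trans).
apply/eqP/polyP => l; rewrite coef0; have [lt_l|le_l] := ltnP l (size (embed t al)); last first.
  by rewrite nth_default.
have /(congr1 (mcoeff l%:Z)) := loc0; rewrite /to_loc /to_malg raddf_sum /= mcoeff0.
rewrite (bigD1 (Ordinal lt_l)) //= mcoeffUU big1 => [|i ne_i]; last first.
  rewrite mcoeffU; case: eqP => // -[il]; case/eqP: ne_i; exact: val_inj.
by rewrite addr0 => /eqP; rewrite tofrac_eq0 => /eqP.
Qed.

Variables (al : {poly {poly {poly int}}}) (d : nat) (B : {poly int}) (A : {poly {poly int}}).
Hypotheses (size_al : size al = d.+1) (al_kills : kills al) (order_f : order_ge t d f).
Hypothesis tame_f : forall Q, ev0 (act t Q f) -> forall n, act t Q f n = 0.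
Hypotheses (B_neq0 : B != 0) (A_neq0 : A != 0) (A_content : content_free A).
Hypothesis al_at_m1 : eval_t_m1 al = B%:P * A.

Let al_neq0 : al != 0. Proof. by rewrite -size_poly_eq0 size_al. Qed.

(** The primitive part of [al] annihilates [f] as well: it does so for large [n], where
    the content does not vanish, and then everywhere. *)
Lemma recurrence_polynomial_exists : exists be, is_recurrence_polynomial f be.
Proof.
have [c [be [c0 alE cop]]] := primitive_part al_neq0; exists be.
have sz : size be = d.+1 by rewrite -size_al alE size_scale.
have be_kills : kills be.
  apply: tame_f; have [n0 cn] : exists n0 : int, forall n, n0 <= n -> zev t c n != 0.
    have [v vP] := zero_valuation R[i].
    have [cE|[x [y [n0 [_ cv]]]]] := val_pev vP (or_introl erefl) t_neq0 (embed_coef t c).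
      by move: c0; rewrite -(embed_coef_eq0 trans) cE eqxx.
    by exists n0 => n /cv /andP[].
  exists n0 => n le_n; have := al_kills n.
  rewrite alE /embed -mul_polyC rmorphM /= map_polyC /= mul_polyC actZ => /eqP.
  by rewrite mulf_eq0 (negbTE (cn n le_n)) => /eqP.
split=> //; first exact: (ideal_generator_of_order sz be_kills order_f).
move=> ga ga_gen; rewrite sz ltnNge; apply/negP => sz_ga.
have /eqP[] := ideal_generator_neq0 al_kills al_neq0 ga_gen.
apply: kills_small order_f _ sz_ga.
by case: ga_gen => /recurrence_ideal_poly.
Qed.

(** A recurrence polynomial has the same order as [al], so the two are proportional over
    [Z[t,M]], by subtracting suitable multiples and comparing orders.  At [t = -1] this
    gives [c' be = e' B A] with [c'] and [e'] in [Z[M]], and [c'] divides [e' B]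
    because [A] has no content. *)
Lemma recurrence_polynomial_at_m1 be : is_recurrence_polynomial f be ->
  exists2 B' : {poly int}, B' != 0 & eval_t_m1 be = B'%:P * A.
Proof.
move=> [be_gen be_min be_cop]; have be0 := ideal_generator_neq0 al_kills al_neq0 be_gen.
have be_kills : kills be by case: be_gen => /recurrence_ideal_poly.
have sz_be : size be = d.+1.
  apply/eqP; rewrite eqn_leq; apply/andP; split.
    by rewrite -size_al; apply: be_min; apply: ideal_generator_of_order order_f.
  by rewrite ltnNge; apply/negP => /(kills_small order_f be_kills)/eqP; rewrite (negbTE be0).
have E : lead_coef al *: be = lead_coef be *: al.
  apply/eqP; rewrite -subr_eq0; apply/eqP; apply: (kills_small order_f).
    move=> n; rewrite /embed rmorphB -!mul_polyC !rmorphM /= !map_polyC /= !mul_polyC.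
    rewrite -scaleNr actD !actZ (be_kills n) (al_kills n) !mulr0 addr0 //.
  apply/leq_sizeP => i le_i; rewrite coefB !coefZ.
  have [->|ne_i] := eqVneq i d.
    by rewrite /lead_coef size_al sz_be /= mulrC subrr.
  have lt_i : (d < i)%N by rewrite ltn_neqAle eq_sym ne_i.
  by rewrite !nth_default ?size_al ?sz_be // !mulr0 subrr.
have no_t1 : ~ (exists al', be = t_plus_1 *: al').
  move=> [al' beE]; have [l||] := be_cop t_plus_1.
  - by exists al'`_l; rewrite beE coefZ.
  - by move/(congr1 at_m1); rewrite at_m1_t_plus_1 /at_m1 rmorph1 => /eqP; rewrite eq_sym oner_eq0.
  - move/(congr1 at_m1); rewrite at_m1_t_plus_1 /at_m1 rmorphN1 => /eqP.
    by rewrite eq_sym oppr_eq0 oner_eq0.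
have lc0 : lead_coef al != 0 by rewrite lead_coef_eq0.
have alm0 : eval_t_m1 al != 0 by rewrite al_at_m1 mulf_neq0 ?polyC_eq0.
have [c' [e' [c'0 e'0 Em]]] := proportional_at_m1 lc0 E no_t1 alm0.
have [|B' e'E beE] := @content_free_cancel c' (e' * B) (eval_t_m1 be) A c'0 A_content.
  by rewrite Em al_at_m1 polyCM -mul_polyC mulrA.
exists B' => //; apply/eqP => B'0; move/eqP: e'E; rewrite B'0 mulr0 mulf_eq0.
by rewrite (negbTE e'0) (negbTE B_neq0).
Qed.

End RecurrencePolynomials.

(** * Values at t = 1 *)

Section ValueAtOne.
Variables (K : fieldType) (t : K).
Hypothesis transcendental : forall P : {poly int}, (map_poly intr P).[t] = 0 -> P = 0.
Let t_neq0 := transcendental_neq0 transcendental.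
Implicit Types (x y : K) (i j n : int).

(** The value at [t = 1] of an element of [Z[t^(+-1)]] inside [K].  At [t = 1] every
    colored Jones polynomial specializes to its color [n], which is enough to see that
    certain elements do not vanish. *)
Definition at_one x i := exists (P : {poly int}) (m : nat), x * t ^+ m = tev t P /\ P.[1] = i.

Lemma at_one_neq0 x i : at_one x i -> i != 0 -> x != 0.
Proof.
move=> [P [m [E P1]]]; apply: contraNneq => x0; rewrite -P1.
have -> : P = 0 by apply/eqP; rewrite -(tev_eq0 transcendental) -E x0 mul0r.
by rewrite horner0.
Qed.

Lemma at_one_tX i : at_one (t ^ i) 1.
Proof.
exists 'X^(addz `|i| i), `|i|%N; split; last by rewrite hornerXn expr1n.
rewrite rmorphXn /= tevX !exprnP (tD t_neq0) addzE; last by lia.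
by rewrite addrC.
Qed.

Lemma at_oneD x y i j : at_one x i -> at_one y j -> at_one (x + y) (i + j).
Proof.
move=> [P [m [E P1]]] [Q [m' [E' Q1]]].
exists (P * 'X^m' + Q * 'X^m), (m + m')%N; split.
  by rewrite rmorphD !rmorphM !rmorphXn /= !tevX -E -E' exprD; ring.
by rewrite hornerD !hornerM !hornerXn !expr1n !mulr1 P1 Q1.
Qed.

Lemma at_oneM x y i j : at_one x i -> at_one y j -> at_one (x * y) (i * j).
Proof.
move=> [P [m [E P1]]] [Q [m' [E' Q1]]].
exists (P * Q), (m + m')%N; split.
  by rewrite rmorphM /= -E -E' exprD; ring.
by rewrite hornerM P1 Q1.
Qed.

Lemma at_one_int i : at_one i%:~R i.
Proof.
exists i%:~R, 0%N; rewrite expr0 mulr1 rmorph_int; split=> //.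
by rewrite -(rmorph_int polyC) hornerC intz.
Qed.

Lemma at_oneN x i : at_one x i -> at_one (- x) (- i).
Proof.
by move=> /(at_oneM (at_one_int (-1))); rewrite mulrN1z !mulN1r.
Qed.

Lemma at_one_sum (m : nat) (F : nat -> K) (G : nat -> int) :
  (forall k, at_one (F k) (G k)) -> at_one (\sum_(k < m) F k) (\sum_(k < m) G k).
Proof.
move=> FG; elim: m => [|m IH]; first by rewrite !big_ord0; apply: (at_one_int 0).
by rewrite !big_ord_recr; apply: at_oneD.
Qed.

(** The derivative at [t = 1] of [t^i - t^j], which vanishes there itself. *)
Lemma at_one_difference i j : exists y, at_one y (i - j) /\ t ^ i - t ^ j = (t - 1) * y.
Proof.
have pos (k : nat) l : exists y, at_one y k%:Z /\ t ^ (l + k%:Z) - t ^ l = (t - 1) * y.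
  exists (t ^ l * \sum_(m < k) t ^+ m); split.
    rewrite -[k%:Z]mul1r; apply: at_oneM; first exact: at_one_tX.
    have -> : k%:Z = \sum_(m < k) 1 by rewrite sumr_const card_ord natz.
    by apply: (@at_one_sum k (fun m => t ^+ m) (fun=> 1)) => m; apply: (at_one_tX m%:Z).
  by rewrite mulrCA -subrX1 mulrBr mulr1 exprnP (tD t_neq0).
have [ij|ij] := lerP j i.
  have [y [y1 yE]] := pos `|i - j|%N j; exists y.
  by move: y1 yE; rewrite (_ : `|i - j|%N%:Z = i - j) ?subrKC //; lia.
have [y [y1 yE]] := pos `|j - i|%N i; exists (- y).
move: y1 yE; rewrite (_ : `|j - i|%N%:Z = j - i); last by lia.
rewrite subrKC => y1 yE; split; first by rewrite -opprB; apply: at_oneN.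
by rewrite mulrN -yE opprB.
Qed.

Lemma two_neq0 : (2%:R : K) != 0.
Proof. by have := at_one_neq0 (at_one_int 2) isT. Qed.

Lemma quantum_neq0 : t ^ 2 - t ^ (- 2) != 0.
Proof.
have [y [y1 ->]] := at_one_difference 2 (- 2).
rewrite mulf_neq0 // ?(at_one_neq0 y1) // subr_eq0; apply/eqP => t1.
by have /(transcendental_inf transcendental) : t ^ 1 = 1 by rewrite expr1z.
Qed.

Lemma quantum_at_one (n : nat) :
  at_one ((t ^ (2 * n%:Z) - t ^ (- (2 * n%:Z))) / (t ^ 2 - t ^ (- 2))) n%:Z.
Proof.
elim: n => [|n IH]; first by rewrite mulr0 oppr0 subrr mul0r; apply: (at_one_int 0).
have -> : (t ^ (2 * n.+1%:Z) - t ^ (- (2 * n.+1%:Z))) / (t ^ 2 - t ^ (- 2)) =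
    t ^ 2 * ((t ^ (2 * n%:Z) - t ^ (- (2 * n%:Z))) / (t ^ 2 - t ^ (- 2))) + t ^ (- (2 * n%:Z)).
  have D0 := quantum_neq0; apply: (mulIf D0); rewrite divfK // [RHS]mulrDl [t ^ 2 * _]mulrA divfK //.
  rewrite [t ^ 2 * _]mulrBr [t ^ (- (2 * n%:Z)) * _]mulrBr !(tD t_neq0).
  have -> : 2 + 2 * n%:Z = 2 * n.+1%:Z by lia.
  have -> : - (2 * n%:Z) + -2 = - (2 * n.+1%:Z) by lia.
  have -> : 2 + - (2 * n%:Z) = - (2 * n%:Z) + 2 by lia.
  by ring.
have -> : n.+1%:Z = 1 * n%:Z + 1 by lia.
by apply: at_oneD (at_oneM (at_one_tX 2) IH) (at_one_tX _).
Qed.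

Lemma odd_at_one (J : int -> K) : seq_odd J ->
  (forall n : nat, (1 <= n)%N -> at_one (J n%:Z) n%:Z) -> forall n, at_one (J n) n.
Proof.
move=> Jodd J1 n; have [n0|n0|<-] := ltrgtP 0 n.
- by rewrite (_ : n = `|n|%N%:Z); [apply: J1; lia | lia].
- rewrite -[n]opprK Jodd; apply: at_oneN.
  by rewrite (_ : - n = `|n|%N%:Z); [apply: J1; lia | lia].
by rewrite (odd_at0 two_neq0 Jodd); apply: (at_one_int 0).
Qed.

(** The linear parts of the colors [j s + 1] in the cabling sum cancel by symmetry, and
    [n] terms are left. *)
Lemma cable_at_one r s (Jc J : int -> K) : seq_odd J -> cabling t r s Jc J ->
  (forall n, at_one (Jc n) n) -> forall n, at_one (J n) n.
Proof.
move=> Jodd J_cable Jc1; apply: odd_at_one => // n n1; rewrite J_cable //.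
rewrite -[n%:Z in X in at_one _ X]mul1r; apply: at_oneM; first exact: at_one_tX.
have sumE : n%:Z = \sum_(i < n) (1 * ((2 * i%:Z - (n%:Z - 1)) * s + 1)).
  have sum_i : \sum_(i < n) (2 * i%:Z - (n%:Z - 1)) = 0 :> int.
    elim: n {n1} => [|n IH]; first by rewrite big_ord0.
    have : \sum_(i < n) (2 * i%:Z - (n.+1%:Z - 1)) = - n%:Z :> int.
      have -> : \sum_(i < n) (2 * i%:Z - (n.+1%:Z - 1)) =
                \sum_(i < n) ((2 * i%:Z - (n%:Z - 1)) + -1) :> int.
        by apply: eq_bigr => i _; lia.
      by rewrite big_split /= IH sumr_const card_ord add0r mulNrn natz.
    by rewrite big_ord_recr /= => ->; lia.
  under eq_bigr do rewrite mul1r.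
  by rewrite big_split /= -mulr_suml sum_i mul0r add0r sumr_const card_ord natz.
rewrite [X in at_one _ X]sumE; apply: (@at_one_sum n (fun i : nat => cable_term t r s Jc (2 * i%:Z - (n%:Z - 1)))
  (fun i : nat => 1 * ((2 * i%:Z - (n%:Z - 1)) * s + 1))) => i.
exact: at_oneM (at_one_tX _) (Jc1 _).
Qed.

End ValueAtOne.

(** * Recurrences of the iterated cable *)

Section ClassicalFactors.
Implicit Types (p q r s a k : int).

Lemma Ffactor2 p : p != 0 -> Ffactor p 2 = binomialF (- (2 * p)) 1 (-1).
Proof.
move=> p0; rewrite /Ffactor eqxx /binomialF /Mpow /Lvar !mulrN1z.
have [p_gt0|p_le0] := ltrP 0 p.
  have -> : (- (2 * p) < 0) = true by lia.
  by rewrite mul_polyC expr1 polyCN opprK abszN.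
have -> : (- (2 * p) < 0) = false by lia.
by rewrite expr1 mulN1r polyCN opprK.
Qed.

Lemma Ffactor_gt2 p q : p != 0 -> 2 < q -> Ffactor p q = binomialF (- (2 * p * q)) 2 1.
Proof.
move=> p0 q2; rewrite /Ffactor (gt_eqF q2) /binomialF /Mpow /Lvar.
have [p_gt0|p_le0] := ltrP 0 p.
  have -> : (- (2 * p * q) < 0) = true by nia.
  by rewrite mul_polyC abszN.
have -> : (- (2 * p * q) < 0) = false by nia.
by rewrite mul1r.
Qed.

Lemma Gfactor_binomial p q : p != 0 -> 0 < q -> Gfactor p q = binomialF (- (p * q)) 1 1.
Proof.
move=> p0 q0; rewrite /Gfactor /binomialF /Mpow /Lvar.
have [p_gt0|p_le0] := ltrP 0 p.
  have -> : (- (p * q) < 0) = true by nia.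
  by rewrite mul_polyC expr1 abszN.
have -> : (- (p * q) < 0) = false by nia.
by rewrite expr1 mul1r.
Qed.

Lemma substM_binomial k a d sg : 0 < k ->
  substM k (binomialF a d sg) = binomialF (k * a) d sg.
Proof.
move=> k0; have subE : substM k =1 map_poly (comp_poly 'X^(`|k|%N)) by [].
rewrite subE /binomialF pmulr_rlt0 //; case: ifP => _.
  rewrite rmorphB /= map_polyZ /= map_polyXn map_polyC /= rmorph_int.
  by rewrite comp_Xn_poly -exprM abszM mulnC.
by rewrite rmorphB /= map_polyXn map_polyC /= rmorphM /= rmorph_int comp_Xn_poly -exprM abszM mulnC.
Qed.

End ClassicalFactors.

Section IteratedCableRecurrences.
Variables (K : fieldType) (t : K).
Hypothesis transcendental : forall P : {poly int}, (map_poly intr P).[t] = 0 -> P = 0.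
Let t_neq0 := transcendental_neq0 transcendental.
Let two := two_neq0 transcendental.
Variables (U T : int -> K) (p q s : int).
Hypotheses (U_odd : seq_odd U) (T_odd : seq_odd T).
Hypothesis U_val : forall n, 1 <= n ->
  U n = (t ^ (2 * n) - t ^ (- (2 * n))) / (t ^ 2 - t ^ (- 2)).
Hypothesis T_cable : cabling t p q U T.
Hypotheses (q2 : 2 <= q) (s2 : 2 <= s).
Hypothesis p_neq0 : p != 0.

Local Notation h := (torus_slice T s).
Local Notation int_lau := (int_laurent t).
Local Notation LM := (int_laurentM transcendental).
Local Notation LD := (int_laurentD transcendental).
Local Notation LN := (int_laurentN transcendental).
Local Notation LP := (int_laurent_power transcendental).

Lemma unknot_all n : U n = (t ^ (2 * n) - t ^ (- (2 * n))) / (t ^ 2 - t ^ (- 2)).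
Proof.
have [n0|n0|<-] := ltrgtP 0 n.
- by apply: U_val; lia.
- rewrite -[n]opprK U_odd U_val; last by lia.
  by rewrite -mulNr opprB; congr ((t ^ _ - t ^ _) / _); ring.
by rewrite (odd_at0 two U_odd) mulr0 oppr0 subrr mul0r.
Qed.

Lemma unknot_int (a b : int) : int_lau (fun n => U (a * n + b)).
Proof.
have L : int_lau (fun n => (t ^ (2 * a * n + 2 * b) + - t ^ (2 * (- a) * n + 2 * (- b)))
    * (t ^ 2 - t ^ (- 2))^-1).
  apply: (LM (LD (LP a b) (LN (LP (- a) (- b))))).
  exact: int_laurent_quantum.
apply: eq_int_laurent L => n; rewrite unknot_all.
by congr ((t ^ _ - t ^ _) / _); ring.
Qed.

Lemma unknot_at_one n : at_one t (U n) n.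
Proof.
apply: odd_at_one => // k k1; rewrite U_val; last by lia.
exact: quantum_at_one.
Qed.

Lemma torus_at_one n : at_one t (T n) n.
Proof. exact: (cable_at_one transcendental T_odd T_cable unknot_at_one). Qed.

(** The inhomogeneous term of [cable_rec2] for the torus knot. *)
Definition torus_rest N : K :=
  t ^ (2 * p * N) * U (N * q + 1) - t ^ (- (2 * p * N)) * U (N * q - 1).

Lemma torus_step2 N :
  T (N + 1) = t ^ (- (4 * p * q * N)) * T (N - 1) + t ^ (- (2 * p * q * N)) * torus_rest N.
Proof.
have := cable_rec2 t_neq0 U_odd T_odd T_cable two N; rewrite -/(torus_rest N) => <-.
rewrite mulrBr !mulrA !(tD t_neq0) addNr expr0z mul1r.
have -> : - (2 * p * q * N) + - (2 * p * q * N) = - (4 * p * q * N) by ring.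
by rewrite addrCA subrr addr0.
Qed.

Lemma torus_step1 N : q = 2 ->
  T (N + 1) = - t ^ (- (4 * p * N) - 2 * p) * T N + t ^ (- (2 * p * N)) * U (2 * N + 1).
Proof.
move=> q_eq; have := cable_rec1 t_neq0 U_odd T_odd T_cable two N q_eq => <-.
rewrite mulrDr !mulrA !(tD t_neq0) addNr expr0z mul1r.
have -> : - (2 * p * N) + (- (2 * p * N) - 2 * p) = - (4 * p * N) - 2 * p by ring.
by rewrite [RHS]addrCA -mulrDl addNr mul0r addr0.
Qed.

Lemma torus_rest_int (a b : int) : int_lau (fun n => torus_rest (a * n + b)).
Proof.
have L : int_lau (fun n => t ^ (2 * (p * a) * n + 2 * (p * b)) * U ((a * q) * n + (b * q + 1))
    + - (t ^ (2 * (- p * a) * n + 2 * (- p * b)) * U ((a * q) * n + (b * q - 1)))).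
  by apply: LD; [|apply: LN]; apply: LM (LP _ _) (unknot_int _ _).
apply: eq_int_laurent L => n; rewrite /torus_rest.
by congr (t ^ _ * U _ - t ^ _ * U _); ring.
Qed.

(** A step of [h] is a step of length [s] of [T], hence an iterate of the recurrences of
    [T]; the steps of length [del] are composed [k] times, and only the leading
    coefficient [al k s] of the exponent has to be kept track of. *)
Lemma iterate_step (al be sg del : int) (x : int -> K) :
    (forall N, T (N + del) = sg%:~R * t ^ (2 * al * N + 2 * be) * T N + x N) ->
    (forall b, int_lau (fun n => x (s * n + b))) ->
  forall k : nat, exists b z, int_lau z /\ forall n,
    T ((n + 1) * s - 1 + del * k%:Z) = unit_mono t (sg ^+ k) (al * k%:Z * s) b n * h n + z n.
Proof.
move=> step x_int; elim=> [|k [b [z [z_int IH]]]].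
  exists 0, (fun=> 0%:~R); split; first exact: int_laurent_int.
  by move=> n; rewrite /unit_mono expr0 !(mulr0, mul0r, addr0) expr0z !mul1r.
pose c := s - 1 + del * k%:Z; pose u n := sg%:~R * t ^ (2 * (al * s) * n + 2 * (al * c + be)).
have u_int : int_lau u by apply: LM (int_laurent_int _ _) (LP _ _).
exists (b + al * c + be), (fun n => u n * z n + x (s * n + c)); split.
  by apply: LD (LM u_int z_int) (x_int _).
move=> n; have -> : (n + 1) * s - 1 + del * k.+1%:Z = ((n + 1) * s - 1 + del * k%:Z) + del by lia.
rewrite step IH (_ : (n + 1) * s - 1 + del * k%:Z = s * n + c); last by rewrite /c; ring.
rewrite mulrDr -addrA; congr (_ + (_ + _)); last first.
  by rewrite /u; congr (_ * t ^ _ * _); ring.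
rewrite mulrA; congr (_ * _); rewrite /unit_mono mulrACA (tD t_neq0) -intrM -exprS.
congr (_ * t ^ _); rewrite (_ : k.+1%:Z = k%:Z + 1) //; last by lia.
by ring.
Qed.

(** For even [s] a step of [h] consists of [s/2] steps of length [2] of [T], which gives
    order [1].  For odd [s] one needs [s] such steps for [L^2 h], except that for
    [q = 2] there are steps of length [1] with sign [-1].  These are the three cases in
    which the factor coming from [T] is [G], [F] of degree [2] and [F] of degree [1]. *)
Lemma slice_relation : exists (d : nat) (a b sg : int) (z : int -> K),
  [/\ sg = 1 \/ sg = -1, forall n, h (n + d%:Z) = unit_mono t sg a b n * h n + z n,
      int_lau z, d = 1%N \/ [/\ d = 2%N, 2 < q & ~~ (2 %| s)%Z] &
      substM (s ^+ 2) (if (2 %| s)%Z then Gfactor p q else Ffactor p q) = binomialF a d sg].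
Proof.
have s2_gt0 : 0 < s ^+ 2 by rewrite exprn_gt0 //; lia.
have step2 N : T (N + 2) =
    1%:~R * t ^ (2 * (- (2 * p * q)) * N + 2 * (- (2 * p * q))) * T N
    + t ^ (- (2 * p * q * (N + 1))) * torus_rest (N + 1).
  have := torus_step2 (N + 1); rewrite -addrA addrK => ->.
  by rewrite mul1r; congr (t ^ _ * _ + _); ring.
have rest2 b : int_lau (fun n => t ^ (- (2 * p * q * (s * n + b + 1))) * torus_rest (s * n + b + 1)).
  have L := LM (LP (- (p * q * s)) (- (p * q * (b + 1)))) (torus_rest_int s (b + 1)).
  apply: eq_int_laurent L => n.
  by congr (t ^ _ * torus_rest _); ring.
have sabs : `|s|%N%:Z = s by lia.
have [s_even|s_odd] := boolP (2 %| s)%Z.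
  have [b [z [z_int zE]]] := iterate_step step2 rest2 `|(s %/ 2)%Z|%N.
  have sE : s = 2 * (s %/ 2)%Z by lia.
  have kE : `|(s %/ 2)%Z|%N%:Z = (s %/ 2)%Z by lia.
  have aE : - (2 * p * q) * `|(s %/ 2)%Z|%N%:Z * s = - (p * q * s ^+ 2).
    rewrite kE; transitivity (- (p * q * s) * (2 * (s %/ 2)%Z)); first by ring.
    by rewrite -sE; ring.
  exists 1%N, (- (p * q * s ^+ 2)), b, 1, z; split; [by left| |by []|by left|].
    move=> n; have := zE n; rewrite expr1n aE kE /torus_slice => <-; congr (T _).
    by rewrite -sE; ring.
  rewrite Gfactor_binomial ?substM_binomial //; last by lia.
  by congr binomialF; ring.
have [q_eq|q_neq] := eqVneq q 2.
  have step1 N : T (N + 1) = (-1)%:~R * t ^ (2 * (- (2 * p)) * N + 2 * (- p)) * T N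
      + t ^ (- (2 * p * N)) * U (2 * N + 1).
    by rewrite torus_step1 // mulrN1z mulN1r; congr (- t ^ _ * _ + _); ring.
  have rest1 b : int_lau (fun n => t ^ (- (2 * p * (s * n + b))) * U (2 * (s * n + b) + 1)).
    have L := LM (LP (- (p * s)) (- (p * b))) (unknot_int (2 * s) (2 * b + 1)).
    apply: eq_int_laurent L => n.
    by congr (t ^ _ * U _); ring.
  have [b [z [z_int zE]]] := iterate_step step1 rest1 `|s|%N.
  exists 1%N, (- (2 * p * s ^+ 2)), b, (-1), z; split; [by right| |by []|by left|].
    have sgE : (-1) ^+ `|s|%N = -1 :> int by rewrite -signr_odd (_ : odd `|s|%N) //; lia.
    have aE : - (2 * p) * s * s = - (2 * p * s ^+ 2) by ring.
    move=> n; have := zE n; rewrite sgE sabs aE /torus_slice => <-; congr (T _).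
    by ring.
  rewrite q_eq Ffactor2 // substM_binomial //.
  by congr binomialF; ring.
have q3 : 2 < q by lia.
have [b [z [z_int zE]]] := iterate_step step2 rest2 `|s|%N.
exists 2%N, (- (2 * p * q * s ^+ 2)), b, 1, z; split; [by left| |by []|by right|].
  have aE : - (2 * p * q) * s * s = - (2 * p * q * s ^+ 2) by ring.
  move=> n; have := zE n; rewrite expr1n sabs aE /torus_slice => <-; congr (T _).
  by ring.
rewrite Ffactor_gt2 // substM_binomial //.
by congr binomialF; ring.
Qed.

Variables (r : int) (C : int -> K).
Hypotheses (C_odd : seq_odd C) (C_cable : cabling t r s T C).
Hypotheses (r_neq0 : r != 0) (r_neq : r != p * q * s).

Lemma cable_at_one_C n : at_one t (C n) n.
Proof. exact: (cable_at_one transcendental C_odd C_cable torus_at_one). Qed.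

Lemma unit_mono_at_one (sg a b n : int) : at_one t (unit_mono t sg a b n) sg.
Proof. by rewrite -[X in at_one _ _ X]mulr1; apply: at_oneM (at_one_int _ _) (at_one_tX _ _). Qed.

Lemma slice_at_one n : at_one t (h n) ((n + 1) * s - 1).
Proof. exact: torus_at_one. Qed.

(** In [cable_rec2] for [C] the value [T ((n+1) s + 1)] is expressed by
    [T ((n+1) s - 1) = h n] through the recurrence of [T]. *)
Lemma cable_step2 n : C (n + 2) = t ^ (- (4 * r * s * (n + 1))) * C n +
  ((t ^ (2 * (r - r * s - 2 * p * q * s) * (n + 1)) - t ^ (2 * (- r - r * s) * (n + 1))) * h n
   + t ^ (2 * (r - r * s - p * q * s) * (n + 1)) * torus_rest ((n + 1) * s)).
Proof.
have := cable_rec2 t_neq0 T_odd C_odd C_cable two (n + 1).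
rewrite addrK torus_step2 -/(h n) (_ : n + 1 + 1 = n + 2); last by ring.
move=> E; set m := n + 1 in E *.
have -> : C (n + 2) = t ^ (- (2 * r * s * m)) * (t ^ (2 * r * s * m) * C (n + 2)).
  by rewrite mulrA (tD t_neq0) addNr expr0z mul1r.
move/eqP: E; rewrite subr_eq => /eqP ->; rewrite -/(h n).
have e1 : t ^ (2 * (r - r * s - 2 * p * q * s) * m) =
    t ^ (- (2 * r * s * m)) * (t ^ (2 * r * m) * t ^ (- (4 * p * q * (m * s)))).
  by rewrite !(tD t_neq0); congr (t ^ _); ring.
have e2 : t ^ (2 * (- r - r * s) * m) = t ^ (- (2 * r * s * m)) * t ^ (- (2 * r * m)).
  by rewrite !(tD t_neq0); congr (t ^ _); ring.
have e3 : t ^ (2 * (r - r * s - p * q * s) * m) =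
    t ^ (- (2 * r * s * m)) * (t ^ (2 * r * m) * t ^ (- (2 * p * q * (m * s)))).
  by rewrite !(tD t_neq0); congr (t ^ _); ring.
have e4 : t ^ (- (4 * r * s * m)) = t ^ (- (2 * r * s * m)) * t ^ (- (2 * r * s * m)).
  by rewrite !(tD t_neq0); congr (t ^ _); ring.
rewrite e1 e2 e3 e4 /torus_slice -/m; move: (C n) (T (m * s - 1)) (torus_rest (m * s)).
move: (t ^ _) (t ^ _) (t ^ _) (t ^ _) (t ^ _) => x1 x2 x3 x4 x5 y1 y2 y3.
by ring.
Qed.

Lemma cable_step1 n : s = 2 ->
  C (n + 1) = - t ^ (- (4 * r * n) - 2 * r) * C n + t ^ (- (2 * r * n)) * T (2 * n + 1).
Proof.
move=> s_eq; have := cable_rec1 t_neq0 T_odd C_odd C_cable two n s_eq => <-.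
rewrite mulrDr !mulrA !(tD t_neq0) addNr expr0z mul1r.
have -> : - (2 * r * n) + (- (2 * r * n) - 2 * r) = - (4 * r * n) - 2 * r by ring.
by rewrite [RHS]addrCA -mulrDl addNr mul0r addr0.
Qed.

Lemma t_minus1_neq0 : t - 1 != 0.
Proof.
rewrite subr_eq0; apply/eqP => t1.
by have /(transcendental_inf transcendental) : t ^ 1 = 1 by rewrite expr1z.
Qed.

(** The expression that has to be nonzero is divided by [t - 1] if [s > 2], since [A]
    vanishes at [t = 1], and then evaluated at [t = 1]; there [g = C(n+2) - C(n)]
    becomes [2] and [A / (t - 1)] becomes [4 (n+1) (r - p q s)]. *)
Lemma cable_relation : exists (d : nat) (a b sg : int) (A w : int -> K),
  [/\ sg = 1 \/ sg = -1,
      forall n, C (n + d%:Z) = unit_mono t sg a b n * C n + (A n * h n + w n),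
      exists (N : nat) c, at_m1 c != 0 /\
        forall n, t ^ (2 * N%:Z * (n + 1)) * A n = zev t c n,
      int_lau w &
   [/\ d = 1%N \/ d = 2%N /\ 2 < s, Ffactor r s = binomialF a d sg &
      forall (d2 : nat) a2 b2 sg2, (0 < d2)%N -> sg2 = 1 \/ sg2 = -1 ->
        let g n := A n * h n + w n in exists n,
        A n * g (n + d2%:Z) - unit_mono t sg2 a2 b2 n * A (n + d2%:Z) * g n != 0]].
Proof.
have [s_eq|s_neq] := eqVneq s 2.
  exists 1%N, (- (2 * r)), (- r), (-1), (fun n => t ^ (2 * (- r) * n)), (fun=> 0%:~R).
  split; [by right| | |exact: int_laurent_int|split].
  - move=> n; rewrite cable_step1 // addr0 /unit_mono mulrN1z mulN1r /torus_slice s_eq.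
    by congr (- t ^ _ * _ + t ^ _ * T _); ring.
  - exists `|r|%N, (monomial (addz `|r| (- r)) `|r|); split.
      by rewrite at_m1_monomial monic_neq0 ?monicXn.
    move=> n; rewrite (zev_monomial transcendental) (tD t_neq0) addzE; last by lia.
    by congr (t ^ _); ring.
  - by left.
  - by rewrite s_eq Ffactor2.
  move=> d2 a2 b2 sg2 d2_gt0 sg2P g; exists 0.
  have tA n : at_one t (t ^ (2 * - r * n)) 1 by apply: at_one_tX.
  have g1 n : at_one t (g n) (1 * ((n + 1) * s - 1) + 0).
    apply: at_oneD (at_one_int _ 0); exact: (at_oneM (tA n) (slice_at_one n)).
  have := at_oneD (at_oneM (tA 0) (g1 (0 + d2%:Z)))
    (at_oneN (at_oneM (at_oneM (unit_mono_at_one sg2 a2 b2 0) (tA (0 + d2%:Z))) (g1 0))).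
  move/(at_one_neq0 transcendental); apply; rewrite s_eq.
  by case: sg2P => ->; lia.
have s3 : 2 < s by lia.
pose e1 := r - r * s - 2 * p * q * s; pose e2 := - r - r * s.
have e12 : e1 - e2 != 0.
  rewrite /e1 /e2; apply: contra r_neq => /eqP E; apply/eqP.
  have /eqP : 2 * (r - p * q * s) = 0 by rewrite -[RHS]E; ring.
  by rewrite mulf_eq0 /= subr_eq0 => /eqP.
pose A n := t ^ (2 * e1 * (n + 1)) - t ^ (2 * e2 * (n + 1)).
pose w n := t ^ (2 * (r - r * s - p * q * s) * (n + 1)) * torus_rest ((n + 1) * s).
have step n : C (n + 2) = unit_mono t 1 (- (2 * r * s)) (- (2 * r * s)) n * C n + (A n * h n + w n).
  by rewrite cable_step2 /unit_mono mul1r; congr (t ^ _ * _ + _); ring.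
exists 2%N, (- (2 * r * s)), (- (2 * r * s)), 1, A, w; split; [by left|by []| | |split].
- pose N := (`|e1| + `|e2|)%N.
  have [leN1 leN2] : `|e1| <= N%:Z /\ `|e2| <= N%:Z by rewrite /N; lia.
  exists N, (monomial (addz N e1) (addz N e1) - monomial (addz N e2) (addz N e2)); split.
    rewrite at_m1D at_m1N !at_m1_monomial subr_eq0; apply/eqP => E.
    have := congr1 (fun P : {poly int} => size P) E; rewrite !size_polyXn => -[E'].
    by have := congr1 Posz E'; rewrite !addzE //; lia.
  move=> n; rewrite zevD zevN !(zev_monomial transcendental) mulrBr !(tD t_neq0) !addzE //.
  by congr (t ^ _ - t ^ _); ring.
- have L := LM (LP (r - r * s - p * q * s) (r - r * s - p * q * s)) (torus_rest_int s s).
  apply: eq_int_laurent L => n; rewrite /w.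
  by congr (t ^ _ * torus_rest _); ring.
- by right.
- by rewrite Ffactor_gt2.
move=> d2 a2 b2 sg2 d2_gt0 sg2P g; exists 0.
have g1 n : at_one t (g n) 2.
  have -> : g n = C (n + 2) + - (unit_mono t 1 (- (2 * r * s)) (- (2 * r * s)) n * C n).
    by rewrite step addrC addKr.
  rewrite [X in at_one _ _ X](_ : _ = (n + 2) + - (1 * n)); last by ring.
  apply: at_oneD (cable_at_one_C _) (at_oneN (at_oneM (unit_mono_at_one _ _ _ _) _)).
  exact: cable_at_one_C.
have Ay n : exists y, at_one t y (2 * (n + 1) * (e1 - e2)) /\ A n = (t - 1) * y.
  have [y [y1 yE]] := at_one_difference transcendental (2 * e1 * (n + 1)) (2 * e2 * (n + 1)).
  exists y; split=> //; move: y1; congr at_one; ring.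
have [y0 [y01 ->]] := Ay 0; have [y [y1 ->]] := Ay (0 + d2%:Z).
have -> : (t - 1) * y0 * g (0 + d2%:Z) - unit_mono t sg2 a2 b2 0 * ((t - 1) * y) * g 0 =
   (t - 1) * (y0 * g (0 + d2%:Z) + - (unit_mono t sg2 a2 b2 0 * y * g 0)).
  by move: (g _) (g _) => x1 x2; ring.
rewrite mulf_neq0 ?t_minus1_neq0 //.
have := at_oneD (at_oneM y01 (g1 (0 + d2%:Z)))
  (at_oneN (at_oneM (at_oneM (unit_mono_at_one sg2 a2 b2 0) y1) (g1 0))).
move/(at_one_neq0 transcendental); apply.
rewrite [X in X != 0](_ : _ = 4 * (e1 - e2) * (1 - sg2 * (d2%:Z + 1))); last by ring.
rewrite mulf_neq0 //; first by rewrite mulf_neq0.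
by case: sg2P => ->; lia.
Qed.

End IteratedCableRecurrences.

(** * Independence for the iterated cable *)

Section IteratedCableIndependence.
Variables (K : fieldType) (t : K).
Hypothesis transcendental : forall P : {poly int}, (map_poly intr P).[t] = 0 -> P = 0.
Let t_neq0 := transcendental_neq0 transcendental.
Let two := two_neq0 transcendental.
Variables (U T C : int -> K) (p q r s : int).
Hypotheses (U_odd : seq_odd U) (T_odd : seq_odd T).
Hypothesis U_val : forall n, 1 <= n ->
  U n = (t ^ (2 * n) - t ^ (- (2 * n))) / (t ^ 2 - t ^ (- 2)).
Hypotheses (T_cable : cabling t p q U T) (C_cable : cabling t r s T C).
Hypotheses (q2 : 2 <= q) (s2 : 2 <= s).

(** Laurent sequences have affine values, those of [h] decrease quadratically. *)
Lemma slice_indep v eps d : valuation t v eps -> eps = 1 \/ eps = -1 -> q < eps * p ->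
  d = 1%N \/ [/\ d = 2%N, 2 < q & ~~ (2 %| s)%Z] ->
  indep t d (torus_slice T s) (laurent t).
Proof.
move=> vP epsP steep dP.
have kap_gt0 : 0 < eps * p * q * s ^+ 2.
  by apply: mulr_gt0; [apply: mulr_gt0; lia | apply: exprn_gt0; lia].
apply: (@indep_sub _ _ _ _ _ (val_growth v 0)) => [e|]; first exact: (growth_laurent vP epsP t_neq0).
have half := slice_half t_neq0 vP epsP U_odd U_val T_cable q2 s2 steep.
case: dP => [->|[-> q3 s_odd]]; first exact: (indep1 vP epsP t_neq0 kap_gt0 half).
exact: (indep2 vP epsP t_neq0 kap_gt0 half
  (slice_other t_neq0 vP epsP U_odd U_val T_cable q2 s2 steep q3 s_odd)).
Qed.

(** The quadratic rate [|r| s] of the values of [C] exceeds the rate of [h], which is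
    [|p| q s^2] or [0] according to the valuation. *)
Lemma cable_indep v eps d d2 : valuation t v eps -> eps = 1 \/ eps = -1 ->
  (q < eps * p /\ eps * p * q * s < eps * r) \/ (q < - (eps * p) /\ 0 < eps * r) ->
  d = 1%N \/ d = 2%N /\ 2 < s ->
  indep t d C (span t d2 (torus_slice T s) (laurent t)).
Proof.
move=> vP epsP slope dP.
have half := cable_half t_neq0 vP epsP U_odd U_val T_odd T_cable q2 s2 C_cable two slope.
have [kap [kap0 kap_lt growth]] : exists kap, [/\ 0 <= kap, kap < eps * r * s &
    val_growth v kap (torus_slice T s)].
  case: slope => [[steep lt_r]|[flat r0]].
    exists (eps * p * q * s ^+ 2); split.
    - by apply: mulr_ge0; [apply: mulr_ge0; lia | apply: exprn_ge0; lia].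
    - by rewrite expr2 mulrA ltr_pM2r //; lia.
    exact: (slice_growth t_neq0 vP epsP U_odd U_val T_odd T_cable q2 s2 steep).
  exists 0; split=> //; first by rewrite mulr_gt0 //; lia.
  exact: (slice_flat t_neq0 vP epsP U_odd U_val T_odd T_cable q2 s2 flat).
apply: (@indep_sub _ _ _ _ _ (val_growth v kap)) => [e|].
  apply: (span_min t_neq0 (growth_module vP epsP t_neq0 kap0) growth) => e'.
  exact: (growth_laurent vP epsP t_neq0 kap0).
case: dP => [->|[-> s3]]; first exact: (indep1 vP epsP t_neq0 kap_lt half).
exact: (indep2 vP epsP t_neq0 kap_lt half (cable_other t_neq0 vP epsP U_odd U_val T_odd
  T_cable q2 s2 C_cable two slope s3)).
Qed.

End IteratedCableIndependence.

(** * The AJ-conjecture for the iterated cable *)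

Theorem theorem1p1 (R : realType) (KT : knot_theory R) (p q r s : int)
    (hpq : coprimez p q) (hq : 2 <= q) (hp : q < `|p|)
    (hrs : coprimez r s) (hs : 2 <= s)
    (hr_pos : 0 < p -> r < 0 \/ p * q * s < r)
    (hr_neg : p < 0 -> 0 < r \/ r < p * q * s) :
  AJ_conjecture KT (cable KT r s (torus_knot KT p q)).
Proof.
pose U := jones KT (unknot KT); pose T := jones KT (torus_knot KT p q).
pose C := jones KT (cable KT r s (torus_knot KT p q)).
have [U_odd T_odd C_odd] : [/\ seq_odd U, seq_odd T & seq_odd C].
  by split=> n; apply: jones_opp.
have U_val := jones_unknot KT.
have T_cable : cabling (tvar R) p q U T by move=> n n1; apply: jones_cable.
have C_cable : cabling (tvar R) r s T C by move=> n n1; apply: jones_cable.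
have trans := @tvar_transcendental R.
have p_neq0 : p != 0 by lia.
have qs_gt0 : 0 < q * s by rewrite mulr_gt0 //; lia.
have [r_neq0 r_neq] : r != 0 /\ r != p * q * s.
  rewrite -mulrA; have [p0|p0] := ltrP 0 p.
    have : 0 < p * (q * s) by rewrite mulr_gt0.
    by have := hr_pos p0; rewrite -mulrA; lia.
  have p0' : p < 0 by lia.
  have : p * (q * s) < 0 by rewrite nmulr_rlt0.
  by have := hr_neg p0'; rewrite -mulrA; lia.
(* The valuation used for [h] depends on the sign of [p], the one used for [C] on the
   side of the excluded interval on which [r] lies. *)
have [v0 v0P] := zero_valuation R[i]; have [vi viP] := infinity_valuation R[i].
have val_exists eps : eps = 1 \/ eps = -1 -> exists v, valuation (tvar R) v eps.
  by case=> ->; [exists v0 | exists vi].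
have [d2 [a2 [b2 [sg2 [z [sg2P rec_h z_int d2P F2]]]]]] := slice_relation trans U_odd T_odd
  U_val T_cable hq hs p_neq0.
have [d [a [b [sg [A [w [sgP rec_C A_int w_int [dP F1 b_neq0]]]]]]]] := cable_relation trans U_odd T_odd
  U_val T_cable hq hs p_neq0 C_odd C_cable r_neq0 r_neq.
have d_gt0 : (0 < d)%N by case: dP => [->|[->]].
have d2_gt0 : (0 < d2)%N by case: d2P => [->|[->]].
have indep_h : indep (tvar R) d2 (torus_slice T s) (laurent (tvar R)).
  have [eps [epsP steep]] : exists eps : int, (eps = 1 \/ eps = -1) /\ q < eps * p.
    have [p0|p0] := ltrP 0 p; [exists 1|exists (-1)]; split; lia.
  have [v vP] := val_exists eps epsP.
  exact: (slice_indep trans U_odd U_val T_cable hq hs vP epsP steep d2P).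
have indep_C : indep (tvar R) d C (span (tvar R) d2 (torus_slice T s) (laurent (tvar R))).
  have [eps [epsP slope]] : exists eps : int, (eps = 1 \/ eps = -1) /\
      ((q < eps * p /\ eps * p * q * s < eps * r) \/ (q < - (eps * p) /\ 0 < eps * r)).
    have [p0|p0] := ltrP 0 p.
      by case: (hr_pos p0) => ?; [exists (-1)|exists 1]; lia.
    have p0' : p < 0 by lia.
    by case: (hr_neg p0') => ?; [exists 1|exists (-1)]; lia.
  have [v vP] := val_exists eps epsP.
  exact: (cable_indep trans U_odd T_odd U_val T_cable C_cable hq hs vP epsP slope dP).
have [al [B [sz kills ord B0 alm1]]] := recurrence_operator trans d_gt0 d2_gt0 rec_C rec_h
  A_int w_int z_int indep_h indep_C (b_neq0 d2 a2 b2 sg2 d2_gt0 sg2P) sgP sg2P.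
have tame := act_tame trans d_gt0 d2_gt0 rec_C rec_h A_int w_int z_int indep_h indep_C.
have AE : NiZhang_apoly p q r s = ('X - 1) * binomialF a d sg * binomialF a2 d2 sg2.
  by rewrite /NiZhang_apoly F1 F2.
rewrite -AE in alm1.
have A_content : content_free (NiZhang_apoly p q r s).
  rewrite AE; apply: content_freeM; last exact: content_free_binomial.
  apply: content_freeM; last exact: content_free_binomial.
  by apply: content_free_monic; rewrite -polyC1 monicXsubC.
have A_neq0 : NiZhang_apoly p q r s != 0.
  apply/eqP => A0.
  have /A_content/(_ 0%N)[x] : coefs_divisible 0 (1 * NiZhang_apoly p q r s).
    by move=> l; exists 0; rewrite A0 mulr0 coef0 mul0r.
  by rewrite coef1 mul0r => /eqP; rewrite oner_eq0.
split; first exact: (recurrence_polynomial_exists sz kills ord tame).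
move=> be be_rec.
have [B' B'0 beE] := recurrence_polynomial_at_m1 sz kills ord B0 A_neq0 A_content alm1 be_rec.
case: (apoly_cable KT hpq hq hp hrs hs) => E.
  by exists B' => //; rewrite beE -E.
exists (- B'); first by rewrite oppr_eq0.
by rewrite beE -[NiZhang_apoly p q r s]opprK -E polyCN mulNr mulrN.
Qed.
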